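(* Let $0<\lambda_1<1$, $0<\lambda_2\le1$, and let $\mu$ be a finite positive Borel measure on $[0,1)$. Let $X,Y$ be Banach spaces of analytic functions on $\mathbb{D}$, continuously embedded in $H(\mathbb{D})$, with $L^{2,\lambda_1}\subseteq X\subseteq\mathcal{B}^{\frac{3-\lambda_1}{2}}$ and $L^{2,\lambda_2}\subseteq Y\subseteq\mathcal{B}^{\frac{3-\lambda_2}{2}}$. Then $\mathcal{C}_\mu$ is bounded from $X$ into $Y$ if and only if $\mu$ is a $\left(1+\frac{\lambda_2-\lambda_1}{2}\right)$-Carleson measure.
   Context: $\mathbb{D}$ is the open unit disc, $H(\mathbb{D})$ the analytic functions on it. For a finite positive Borel measure $\mu$ on $[0,1)$, $\mu_n=\int_{[0,1)}t^n\,d\mu(t)$ and $\mathcal{C}_\mu(f)(z)=\sum_{n\ge0}\big(\mu_n\sum_{k=0}^n a_k\big)z^n=\int_{[0,1)}\frac{f(tz)}{1-tz}\,d\mu(t)$ for $f=\sum a_nz^n$. For $s>0$, $\mu$ is an $s$-Carleson measure if $\mu([t,1))\le C(1-t)^s$ for all $t\in[0,1)$. $\mathcal{B}^\alpha=\{f\in H(\mathbb{D}):|f(0)|+\sup_{z}(1-|z|^2)^\alpha|f'(z)|<\infty\}$. For $0<\lambda\le1$, the Morrey space $L^{2,\lambda}$ is the set of $f\in H^2$ with $|f(0)|+\sup_{I\subset\partial\mathbb{D}}\big(|I|^{-\lambda}\int_I|f(e^{i\theta})-f_I|^2d\theta\big)^{1/2}<\infty$ ($I$ arcs of length $|I|$,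 $f_I$ the mean of the boundary function over $I$). *)

(* Defs.v *)
From mathcomp Require Import all_boot all_algebra.
From mathcomp Require Import all_classical all_reals all_analysis.
From mathcomp Require Export complex.
Import GRing.Theory Num.Theory.
Import numFieldNormedType.Exports.

Set Implicit Arguments.
Unset Strict Implicit.
Unset Printing Implicit Defensive.

Local Open Scope classical_set_scope.
Local Open Scope ring_scope.

Section Defs.
Variable R : realType.

Definition cmod (z : R[i]) : R := Num.sqrt (complex.Re z ^+ 2 + complex.Im z ^+ 2).

Definition cexpi (t : R) : R[i] := (cos t +i* sin t)%C.

Definition rC (x : R) : R[i] := (x +i* 0)%C.

Definition cpsum (u : nat -> R[i]) (n : nat) : R[i] := \sum_(k < n) u k.

Definition cseries_to (u : nat -> R[i]) (l : R[i]) : Prop :=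
  ((fun n => complex.Re (cpsum u n)) @ \oo --> complex.Re l) /\
  ((fun n => complex.Im (cpsum u n)) @ \oo --> complex.Im l).

(* Analytic functions on the disc are represented by their Taylor
   coefficients (a_n); such an (a_n) represents an element of H(D) iff the
   power series converges at every point of the open unit disc. *)
Definition HD : set (nat -> R[i]) :=
  [set a | forall z : R[i], cmod z < 1 ->
           exists l, cseries_to (fun n => a n * z ^+ n) l].

Definition peval (a : nat -> R[i]) (z : R[i]) : R[i] :=
  (lim ((fun n => complex.Re (cpsum (fun k => a k * z ^+ k) n)) @ \oo) +i*
   lim ((fun n => complex.Im (cpsum (fun k => a k * z ^+ k) n)) @ \oo))%C.

Definition is_cderiv (f : R[i] -> R[i]) (z d : R[i]) : Prop :=
  forall e : R, 0 < e -> exists2 del : R, 0 < del &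
    forall h : R[i], 0 < cmod h < del ->
      cmod ((f (z + h) - f z) / h - d) < e.

Definition Bloch (alpha : R) : set (nat -> R[i]) :=
  [set a | HD a /\ exists M : R, forall z d : R[i], cmod z < 1 ->
      is_cderiv (peval a) z d ->
      (1 - cmod z ^+ 2) `^ alpha * cmod d <= M].

Definition H2 : set (nat -> R[i]) :=
  [set a | HD a /\ exists M : R, forall r : R, 0 <= r < 1 ->
      (\int[lebesgue_measure]_(t in `[0%R, (2 * pi)%R]%classic)
          ((cmod (peval a (rC r * cexpi t))) ^+ 2)%:E <= M%:E)%E].

Definition bdry (a : nat -> R[i]) (t : R) : R[i] :=
  (lim ((fun r : R => complex.Re (peval a (rC r * cexpi t))) @ at_left 1) +i*
   lim ((fun r : R => complex.Im (peval a (rC r * cexpi t))) @ at_left 1))%C.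

Definition Lint (g : R -> R) (s l : R) : R :=
  fine (\int[lebesgue_measure]_(t in `[s, (s + l)%R]%classic) (g t)%:E)%E.

Definition arc_mean (a : nat -> R[i]) (s l : R) : R[i] :=
  ((Lint (fun t => complex.Re (bdry a t)) s l / l) +i*
   (Lint (fun t => complex.Im (bdry a t)) s l / l))%C.

(* Morrey space L^{2,lambda}: arcs I of the unit circle are parametrized
   by a starting angle s and their length |I| = l with 0 < l <= 2 pi *)
Definition Morrey (lam : R) : set (nat -> R[i]) :=
  [set a | H2 a /\ exists M : R, forall s l : R, 0 < l <= 2 * pi ->
      (\int[lebesgue_measure]_(t in `[s, (s + l)%R]%classic)
          ((cmod (bdry a t - arc_mean a s l)) ^+ 2)%:E
        <= (M * l `^ lam)%:E)%E].

(* (X, N) is a complex Banach space of analytic functions on D,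
   continuously embedded in H(D) (topology of uniform convergence on
   compact subsets of D) *)
Definition banach_HD (X : set (nat -> R[i])) (N : (nat -> R[i]) -> R) : Prop :=
  [/\ X `<=` HD,
      X (fun _ => 0) /\
      (forall f g, X f -> X g -> X (fun n => f n + g n)) /\
      (forall (c : R[i]) f, X f -> X (fun n => c * f n)),
      (forall f, X f -> 0 <= N f) /\
      (forall f, X f -> N f = 0 -> f = (fun _ => 0)) /\
      (forall (c : R[i]) f, X f -> N (fun n => c * f n) = cmod c * N f) /\
      (forall f g, X f -> X g -> N (fun n => f n + g n) <= N f + N g),
      (forall u : nat -> nat -> R[i], (forall m, X (u m)) ->
         (forall e : R, 0 < e -> exists K : nat, forall m n, (K <= m)%N ->
            (K <= n)%N -> N (fun k => u m k - u n k) < e) ->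
         exists2 f, X f & forall e : R, 0 < e -> exists K : nat,
            forall n, (K <= n)%N -> N (fun k => u n k - f k) < e) &
      (forall r : R, 0 <= r < 1 -> exists C : R, forall f, X f ->
         forall z, cmod z <= r -> cmod (peval f z) <= C * N f)].

Definition moment (mu : {measure set R -> \bar R}) (n : nat) : R :=
  fine (\int[mu]_(t in `[0%R, 1%R[%classic) (t ^+ n)%:E)%E.

Definition Cmu (mu : {measure set R -> \bar R}) (a : nat -> R[i]) : nat -> R[i] :=
  fun n => rC (moment mu n) * \sum_(k < n.+1) a k.

Definition bounded_op (T : (nat -> R[i]) -> (nat -> R[i]))
    (X : set (nat -> R[i])) (NX : (nat -> R[i]) -> R)
    (Y : set (nat -> R[i])) (NY : (nat -> R[i]) -> R) : Prop :=
  (forall f, X f -> Y (T f)) /\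
  exists C : R, forall f, X f -> NY (T f) <= C * NX f.

Definition carleson (mu : {measure set R -> \bar R}) (s : R) : Prop :=
  exists C : R, forall t : R, 0 <= t < 1 ->
    (mu `[t, 1%R[%classic <= (C * (1 - t) `^ s)%:E)%E.

End Defs.

(* Main.v *)
Require Import Defs.
From mathcomp Require Import all_boot all_order all_algebra.
From mathcomp Require Import all_classical all_reals all_analysis.
From mathcomp Require Import measurable_realfun complex ring lra.
Import Order.TTheory GRing.Theory Num.Theory.
Import numFieldNormedType.Exports.

Set Implicit Arguments.
Unset Strict Implicit.
Unset Printing Implicit Defensive.

Local Open Scope classical_set_scope.
Local Open Scope ring_scope.

(* The operator is [C_mu f (z) = int F (t z) dmu(t)] with [F (w) = f (w) / (1 - w)].
   For [f] in the Bloch space of exponent [al > 1] one has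
   [|f (w)| <= K (1 - |w|)^(1 - al)] and a Lipschitz bound
   [K |x - y| (1 - t)^(- al)] along circles of radius [t].  On an arc of length
   [l], split the boundary function of [C_mu f] at [t = 1 - l]: for [t >= 1 - l]
   the size of [F] is used, with [|1 - t e^(ix)| >= (1 - t)^(1 - ep) (d / 2)^ep],
   [d = |1 - e^(ix)|]; for [t < 1 - l] the variation of [F] along the arc is
   used.  Dyadic summation against the Carleson condition bounds the oscillation
   by [l^((lam - 1) / 2) (1 + (l / d)^ep)], which gives membership in the Morrey
   space for every [0 < lam <= 1] at once.  Boundedness from [X] to [Y] then
   follows from the closed graph theorem.

   Conversely, the same estimate applied to the constant function [1] and a
   measure [nu] with [nu [t, 1) ~ (1 - t)^((1 + lam1) / 2)] produces an element
   of the Morrey space with nonnegative coefficients whose partial sums grow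
   like [n^((1 - lam1) / 2)].  The Bloch bound on the derivative of its image at
   [r = 1 - 1 / (4 N)] forces [mu_(2N) = O (N^(- s))], which is the Carleson
   condition. *)

(** The endpoint [lam2 = 1] shapes the sufficiency proof. There the Carleson exponent equals
    [al = (3 - lam1) / 2], and the plain bound [|F (t z)| <= K (1 - t)^(- al)] may have a divergent
    integral. Moving a power [ep] of the kernel onto the distance to [1] restores integrability in
    [t] at the price of a singularity in the angle, harmless while it is square integrable. This
    asks for [(1 - lam) / 2 < ep < 1 / 2], a nonempty range exactly when [lam > 0]. The condition
    [lam1 < 1] enters as [al > 1], which keeps a logarithm out of the growth of Bloch functions.
    Only set inclusions tie [X] and [Y] to the Morrey and Bloch spaces, with no inequality between
    norms. Membership alone has to yield a norm bound, hence the closed graph theorem; continuity of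
    point evaluations supplies the closedness. For the converse the inclusions are used at their
    extremes: the test function lies in the smallest admissible [X], and its image is tested only
    through the largest admissible [Y]. *)

Section ComplexModulus.
Variable R : realType.
Implicit Types (z w : R[i]) (x y : R).

(** * Modulus, components and limits of complex numbers *)

Lemma cmodE z : (cmod z)%:C%C = `|z|.
Proof. by rewrite normc_def. Qed.

Lemma cmod_ge0 z : 0 <= cmod z.
Proof. exact: sqrtr_ge0. Qed.

Lemma cmodM z w : cmod (z * w) = cmod z * cmod w.
Proof. by apply: complexI; rewrite rmorphM /= !cmodE normrM. Qed.

Lemma cmodV z : cmod z^-1 = (cmod z)^-1.
Proof. by apply: complexI; rewrite fmorphV /= !cmodE normfV. Qed.

Lemma cmodX z n : cmod (z ^+ n) = cmod z ^+ n.
Proof. by apply: complexI; rewrite rmorphXn /= !cmodE normrX. Qed.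

Lemma cmodN z : cmod (- z) = cmod z.
Proof. by apply: complexI; rewrite !cmodE normrN. Qed.

Lemma cmodD z w : cmod (z + w) <= cmod z + cmod w.
Proof. by rewrite -lecR rmorphD /= !cmodE ler_normD. Qed.

Lemma cmodBD z w : cmod (z - w) <= cmod z + cmod w.
Proof. by rewrite -(cmodN w) cmodD. Qed.

Lemma cmod_rev z w : cmod z - cmod w <= cmod (z - w).
Proof. by rewrite lerBlDr; apply: le_trans (cmodD _ _); rewrite subrK. Qed.

Lemma cmod_eq0 z : (cmod z == 0) = (z == 0).
Proof. by rewrite -(inj_eq (@complexI R)) cmodE normr_eq0. Qed.

Lemma cmod0 : cmod (0 : R[i]) = 0.
Proof. by apply/eqP; rewrite cmod_eq0. Qed.

Lemma cmod_gt0 z : (0 < cmod z) = (z != 0).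
Proof. by rewrite lt_def cmod_eq0 cmod_ge0 andbT. Qed.

Lemma cmod_rC x : cmod (rC x) = `|x|.
Proof. by rewrite /cmod /= expr0n addr0 sqrtr_sqr. Qed.

Lemma cmod1 : cmod (1 : R[i]) = 1.
Proof. by rewrite -[1]/(rC 1) cmod_rC normr1. Qed.

Lemma cmod_nat n : cmod (n%:R : R[i]) = n%:R.
Proof.
by apply: complexI; rewrite cmodE normr_nat (rmorph_nat (real_complex R)).
Qed.

Lemma cmod_sum (I : finType) (P : pred I) (F : I -> R[i]) :
  cmod (\sum_(i | P i) F i) <= \sum_(i | P i) cmod (F i).
Proof.
rewrite -lecR rmorph_sum /= cmodE [leRHS](eq_bigr (fun i => `|F i|)); last first.
  by move=> i _; exact: cmodE.
exact: ler_norm_sum.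
Qed.

Lemma cmod_cexpi x : cmod (cexpi x) = 1.
Proof. by rewrite /cmod /= cos2Dsin2 sqrtr1. Qed.

Lemma cmod_sqr z : cmod z ^+ 2 = complex.Re z ^+ 2 + complex.Im z ^+ 2.
Proof. by rewrite sqr_sqrtr // addr_ge0 // sqr_ge0. Qed.

Lemma Re_le_cmod z : `|complex.Re z| <= cmod z.
Proof. by rewrite -sqrtr_sqr ler_wsqrtr // lerDl sqr_ge0. Qed.

Lemma Im_le_cmod z : `|complex.Im z| <= cmod z.
Proof. by rewrite -sqrtr_sqr ler_wsqrtr // lerDr sqr_ge0. Qed.

Lemma cmod_le_ReIm z : cmod z <= `|complex.Re z| + `|complex.Im z|.
Proof.
have h : 0 <= `|complex.Re z| + `|complex.Im z| by rewrite addr_ge0.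
rewrite -(ger0_norm h) -sqrtr_sqr; apply: ler_wsqrtr.
by rewrite sqrrD !real_normK ?num_real// lerD2r lerDl mulrn_wge0 // mulr_ge0.
Qed.

Lemma ReD z w : complex.Re (z + w) = complex.Re z + complex.Re w.
Proof. by case: z; case: w. Qed.
Lemma ImD z w : complex.Im (z + w) = complex.Im z + complex.Im w.
Proof. by case: z; case: w. Qed.
Lemma ReB z w : complex.Re (z - w) = complex.Re z - complex.Re w.
Proof. by case: z; case: w. Qed.
Lemma ImB z w : complex.Im (z - w) = complex.Im z - complex.Im w.
Proof. by case: z; case: w. Qed.
Lemma ReM z w : complex.Re (z * w) =
  complex.Re z * complex.Re w - complex.Im z * complex.Im w.
Proof. by case: z; case: w. Qed.
Lemma ImM z w : complex.Im (z * w) =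
  complex.Re z * complex.Im w + complex.Im z * complex.Re w.
Proof. by case: z => a b; case: w => c d /=. Qed.
Lemma Re_rCM x z : complex.Re (rC x * z) = x * complex.Re z.
Proof. by rewrite ReM /= mul0r subr0. Qed.
Lemma Im_rCM x z : complex.Im (rC x * z) = x * complex.Im z.
Proof. by rewrite ImM /= mul0r addr0. Qed.
Lemma Re_sum (I : finType) (P : pred I) (F : I -> R[i]) :
  complex.Re (\sum_(i | P i) F i) = \sum_(i | P i) complex.Re (F i).
Proof. exact: (big_morph (@complex.Re R) ReD (erefl : complex.Re 0 = 0)). Qed.
Lemma Im_sum (I : finType) (P : pred I) (F : I -> R[i]) :
  complex.Im (\sum_(i | P i) F i) = \sum_(i | P i) complex.Im (F i).
Proof. exact: (big_morph (@complex.Im R) ImD (erefl : complex.Im 0 = 0)). Qed.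

Lemma rC0 : rC 0 = 0 :> R[i].
Proof. by []. Qed.

Lemma rC1 : rC 1 = 1 :> R[i].
Proof. by []. Qed.

Lemma rCM x y : rC (x * y) = rC x * rC y.
Proof. exact: (rmorphM (real_complex R)). Qed.

Lemma rCB x y : rC (x - y) = rC x - rC y.
Proof. exact: (rmorphB (real_complex R)). Qed.

Lemma rCX x n : rC (x ^+ n) = rC x ^+ n.
Proof. exact: (rmorphXn (real_complex R)). Qed.

(** Componentwise, so that [cseries_to u l] unfolds to [ccvg (cpsum u) l] and membership in [HD]
    supplies limits directly; [ccvgP] translates to the modulus for estimates. *)
Definition ccvg (u : nat -> R[i]) (l : R[i]) : Prop :=
  ((fun n => complex.Re (u n)) @ \oo --> complex.Re l) /\
  ((fun n => complex.Im (u n)) @ \oo --> complex.Im l).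

Lemma ccvgP (u : nat -> R[i]) l :
  ccvg u l <-> (fun n => cmod (u n - l)) @ \oo --> (0 : R).
Proof.
split=> [[/cvgrPdist_lt hR /cvgrPdist_lt hI]|/cvgr0Pnorm_lt h].
  apply/cvgr0Pnorm_lt => e e0.
  have e2 : 0 < e / 2 by rewrite divr_gt0.
  near=> n.
  rewrite ger0_norm ?cmod_ge0//; apply: le_lt_trans (cmod_le_ReIm _) _.
  rewrite (splitr e) ltrD // ?ReB ?ImB distrC; near: n;
    [exact: hR | exact: hI].
split; apply/cvgrPdist_lt => e e0; near=> n;
  rewrite distrC -?ReB -?ImB; [apply: le_lt_trans (Re_le_cmod _) _|
  apply: le_lt_trans (Im_le_cmod _) _];
  rewrite -[cmod _]ger0_norm ?cmod_ge0//; near: n; exact: h.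
Unshelve. all: by end_near. Qed.

Lemma ccvg_unique (u : nat -> R[i]) l l' : ccvg u l -> ccvg u l' -> l = l'.
Proof.
case: l l' => [a b] [c d] [/= h1 h2] [/= h3 h4].
by rewrite (cvg_unique _ h1 h3) ?(cvg_unique _ h2 h4).
Qed.

Lemma eq_ccvg (u v : nat -> R[i]) l :
  u =1 v -> ccvg u l -> ccvg v l.
Proof. by move=> /funext ->. Qed.

Lemma ccvg_cst z : ccvg (fun=> z) z.
Proof. by split; exact: cvg_cst. Qed.

Lemma ccvgD (u v : nat -> R[i]) l l' :
  ccvg u l -> ccvg v l' -> ccvg (fun n => u n + v n) (l + l').
Proof.
move=> [u1 u2] [v1 v2]; split.
  by under eq_fun do rewrite ReD; rewrite ReD; exact: cvgD.
by under eq_fun do rewrite ImD; rewrite ImD; exact: cvgD.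
Qed.

Lemma ccvgM (u v : nat -> R[i]) l l' :
  ccvg u l -> ccvg v l' -> ccvg (fun n => u n * v n) (l * l').
Proof.
move=> [u1 u2] [v1 v2]; split.
  by under eq_fun do rewrite ReM; rewrite ReM; apply: cvgB; exact: cvgM.
by under eq_fun do rewrite ImM; rewrite ImM; apply: cvgD; exact: cvgM.
Qed.

Lemma ccvgZ c (u : nat -> R[i]) l :
  ccvg u l -> ccvg (fun n => c * u n) (c * l).
Proof. by apply: ccvgM; exact: ccvg_cst. Qed.

Lemma ccvgB (u v : nat -> R[i]) l l' :
  ccvg u l -> ccvg v l' -> ccvg (fun n => u n - v n) (l - l').
Proof.
move=> hu hv; rewrite -mulN1r.
have := ccvgD hu (ccvgZ (-1) hv).
by under eq_fun do rewrite mulN1r.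
Qed.

Lemma ccvg_shift (u : nat -> R[i]) l : ccvg u l -> ccvg (fun n => u n.+1) l.
Proof.
by move=> [h1 h2]; split;
  [move: h1|move: h2]; rewrite -cvg_shiftS /=.
Qed.

Lemma ccvg_bound (u : nat -> R[i]) l B :
  (forall n, cmod (u n) <= B) -> ccvg u l -> cmod l <= B.
Proof.
move=> hB /ccvgP h; apply/ler_addgt0Pr => e e0.
move/cvgr0Pnorm_lt : h => /(_ e e0) [N _ /(_ N (leqnn N)) /=].
rewrite ger0_norm ?cmod_ge0// => hN.
have -> : l = u N - (u N - l) by rewrite subKr.
by apply: le_trans (cmodBD _ _) _; rewrite lerD ?hB ?ltW.
Qed.

Lemma ccvg_pinching (u : nat -> R[i]) l (v : nat -> R) :
  (forall n, cmod (u n - l) <= v n) -> v @ \oo --> (0 : R) -> ccvg u l.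
Proof.
move=> huv v0; apply/ccvgP.
apply: (squeeze_cvgr _ (cvg_cst 0) v0).
by apply: nearW => n; rewrite cmod_ge0 huv.
Qed.

Lemma cexpiD x y : cexpi (x + y) = cexpi x * cexpi y.
Proof.
apply/eqP; rewrite eq_complex /= cosD sinD eqxx /=.
by apply/eqP; ring.
Qed.

Lemma cexpi0 : cexpi 0 = 1 :> R[i].
Proof. by rewrite /cexpi cos0 sin0. Qed.

End ComplexModulus.

(** * Power series on the disc: derivative, mean value inequality, identity theorem *)

Section PowerSeries.
Variable R : realType.
Implicit Types (z w : R[i]) (x y : R) (a : nat -> R[i]).

Lemma geom_sum_le (q : R) n : 0 <= q < 1 -> \sum_(k < n) q ^+ k <= (1 - q)^-1.
Proof.
move=> /andP[q0 q1]; have q1' : 0 < 1 - q by rewrite subr_gt0.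
rewrite -[leRHS]mul1r ler_pdivlMr// mulrC -opprB mulNr -subrX1 opprB.
by rewrite lerBlDr lerDl exprn_ge0.
Qed.

(** Each of the [n] copies of [q ^+ n] is matched with a different larger term [q ^+ i], [i < n], of
    the geometric sum. *)
Lemma nat_geom_le (q : R) n : 0 <= q < 1 -> n%:R * q ^+ n <= (1 - q)^-1.
Proof.
move=> q01; apply: le_trans (geom_sum_le n q01); case/andP: q01 => q0 q1.
apply: le_trans (_ : \sum_(i < n) q ^+ n <= _).
  by rewrite sumr_const card_ord mulr_natl.
apply: ler_sum => i _.
by apply: ler_wiXn2l => //; [exact: ltW | exact: ltnW].
Qed.

(** Absolute convergence on every radius below [1], phrased by bounded partial sums so that only
    real numbers occur; [HD_absum] identifies it with [HD]. *)
Definition absum a : Prop := forall r : R, 0 <= r < 1 ->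
  exists2 B : R, 0 <= B & forall n, \sum_(k < n) cmod (a k) * r ^+ k <= B.

(** Abel's lemma: bounded terms at the larger radius [q = (1 + r) / 2] leave a geometric series of
    ratio [r / q] at radius [r]. *)
Lemma bounded_absum a :
  (forall r : R, 0 <= r < 1 ->
     exists2 B : R, 0 <= B & forall n, cmod (a n) * r ^+ n <= B) -> absum a.
Proof.
move=> ha r /andP[r0 r1]; pose q := (1 + r) / 2.
have q0 : 0 < q by rewrite /q; lra.
have [B B0 hB] : exists2 B : R, 0 <= B & forall n, cmod (a n) * q ^+ n <= B.
  by apply: ha; rewrite /q; apply/andP; split; lra.
have rq : 0 <= r / q < 1.
  by rewrite divr_ge0 ?(ltW q0)//= ltr_pdivrMr// mul1r /q; lra.
exists (B * (1 - r / q)^-1) => [|n].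
  by rewrite mulr_ge0// invr_ge0 subr_ge0; case/andP: rq => _ /ltW.
apply: le_trans (ler_wpM2l B0 (geom_sum_le n rq)).
rewrite mulr_sumr; apply: ler_sum => k _.
have -> : cmod (a k) * r ^+ k = cmod (a k) * q ^+ k * (r / q) ^+ k.
  by rewrite -mulrA -exprMn mulrCA divff ?mulr1 // gt_eqF.
by apply: ler_wpM2r => //; rewrite exprn_ge0//; case/andP: rq.
Qed.

Lemma absum_bound a : absum a -> forall r : R, 0 <= r < 1 ->
  exists2 B : R, 0 <= B & forall n, cmod (a n) * r ^+ n <= B.
Proof.
move=> ha r r01; have [B B0 hB] := ha _ r01; exists B => // n.
apply: le_trans (hB n.+1); rewrite big_ord_recr /= lerDr sumr_ge0// => i _.
by rewrite mulr_ge0 ?cmod_ge0// exprn_ge0//; case/andP: r01.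
Qed.

Lemma absum_cseries (u : nat -> R[i]) (B : R) :
  (forall n, \sum_(k < n) cmod (u k) <= B) ->
  exists l, cseries_to u l.
Proof.
move=> hB.
have key (f : R[i] -> R) : (forall z, `|f z| <= cmod z) ->
    cvgn (fun n => \sum_(k < n) f (u k)).
  move=> hf; have -> : (fun n => \sum_(k < n) f (u k)) =
      series (fun k => f (u k)).
    by apply/funext => n; rewrite /series /= big_mkord.
  apply: normed_cvg; apply: nondecreasing_is_cvgn.
    by apply: nondecreasing_series => k _ _ /=.
  exists B => _ [n _ <-] /=; rewrite /series /= big_mkord.
  by apply: le_trans (hB n); apply: ler_sum.
have h1 := key _ (@Re_le_cmod R); have h2 := key _ (@Im_le_cmod R).
exists ((lim ((fun n => \sum_(k < n) complex.Re (u k)) @ \oo)) +i*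
  (lim ((fun n => \sum_(k < n) complex.Im (u k)) @ \oo)))%C.
by split => /=; [under eq_fun do rewrite /cpsum Re_sum |
  under eq_fun do rewrite /cpsum Im_sum].
Qed.

Lemma absum_peval_cvg a z : absum a -> cmod z < 1 ->
  ccvg (cpsum (fun n => a n * z ^+ n)) (peval a z).
Proof.
move=> ha z1; have z01 : 0 <= cmod z < 1 by rewrite cmod_ge0.
have [B _ hB] := ha _ z01.
have [n|l [h1 h2]] := @absum_cseries (fun n => a n * z ^+ n) B.
  by under eq_bigr do rewrite cmodM cmodX.
have -> : peval a z = l.
  rewrite /peval; case: l h1 h2 => x y /= h1 h2.
  by rewrite (cvg_lim _ h1)// (cvg_lim _ h2).
by split.
Qed.

(** Convergence at the single point [rC r] forces the terms to tend to [0], hence to be bounded, and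
    Abel's lemma applies. *)
Lemma HD_absum a : HD a <-> absum a.
Proof.
split=> [ha|ha z z1]; last first.
  by exists (peval a z); exact: absum_peval_cvg.
apply: bounded_absum => r /andP[r0 r1].
have hr : cmod (rC r) < 1 by rewrite cmod_rC ger0_norm.
have [l hl] := ha _ hr.
have : ccvg (fun n => a n * rC r ^+ n) (l - l).
  have := ccvgB (ccvg_shift hl) hl.
  by under eq_fun do rewrite /cpsum big_ord_recr /= addrAC subrr add0r.
rewrite subrr => /ccvgP h.
have [M [Mr hM]] := cvg_seq_bounded (cvgP _ h).
exists (`|M| + 1) => [|n]; first by rewrite addr_ge0.
have M1 : M < `|M| + 1 by rewrite (le_lt_trans (ler_norm M)) // ltrDl.
have /= := hM _ M1 n I; rewrite subr0 ger0_norm ?cmod_ge0//.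
by rewrite cmodM cmodX cmod_rC ger0_norm.
Qed.

Lemma peval_cvg a z : HD a -> cmod z < 1 ->
  ccvg (cpsum (fun n => a n * z ^+ n)) (peval a z).
Proof. by move=> /HD_absum; exact: absum_peval_cvg. Qed.

Lemma peval_unique a z l :
  ccvg (cpsum (fun n => a n * z ^+ n)) l -> peval a z = l.
Proof.
case: l => x y [/= h1 h2].
by rewrite /peval (cvg_lim _ h1)// (cvg_lim _ h2).
Qed.

Lemma HDB a b : HD a -> HD b -> HD (fun n => a n - b n).
Proof.
move=> ha hb z z1; exists (peval a z - peval b z).
have := ccvgB (peval_cvg ha z1) (peval_cvg hb z1).
apply: eq_ccvg => n.
by rewrite /cpsum -sumrB; apply: eq_bigr => i _; rewrite mulrBl.
Qed.

Lemma pevalB a b z : HD a -> HD b -> cmod z < 1 ->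
  peval (fun n => a n - b n) z = peval a z - peval b z.
Proof.
move=> ha hb z1; apply: peval_unique.
have := ccvgB (peval_cvg ha z1) (peval_cvg hb z1).
apply: eq_ccvg => n.
by rewrite /cpsum -sumrB; apply: eq_bigr => i _; rewrite mulrBl.
Qed.

(** Passing to a larger radius gains a factor [(r / q) ^+ n], which absorbs [n] by [nat_geom_le]. *)
Lemma absum_natM a : absum a -> absum (fun n => n%:R * a n).
Proof.
move=> ha; apply: bounded_absum => r /andP[r0 r1]; pose q := (1 + r) / 2.
have q0 : 0 < q by rewrite /q; lra.
have [B B0 hB] : exists2 B : R, 0 <= B & forall n, cmod (a n) * q ^+ n <= B.
  by apply: absum_bound => //; rewrite /q; apply/andP; split; lra.
have rq : 0 <= r / q < 1.
  by rewrite divr_ge0 ?(ltW q0)//= ltr_pdivrMr// mul1r /q; lra.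
have rq1 : 0 <= (1 - r / q)^-1.
  by rewrite invr_ge0 subr_ge0; case/andP: rq => _ /ltW.
exists (B * (1 - r / q)^-1) => [|n]; first by rewrite mulr_ge0.
rewrite cmodM cmod_nat.
have -> : n%:R * cmod (a n) * r ^+ n =
    cmod (a n) * q ^+ n * (n%:R * (r / q) ^+ n).
  rewrite mulrACA -exprMn [q * _]mulrC divfK ?gt_eqF//; ring.
apply: ler_pM; rewrite ?hB ?nat_geom_le//.
  by rewrite mulr_ge0 ?cmod_ge0// exprn_ge0// ltW.
by rewrite mulr_ge0// exprn_ge0//; case/andP: rq.
Qed.

(** Taylor coefficients of the derivative; [peval_cderiv] proves that they represent it. *)
Definition dcoef a : nat -> R[i] := fun n => n.+1%:R * a n.+1.

Lemma absum_dcoef a : absum a -> absum (dcoef a).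
Proof.
move=> /absum_natM/absum_bound ha; apply: bounded_absum => r r01.
pose q := (1 + r) / 2; case/andP: r01 => r0 r1.
have q0 : 0 < q by rewrite /q; lra.
have [B B0 hB] : exists2 B : R, 0 <= B & forall n,
    cmod (n%:R * a n) * q ^+ n <= B.
  by apply: ha; rewrite /q; apply/andP; split; lra.
exists (B / q) => [|n]; first by rewrite divr_ge0 // ltW.
rewrite ler_pdivlMr// -mulrA; apply: le_trans (hB n.+1).
rewrite /dcoef exprSr; apply: ler_wpM2l; first exact: cmod_ge0.
apply: ler_wpM2r; first exact: ltW.
by rewrite lerXn2r ?nnegrE ?(ltW q0)// /q; lra.
Qed.

Lemma HD_dcoef a : HD a -> HD (dcoef a).
Proof. by move=> /HD_absum/absum_dcoef/HD_absum. Qed.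

(* [E k.+1 = w E k + k (w - z)^2 z^(k-1)] for the second-order Taylor remainder *)
Lemma expr_taylor2 z w (r : R) k : cmod z <= r -> cmod w <= r ->
  cmod (w ^+ k - z ^+ k - (w - z) * (k%:R * z ^+ k.-1)) * r ^+ 2 <=
  cmod (w - z) ^+ 2 * (k%:R * (k%:R * r ^+ k)).
Proof.
move=> zr wr; have r0 : 0 <= r := le_trans (cmod_ge0 _) zr.
elim: k => [|k IH].
  by rewrite !expr0 subrr sub0r mul0r mulr0 oppr0 cmod0 !mul0r mulr0.
set E := w ^+ k - _ - _ in IH.
have -> : w ^+ k.+1 - z ^+ k.+1 - (w - z) * (k.+1%:R * z ^+ k.+1.-1) =
    w * E + k%:R * ((w - z) ^+ 2 * z ^+ k.-1).
  rewrite /E /= -[k.+1]addn1 natrD; case: k {IH E} => [|k] /=.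
    by rewrite !expr0 !expr1 !mul0r; ring.
  by rewrite addn1 !exprS; ring.
apply: le_trans (_ : (cmod w * cmod E + k%:R * (cmod (w - z) ^+ 2 *
    cmod z ^+ k.-1)) * r ^+ 2 <= _).
  apply: ler_wpM2r; first exact: exprn_ge0.
  by apply: le_trans (cmodD _ _) _; rewrite !cmodM !cmodX cmod_nat.
set d := cmod (w - z) in IH *; have d0 : 0 <= d by exact: cmod_ge0.
have h1 : cmod w * cmod E * r ^+ 2 <= r * (d ^+ 2 * (k%:R * (k%:R * r ^+ k))).
  rewrite -mulrA; apply: ler_pM => //; first exact: cmod_ge0.
  by rewrite mulr_ge0 ?cmod_ge0 ?exprn_ge0.
have h2 : k%:R * (d ^+ 2 * cmod z ^+ k.-1) * r ^+ 2 <=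
    k%:R * (d ^+ 2 * r ^+ k.+1).
  case: k {IH E h1} => [|k /=]; first by rewrite !mul0r.
  rewrite -2!mulrA; apply: ler_wpM2l => //; apply: ler_wpM2l; first exact: exprn_ge0.
  rewrite -[k.+2]addn2 exprD; apply: ler_wpM2r; first exact: exprn_ge0.
  by rewrite lerXn2r ?nnegrE ?cmod_ge0.
rewrite mulrDl; apply: le_trans (lerD h1 h2) _.
rewrite [r ^+ k.+1]exprS -natr1 -subr_ge0.
set K : R := k%:R; have K0 : 0 <= K by exact: ler0n.
have -> : d ^+ 2 * ((K + 1) * ((K + 1) * (r * r ^+ k))) -
  (r * (d ^+ 2 * (K * (K * r ^+ k))) + K * (d ^+ 2 * (r * r ^+ k))) =
  (K + 1) * (d ^+ 2 * (r * r ^+ k)) by ring.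
by rewrite mulr_ge0 ?addr_ge0 ?mulr_ge0 ?exprn_ge0.
Qed.

(** The term [k = 0] is killed by its factor [k], so the junk exponent [0.-1] is harmless and the
    index shifts by one. *)
Lemma cpsum_dcoef a z n :
  cpsum (fun k => a k * (k%:R * z ^+ k.-1)) n.+1 =
  cpsum (fun k => dcoef a k * z ^+ k) n.
Proof.
rewrite /cpsum big_ord_recl mul0r mulr0 add0r; apply: eq_bigr => i _.
by rewrite /dcoef /= /bump /= add1n mulrCA mulrA.
Qed.

(** Summing [expr_taylor2] against the coefficients leaves a series of [k^2 |a k| r^k], bounded
    because [absum] survives two multiplications by [n]. This remainder, uniform on the closed disc
    of radius [r], yields the derivative, the mean value inequality, continuity and the identity
    theorem. *)
Lemma peval_taylor2 a (r : R) : HD a -> 0 < r < 1 ->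
  exists2 K : R, 0 <= K & forall z w, cmod z <= r -> cmod w <= r ->
    cmod (peval a w - peval a z - (w - z) * peval (dcoef a) z) <=
    K * cmod (w - z) ^+ 2.
Proof.
move=> ha /andP[r0 r1]; have r01 : 0 <= r < 1 by rewrite ltW.
have [B B0 hB] := absum_natM (absum_natM ((HD_absum a).1 ha)) r01.
exists (B / r ^+ 2) => [|z w zr wr]; first by rewrite divr_ge0 // exprn_ge0// ltW.
have z1 := le_lt_trans zr r1; have w1 := le_lt_trans wr r1.
have hc := ccvgB (ccvgB (ccvg_shift (peval_cvg ha w1))
  (ccvg_shift (peval_cvg ha z1)))
  (ccvgZ (w - z) (peval_cvg (HD_dcoef ha) z1)).
apply: ccvg_bound hc => n; rewrite -cpsum_dcoef /cpsum mulr_sumr -!sumrB.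
apply: le_trans (cmod_sum _ _) _.
rewrite mulrAC ler_pdivlMr ?exprn_gt0// mulr_suml mulrC.
apply: le_trans (ler_wpM2l (exprn_ge0 2 (cmod_ge0 _)) (hB n.+1)).
rewrite mulr_sumr; apply: ler_sum => i _.
have -> : a i * w ^+ i - a i * z ^+ i - (w - z) * (a i * (i%:R * z ^+ i.-1)) =
  a i * (w ^+ i - z ^+ i - (w - z) * (i%:R * z ^+ i.-1)) by ring.
rewrite !cmodM !cmod_nat.
have -> : cmod (w - z) ^+ 2 * (i%:R * (i%:R * cmod (a i)) * r ^+ i) =
  cmod (a i) * (cmod (w - z) ^+ 2 * (i%:R * (i%:R * r ^+ i))) by ring.
by rewrite -[leLHS]mulrA; apply: ler_wpM2l; [exact: cmod_ge0 | exact: expr_taylor2].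
Qed.

Lemma peval_cderiv a z : HD a -> cmod z < 1 ->
  is_cderiv (peval a) z (peval (dcoef a) z).
Proof.
move=> ha z1 e e0; pose r := (1 + cmod z) / 2.
have z0 := cmod_ge0 z.
have r01 : 0 < r < 1 by rewrite /r; apply/andP; split; lra.
have [K K0 hK] := peval_taylor2 ha r01.
have K1 : 0 < K + 1 by rewrite ltr_wpDl.
exists (Num.min ((1 - cmod z) / 2) (e / (K + 1))) => [|h].
  by rewrite lt_min !divr_gt0 // subr_gt0.
rewrite lt_min => /andP[h0 /andP[h1 h2]].
have hn0 : h != 0 by rewrite -cmod_gt0.
have zr : cmod z <= r by rewrite /r; lra.
have whr : cmod (z + h) <= r.
  by apply: le_trans (cmodD _ _) _; move: h1; rewrite /r; lra.
have hz : z + h - z = h by rewrite addrC addKr.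
have := hK _ _ zr whr; rewrite hz => hh.
have -> : (peval a (z + h) - peval a z) / h - peval (dcoef a) z =
  (peval a (z + h) - peval a z - h * peval (dcoef a) z) / h.
  by rewrite [RHS]mulrBl [h * _]mulrC mulfK.
rewrite cmodM cmodV ltr_pdivrMr//; apply: le_lt_trans hh _.
rewrite expr2 mulrA ltr_pM2r//.
move: h2; rewrite ltr_pdivlMr// mulrC; apply: le_lt_trans.
by rewrite ler_pM2r // lerDl.
Qed.

(** The segment is cut into [N.+1] equal steps, whose nodes stay in the disc by convexity. The
    linear parts add up to at most [M d], the Taylor remainders to [K d^2 / N.+1], which vanishes as
    [N] grows. *)
Lemma mean_value_ineq a (r M : R) z w : HD a -> r < 1 ->
  cmod z <= r -> cmod w <= r ->
  (forall v, cmod v <= r -> cmod (peval (dcoef a) v) <= M) ->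
  cmod (peval a w - peval a z) <= M * cmod (w - z).
Proof.
move=> ha r1 zr wr hM; have r0 : 0 <= r := le_trans (cmod_ge0 _) zr.
(* The Taylor estimate asks for a positive radius, while [r] may be [0]. *)
pose r' := (1 + r) / 2.
have r01 : 0 < r' < 1 by rewrite /r'; apply/andP; split; lra.
have rr' : r <= r' by rewrite /r'; lra.
have [K K0 hK] := peval_taylor2 ha r01.
pose d := cmod (w - z); have d0 : 0 <= d by exact: cmod_ge0.
suff hN (N : nat) : cmod (peval a w - peval a z) <=
    M * d + K * d ^+ 2 / N.+1%:R.
  apply/ler_addgt0Pr => e e0.
  have [N hN'] : exists N : nat, K * d ^+ 2 / e < N.+1%:R.
    exists (Num.truncn (K * d ^+ 2 / e)); exact: truncnS_gt.
  apply: le_trans (hN N) _; rewrite lerD2l.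
  by rewrite ler_pdivrMr ?ltr0n// [e * _]mulrC -ler_pdivrMr// ltW.
pose N' : R := N.+1%:R; have N0 : 0 < N' by rewrite ltr0n.
pose v (j : nat) : R[i] := z + rC (j%:R / N') * (w - z).
have vr (j : nat) : (j <= N.+1)%N -> cmod (v j) <= r.
  move=> jN; set x := j%:R / N'.
  have x0 : 0 <= x by rewrite divr_ge0 // ltW.
  have x1 : x <= 1 by rewrite ler_pdivrMr // mul1r ler_nat.
  have -> : v j = rC (1 - x) * z + rC x * w.
    by rewrite rCB /v -/x rC1; ring.
  apply: le_trans (cmodD _ _) _; rewrite !cmodM !cmod_rC !ger0_norm ?subr_ge0//.
  have -> : r = (1 - x) * r + x * r by ring.
  by apply: lerD; apply: ler_wpM2l; rewrite ?subr_ge0.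
have v0 : v 0%N = z by rewrite /v mul0r rC0 mul0r addr0.
have vN : v N.+1 = w by rewrite /v divff ?gt_eqF// rC1 mul1r addrC subrK.
have := telescope_sumr (fun j => peval a (v j)) (leq0n N.+1).
rewrite big_mkord v0 vN => <-.
apply: le_trans (cmod_sum _ _) _.
have -> : M * d + K * d ^+ 2 / N.+1%:R =
    \sum_(j < N.+1) (M * d / N' + K * d ^+ 2 / N' ^+ 2).
  rewrite sumr_const card_ord -[X in _ = X]mulr_natr -/N'; field.
  by rewrite addrC natr1 pnatr_eq0.
apply: ler_sum => j _.
have hd : v j.+1 - v j = rC N'^-1 * (w - z).
  rewrite /v opprD addrACA subrr add0r -mulrBl -rCB; congr (rC _ * _).
  by rewrite -mulrBl -natr1 addrAC subrr add0r mul1r.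
have hdd : cmod (v j.+1 - v j) = d / N'.
  by rewrite hd cmodM cmod_rC ger0_norm ?invr_ge0 ?(ltW N0)// mulrC.
have vj := vr j (ltnW (ltn_ord j)); have vj1 := vr j.+1 (ltn_ord j).
have := hK _ _ (le_trans vj rr') (le_trans vj1 rr'); rewrite hdd => h.
set A := peval a _ - _ in h *.
have -> : A = (A - (v j.+1 - v j) * peval (dcoef a) (v j)) +
    (v j.+1 - v j) * peval (dcoef a) (v j) by rewrite subrK.
apply: le_trans (cmodD _ _) _; rewrite addrC; apply: lerD.
  rewrite cmodM hdd mulrC -mulrA; apply: ler_wpM2r; last exact: hM.
  by rewrite divr_ge0 // ltW.
by apply: le_trans h _; rewrite exprMn exprVn mulrA.
Qed.

Lemma peval0 a : peval a 0 = a 0%N.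
Proof.
apply: peval_unique; apply: (@ccvg_pinching _ _ _ (fun n => (n == 0%N)%:R * cmod (a 0%N))).
  case=> [|n]; first by rewrite /cpsum big_ord0 sub0r cmodN mul1r.
  rewrite /cpsum big_ord_recl expr0 mulr1 mul0r addrAC subrr add0r big1 ?cmod0//.
  by move=> i _; rewrite exprS mul0r mulr0.
apply/cvgr0Pnorm_lt => e e0; exists 1%N => // -[//|n] _ /=.
by rewrite mul0r normr0.
Qed.

(** Strong induction on the index: once the coefficients below [n] vanish, division by [z ^+ n]
    leaves the shifted series [b], zero off the origin. Expanding [b] between [0] and a small real
    [x] then bounds its constant term [a n] by a multiple of [x]. *)
Lemma peval_eq0 a : HD a -> (forall z, cmod z < 1 -> peval a z = 0) ->
  a = fun=> 0.
Proof.
move=> ha hp; apply/funext => n.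
elim/ltn_ind: n => n IH; apply/eqP; rewrite -cmod_eq0 eq_le cmod_ge0 andbT.
pose b k := a (n + k)%N.
have hb : HD b.
  apply/HD_absum/bounded_absum => r /andP[r0 r1]; pose q := (1 + r) / 2.
  have q0 : 0 < q by rewrite /q; lra.
  have [C C0 hC] : exists2 B : R, 0 <= B & forall m, cmod (a m) * q ^+ m <= B.
    apply: absum_bound; first exact/HD_absum.
    by rewrite /q; apply/andP; split; lra.
  exists (C / q ^+ n) => [|k]; first by rewrite divr_ge0// exprn_ge0// ltW.
  rewrite ler_pdivlMr ?exprn_gt0// /b -mulrA; apply: le_trans (hC (n + k)%N).
  apply: ler_wpM2l; first exact: cmod_ge0.
  rewrite exprD mulrC ler_pM2l ?exprn_gt0// lerXn2r ?nnegrE ?(ltW q0)// /q; lra.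
have hb0 z : cmod z < 1 -> z != 0 -> peval b z = 0.
  move=> z1 zn0; apply: (mulfI (expf_neq0 n zn0)); rewrite mulr0 -(hp _ z1).
  have h1 := ccvgZ (z ^+ n) (peval_cvg hb z1).
  have h2 : ccvg (fun m => cpsum (fun k => a k * z ^+ k) (m + n)%N) (peval a z).
    case: (peval_cvg ha z1) => g1 g2.
    by split; [move: g1|move: g2]; rewrite -(cvg_shiftn n).
  apply: ccvg_unique h1 _; apply: eq_ccvg h2 => m.
  rewrite addnC /cpsum big_split_ord /= big1 ?add0r => [|i _]; last first.
    by rewrite IH ?mul0r.
  by rewrite mulr_sumr; apply: eq_bigr => i _; rewrite exprD mulrCA.
have r12 : 0 < (1/2 : R) < 1 by apply/andP; split; lra.
have [K K0 hK] := peval_taylor2 hb r12.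
set c := cmod (peval (dcoef b) 0) in hK *.
have c0 : 0 <= c by exact: cmod_ge0.
have cK : 0 < c + K + 1 by lra.
have key (x : R) : 0 < x <= 1/2 -> cmod (a n) <= x * (c + K + 1).
  move=> /andP[x0 x1].
  have hx : cmod (rC x) = x by rewrite cmod_rC ger0_norm// ltW.
  have := hK 0 (rC x); rewrite hx cmod0 subr0 hx hb0 ?hx; last 2 first.
  - by lra.
  - by rewrite -cmod_eq0 hx gt_eqF.
  rewrite peval0 /b addn0 => /(_ _ x1) h.
  have {h}h : cmod (0 - a n - rC x * peval (dcoef b) 0) <= K * x ^+ 2.
    by apply: h; lra.
  have -> : a n = - ((0 - a n - rC x * peval (dcoef b) 0)
    + rC x * peval (dcoef b) 0) by ring.
  rewrite cmodN; apply: le_trans (cmodD _ _) _; rewrite cmodM hx -/c.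
  apply: le_trans (lerD h (lexx _)) _.
  have : 0 <= K * x * (1 - x) by rewrite !mulr_ge0 ?subr_ge0//; lra.
  by move: x0; nra.
apply/ler_addgt0Pr => e e0; rewrite add0r.
pose x := Num.min (1/2) (e / (c + K + 1)).
have hx : 0 < x <= 1/2.
  have e1 : 0 < e / (c + K + 1) by rewrite divr_gt0.
  by rewrite /x lt_min ge_min lexx e1 /= !andbT; lra.
apply: le_trans (key x hx) _.
by rewrite -ler_pdivlMr// /x ge_min lexx orbT.
Qed.

End PowerSeries.

(** * Growth of Bloch functions and distance to the boundary point 1 *)

Section BlochGrowth.
Variable R : realType.
Implicit Types (z w : R[i]) (x y : R) (a : nat -> R[i]).

Lemma powR_exprn x k (r : R) : 0 <= x -> (x ^+ k) `^ r = (x `^ r) ^+ k.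
Proof.
move=> x0; elim: k => [|k IH]; first by rewrite !expr0 powR1.
by rewrite !exprS powRM ?exprn_ge0// IH.
Qed.

Lemma pow1R (r : R) : 1 `^ r = 1 :> R.
Proof. by rewrite powR1. Qed.

Lemma powR_anti (r x y : R) : r <= 0 -> 0 < x -> x <= y -> y `^ r <= x `^ r.
Proof.
move=> r0 x0 xy; have y0 := lt_le_trans x0 xy.
have [s s0 ->] : exists2 s : R, 0 <= s & r = - s.
  by exists (- r); rewrite ?oppr_ge0 ?opprK.
rewrite !powRN lef_pV2 ?posrE ?powR_gt0//.
by apply: ge0_ler_powR; rewrite ?nnegrE //; exact: ltW.
Qed.

Lemma powR_half_lt1 (r : R) : 0 < r -> (1 / 2 : R) `^ r < 1.
Proof.
move=> r0; rewrite -[ltRHS](pow1R r).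
by apply: gt0_ltr_powR => //; rewrite ?nnegrE //; lra.
Qed.

Lemma half_expr_small (c e : R) : 0 < e -> exists n : nat, c * (1/2) ^+ n < e.
Proof.
move=> e0; exists (Num.truncn (`|c| / e)).+1.
apply: le_lt_trans (ler_wpM2r _ (ler_norm c)) _; first by rewrite exprn_ge0//; lra.
rewrite mul1r exprVn ltr_pdivrMr ?exprn_gt0// mulrC -ltr_pdivrMr//.
apply: lt_trans (truncnS_gt _) _.
by rewrite -natrX ltr_nat ltn_expl.
Qed.

Lemma dyadic_low (l x : R) : 0 < x <= l ->
  exists k : nat, l * (1/2) ^+ k.+1 < x <= l * (1/2) ^+ k.
Proof.
move=> /andP[x0 xl]; have ex := half_expr_small l x0.
case: (ex_minnP ex) => -[|k] hk hmin.
  by move: hk; rewrite expr0 mulr1 ltNge xl.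
exists k; rewrite hk /= leNgt; apply/negP => /hmin.
by rewrite ltnn.
Qed.

Lemma dyadic_high (l x : R) : 0 < l < x ->
  exists k : nat, l * 2 ^+ k <= x <= l * 2 ^+ k.+1.
Proof.
move=> /andP[l0 lx]; have ex := half_expr_small x l0.
case: (ex_minnP ex) => -[|k] hk hmin.
  by move: hk; rewrite expr0 mulr1 ltNge (ltW lx).
exists k; apply/andP; split; last first.
  move: hk; rewrite mul1r exprVn ltr_pdivrMr ?exprn_gt0//; exact: ltW.
rewrite leNgt; apply/negP => h; suff /hmin : x * (1/2) ^+ k < l by rewrite ltnn.
by rewrite mul1r exprVn ltr_pdivrMr ?exprn_gt0.
Qed.

Lemma powR2_lt1 (r : R) : r < 0 -> 2 `^ r < 1 :> R.
Proof.
move=> r0; rewrite -[r]opprK powRN invf_lt1 ?powR_gt0// -[ltLHS](pow1R (- r)).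
by apply: gt0_ltr_powR; rewrite ?oppr_gt0 ?nnegrE// ltr1n.
Qed.

(** Kept apart from [Bloch] because Morrey membership uses only [growth] and [angular_lip]. The
    constant function satisfies both with [al = 1], an exponent at which a general Bloch function
    may grow logarithmically. *)
Definition growth (al K : R) a := forall w, cmod w < 1 ->
  cmod (peval a w) <= K * (1 - cmod w) `^ (1 - al).

Definition angular_lip (al K : R) a := forall t x y, 0 <= t < 1 ->
  cmod (peval a (rC t * cexpi x) - peval a (rC t * cexpi y)) <=
  K * `|x - y| * (1 - t) `^ (- al).

(** [peval_cderiv] provides the derivative that the Bloch condition quantifies over, and
    [1 - |v| <= 1 - |v|^2] simplifies the weight. *)
Lemma Bloch_dcoef (al : R) a : 0 < al -> Bloch al a ->
  exists2 M : R, 0 <= M & forall v, cmod v < 1 ->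
    cmod (peval (dcoef a) v) <= M * (1 - cmod v) `^ (- al).
Proof.
move=> al0 [ha [M hM]]; exists `|M| => // v v1.
have := hM v _ v1 (peval_cderiv ha v1).
have v0 := cmod_ge0 v.
have h1 : 0 < 1 - cmod v by rewrite subr_gt0.
have h2 : 1 - cmod v <= 1 - cmod v ^+ 2.
  by rewrite lerD2l lerN2 expr2 ler_piMr// ltW.
have h3 : (1 - cmod v) `^ al <= (1 - cmod v ^+ 2) `^ al.
  by apply: ge0_ler_powR; rewrite ?nnegrE ?(ltW al0) ?(ltW h1)//; apply: le_trans h2; exact: ltW.
move=> h; rewrite powRN ler_pdivlMr ?powR_gt0// mulrC.
apply: le_trans (ler_wpM2r (cmod_ge0 _) h3) _.
exact: le_trans h (ler_norm _).
Qed.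

(** Induction on the dyadic distance to the circle. A point at distance [x] is compared with the
    point on its ray at distance [2 x]; the move costs [M x^(1 - al)] by the mean value inequality,
    and the inherited bound shrinks by [q = 2^(1 - al)], which is below [1] because [al > 1]. *)
Lemma Bloch_growth (al : R) a : 1 < al -> Bloch al a ->
  exists2 K : R, 0 <= K & growth al K a.
Proof.
move=> al1 hB; have al0 : 0 < al by lra.
have ha : HD a by case: hB.
have [M M0 hM] := Bloch_dcoef al0 hB.
have rad z w r : r < 1 -> cmod z <= r -> cmod w <= r ->
    cmod (peval a w - peval a z) <= M * (1 - r) `^ (- al) * cmod (w - z).
  move=> r1 zr wr; apply: (mean_value_ineq ha r1 zr wr) => v vr.
  apply: le_trans (hM v (le_lt_trans vr r1)) _.
  by apply: ler_wpM2l => //; apply: powR_anti; rewrite ?oppr_le0 ?subr_gt0 ?lerD2l ?lerN2 ?(ltW al0).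
pose q : R := 2 `^ (1 - al).
have q1 : q < 1.
  by apply: powR2_lt1; rewrite subr_lt0.
pose K0 := cmod (a 0%N) + M * (1 - 1/2) `^ (- al).
(* [K0] settles the disc of radius [1/2]; the term [M / (1 - q)] ensures [K q + M <= K], which
   closes the induction. *)
pose K := K0 + M / (1 - q).
have K00 : 0 <= K0 by rewrite addr_ge0 ?cmod_ge0 ?mulr_ge0 ?powR_ge0.
have Mq : 0 <= M / (1 - q) by rewrite divr_ge0// subr_ge0 ltW.
have KK : 0 <= K by rewrite addr_ge0.
exists K => // w w1.
suff key n : forall w, cmod w < 1 -> (1/2) ^+ n.+1 <= 1 - cmod w ->
    cmod (peval a w) <= K * (1 - cmod w) `^ (1 - al).
  have [n hn] : exists n : nat, (1/2 : R) ^+ n.+1 <= 1 - cmod w.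
    have w1' : 0 < 1 - cmod w by rewrite subr_gt0.
    exists (Num.truncn ((1 - cmod w)^-1)).
    rewrite mul1r exprVn -[leRHS]invrK lef_pV2 ?posrE ?invr_gt0 ?exprn_gt0//.
    apply: le_trans (ltW (truncnS_gt _)) _.
    by rewrite -natrX ler_nat ltnW// ltn_expl.
  exact: key hn.
elim: n => [|n IH] {w1}w w1 hw; set x := 1 - cmod w in hw *.
  rewrite expr1 in hw.
  have wh : cmod w <= 1/2 by move: hw; rewrite /x; lra.
  have x1 : 1 <= x `^ (1 - al).
    rewrite -[leLHS](pow1R (1 - al)); apply: powR_anti; rewrite ?subr_le0 ?(ltW al1)//.
      by move: hw; rewrite /x; lra.
    by rewrite /x gerBl cmod_ge0.
  apply: le_trans (_ : K0 <= _); last first.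
    apply: le_trans (_ : K <= _); first by rewrite lerDl.
    by rewrite -[leLHS]mulr1; exact: ler_wpM2l.
  have -> : peval a w = peval a 0 + (peval a w - peval a 0) by rewrite addrC subrK.
  apply: le_trans (cmodD _ _) _; rewrite /K0 peval0 lerD2l -peval0.
  have h12 : (1/2 : R) < 1 by lra.
  have h0 : cmod (0 : R[i]) <= 1/2 by rewrite cmod0; lra.
  apply: le_trans (rad 0 w _ h12 h0 wh) _.
  rewrite subr0 -[leRHS]mulr1; apply: ler_wpM2l; first by rewrite mulr_ge0// powR_ge0.
  exact: ltW.
have [hx|hx] := leP ((1/2) ^+ n.+1) x; first exact: IH.
have x0 : 0 < x by rewrite /x subr_gt0.
have xh : x < 1/2.
  apply: lt_le_trans hx _; rewrite exprS; apply: ler_piMr; first by lra.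
  by rewrite exprn_ile1//; lra.
have w0 : 0 < cmod w by move: xh; rewrite /x; lra.
(* The point on the ray of [w] with [1 - |w'| = 2 (1 - |w|)]; the case [1 - |w| < 1/2] makes its
   modulus positive. *)
pose w' := rC ((2 * cmod w - 1) / cmod w) * w.
have cw' : cmod w' = 2 * cmod w - 1.
  rewrite cmodM cmod_rC ger0_norm ?divfK ?gt_eqF// divr_ge0 ?(ltW w0)//.
  by move: xh; rewrite /x; lra.
have xw' : 1 - cmod w' = 2 * x by rewrite cw' /x; ring.
have dw : cmod (w - w') = x.
  have -> : w - w' = rC ((1 - cmod w) / cmod w) * w.
    have -> : (1 - cmod w) / cmod w = 1 - (2 * cmod w - 1) / cmod w.
      by field; rewrite gt_eqF.
    by rewrite rCB rC1 mulrBl mul1r.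
  rewrite cmodM cmod_rC ger0_norm ?divfK ?gt_eqF//.
  by rewrite divr_ge0 ?(ltW w0)// subr_ge0 ltW.
have w'1 : cmod w' < 1 by rewrite cw'; lra.
have ihw : cmod (peval a w') <= K * (2 * x) `^ (1 - al).
  rewrite -xw'; apply: IH => //; rewrite xw'.
  move: hw; rewrite exprS; set e := (1/2) ^+ n.+1; lra.
have ww' : cmod w' <= cmod w by rewrite cw'; lra.
have hr := rad w' w _ w1 ww' (lexx _); rewrite -/x dw -mulrA in hr.
have -> : peval a w = peval a w' + (peval a w - peval a w') by rewrite addrC subrK.
apply: le_trans (cmodD _ _) _; apply: le_trans (lerD ihw hr) _.
have -> : x `^ (- al) * x = x `^ (1 - al).
  rewrite -{2}(powRr1 (ltW x0)) -powRD ?(gt_eqF x0) ?implybT//.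
  by congr (_ `^ _); rewrite addrC.
rewrite powRM ?(ltW x0)// -/q mulrA -mulrDl ler_pM2r ?powR_gt0//.
rewrite -lerBrDl -{1}(mulr1 K) -mulrBr -ler_pdivrMr ?subr_gt0//.
by rewrite /K lerDr.
Qed.

Lemma lip_of_derive (f df : R -> R) : (forall x, is_derive x 1 f (df x)) ->
  (forall x, `|df x| <= 1) -> forall x y, `|f x - f y| <= `|x - y|.
Proof.
move=> hf hdf x y; wlog xy : x y / x < y => [hwlog|].
  have [xy|yx|->] := ltgtP x y; first exact: hwlog.
    by rewrite distrC [leRHS]distrC; exact: hwlog.
  by rewrite !subrr.
have [|c _ hc] := @MVT _ f df x y xy (fun u _ => hf u).
  apply: continuous_subspaceT => u; apply: differentiable_continuous.
  by apply/derivable1_diffP; case: (hf u).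
by rewrite distrC hc normrM [leRHS]distrC ler_piMl.
Qed.

Lemma cexpi_lip x y : cmod (cexpi x - cexpi y) <= 2 * `|x - y|.
Proof.
apply: le_trans (cmod_le_ReIm _) _; rewrite ReB ImB /= mulr2n mulrDl !mul1r.
apply: lerD.
  apply: (lip_of_derive (@is_derive_cos R)) => u.
  by rewrite normrN; exact: sin_max.
apply: (lip_of_derive (@is_derive_sin R)); exact: cos_max.
Qed.

(** The chord between two points of the circle of radius [t] stays in that disc, where the
    derivative is at most [M (1 - t)^(- al)]. *)
Lemma Bloch_angular_lip (al : R) a : 0 < al -> Bloch al a ->
  exists2 K : R, 0 <= K & angular_lip al K a.
Proof.
move=> al0 hB; have ha : HD a by case: hB.
have [M M0 hM] := Bloch_dcoef al0 hB.
exists (2 * M) => [|t x y /andP[t0 t1]]; first by rewrite mulr_ge0.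
have ct u : cmod (rC t * cexpi u) <= t.
  by rewrite cmodM cmod_cexpi mulr1 cmod_rC ger0_norm.
apply: le_trans.
  apply: (@mean_value_ineq _ a t (M * (1 - t) `^ (- al)) _ _ ha t1 (ct y) (ct x)).
  move=> v vt; apply: le_trans (hM v (le_lt_trans vt t1)) _.
  by apply: ler_wpM2l => //; apply: powR_anti; rewrite ?oppr_le0 ?subr_gt0 ?lerD2l ?lerN2 ?(ltW al0).
rewrite -mulrBr cmodM cmod_rC ger0_norm//.
have -> : 2 * M * `|x - y| * (1 - t) `^ (- al) =
  M * (1 - t) `^ (- al) * (2 * `|x - y|) by ring.
apply: ler_wpM2l; first by rewrite mulr_ge0// powR_ge0.
apply: le_trans (_ : 1 * cmod (cexpi x - cexpi y) <= _).
  by apply: ler_wpM2r; [exact: cmod_ge0 | exact: ltW].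
by rewrite mul1r cexpi_lip.
Qed.

(** Where [cos y >= 1/2], the mean value theorem gives even [y / 2]. Otherwise [sin y] exceeds
    [1/2], because the squares add up to [1], while [y / 4 < 1/2] by [pi / 2 < 2]. *)
Lemma sin_ge_quarter y : 0 <= y <= pi / 2 -> y / 4 <= sin y.
Proof.
move=> /andP[y0 y2]; have pi2 := pihalf_lt2 R.
move: y0; rewrite le_eqVlt => /orP[/eqP<-|y0].
  by rewrite mul0r sin0.
have [hc|hc] := leP (1/2) (cos y).
  have [|c cy hs] := @MVT _ sin cos 0 y y0 (fun u _ => is_derive_sin u).
    by apply: continuous_subspaceT => u; exact: continuous_sin.
  move: hs; rewrite sin0 !subr0 => ->.
  move: cy; rewrite in_itv /= => /andP[c0 cy].
  have : cos y < cos c.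
    by rewrite ltr_cos ?in_itv /= ?(ltW c0) ?(ltW y0)//=; lra.
  move=> h; rewrite mulrC; apply: ler_wpM2r; first exact: ltW.
  by lra.
have s0 : 0 <= sin y by apply: sin_ge0_pi; rewrite (ltW y0) /=; lra.
have c0 : 0 <= cos y by apply: cos_ge0_pihalf; rewrite y2 andbT; lra.
have := cos2Dsin2 y; nra.
Qed.

(** Distance from [cexpi x] to the singularity of [1 / (1 - w)]; being periodic in [x], it suits
    arcs with an arbitrary starting angle. *)
Definition dist1 x : R := cmod (1 - cexpi x).

Lemma dist1_ge0 x : 0 <= dist1 x.
Proof. exact: cmod_ge0. Qed.

(** By the half-angle formulas [|1 - e^(ix)| = 2 |sin (x / 2)|], and [sin_ge_quarter] applies to
    [x / 2]. *)
Lemma dist1_ge x : `|x| <= pi -> `|x| / 4 <= dist1 x.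
Proof.
wlog x0 : x / 0 <= x => [hw|].
  have [/hw//|x0] := leP 0 x; rewrite -normrN => h.
  have -> : dist1 x = dist1 (- x) by rewrite /dist1 /cmod /= cosN sinN sub0r sub0r opprK sqrrN.
  by apply: hw => //; rewrite oppr_ge0 ltW.
rewrite ger0_norm// => xpi.
have : (x / 2) / 4 <= sin (x / 2) by apply: sin_ge_quarter; apply/andP; split; lra.
move=> hs; rewrite /dist1 /cmod /= sub0r sqrrN.
have -> : x = (x / 2) + (x / 2) by field.
rewrite cosD sinD; set s := sin (x / 2) in hs *; set c := cos (x / 2).
have hcs : c ^+ 2 + s ^+ 2 = 1 by exact: cos2Dsin2.
have -> : (1 - (c * c - s * s)) ^+ 2 + (s * c + c * s) ^+ 2 = (2 * s) ^+ 2.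
  have -> : 1 = c ^+ 2 + s ^+ 2 by [].
  have -> : (c ^+ 2 + s ^+ 2 - (c * c - s * s)) ^+ 2 + (s * c + c * s) ^+ 2 =
    (2 * s) ^+ 2 * (c ^+ 2 + s ^+ 2) by ring.
  by rewrite hcs mulr1.
rewrite sqrtr_sqr ger0_norm; last by lra.
by lra.
Qed.

Lemma cexpiN x : cexpi (- x) * cexpi x = 1.
Proof. by rewrite -cexpiD addNr cexpi0. Qed.

Lemma cexpi2pi : cexpi (2 * pi) = 1 :> R[i].
Proof.
by rewrite mulr2n mulrDl mul1r /cexpi -mulr2n cos2pi sin2pi.
Qed.

Lemma cexpi_base x : exists2 p : R, cexpi p = 1 & p <= x < p + 2 * pi.
Proof.
have pi0 := pi_gt0 R.
have nat_case n : cexpi (2 * pi * n%:R) = 1 :> R[i].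
  elim: n => [|n IH]; first by rewrite mulr0 cexpi0.
  by rewrite -[n.+1%:R]natr1 mulrDr mulr1 cexpiD IH mul1r cexpi2pi.
exists (2 * pi * (Num.floor (x / (2 * pi)))%:~R).
  case: (Num.floor _) => n; first exact: nat_case.
  rewrite NegzE mulrNz mulrN; have := cexpiN (2 * pi * n.+1%:R).
  by rewrite nat_case mulr1.
have p0 : 0 < 2 * pi :> R by rewrite mulr_gt0.
have /andP[h1 h2] := floor_itv (x / (2 * pi)).
move: h1 h2; rewrite intrD; set f : R := (Num.floor _)%:~R => h1 h2.
rewrite ler_pdivlMr// in h1; rewrite ltr_pdivrMr// in h2.
have -> : 2 * pi * f = f * (2 * pi) by rewrite mulrC.
by rewrite h1 /=; move: h2; rewrite mulrDl mul1r.
Qed.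

End BlochGrowth.

(** * Dyadic integral estimates for Carleson measures and along arcs *)

Section Integrals.
Variable R : realType.

(** Common form of all dyadic summations below. Pointwise [h] is at most the sum of [c k] times the
    indicator of [E k], so the sets may overlap and balls can replace shells; exchanging sum and
    integral leaves a geometric series. *)
Lemma series_dominated_integral d (T : measurableType d)
    (mu : {measure set T -> \bar R}) (D : set T) (h : T -> R)
    (E : nat -> set T) (c : nat -> R) (A q : R) :
  measurable D -> measurable_fun D h -> (forall x, D x -> 0 <= h x) ->
  (forall k, measurable (E k)) -> (forall k, 0 <= c k) -> 0 <= q < 1 -> 0 <= A ->
  (forall x, D x -> exists k, E k x /\ h x <= c k) ->
  (forall k, (c k)%:E * mu (E k) <= (A * q ^+ k)%:E)%E ->
  (\int[mu]_(x in D) (h x)%:E <= (A / (1 - q))%:E)%E.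
Proof.
move=> mD mh h0 mE c0 q01 A0 hE hc.
pose f k x := (c k * \1_(E k) x)%:E : \bar R.
have f0 k x : (0 <= f k x)%E by rewrite lee_fin mulr_ge0.
have mf k : measurable_fun D (f k).
  by apply/measurable_EFinP; apply: measurable_funM => //; exact: measurable_indic.
apply: (@le_trans _ _ (\int[mu]_(x in D) \sum_(0 <= k <oo) f k x)%E).
  apply: ge0_le_integral => //.
  - exact/measurable_EFinP.
  - by apply: ge0_emeasurable_sum.
  - move=> x Dx; have [k [Ekx hk]] := hE x Dx.
    apply: (@le_trans _ _ (f k x)).
      by rewrite lee_fin indicE mem_set// mulr1.
    apply: le_trans (nneseries_lim_ge k.+1 _); last by [].
    by rewrite big_nat_recr//= leeDr// sume_ge0.
rewrite integral_nneseries//.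
apply: lime_le; first by apply: is_cvg_nneseries => k _ _; apply: integral_ge0.
apply: nearW => n /=.
apply: (@le_trans _ _ (\sum_(0 <= k < n) (A * q ^+ k)%:E)%E).
  apply: lee_sum => k _; apply: le_trans (hc k).
  under eq_integral do rewrite /f EFinM.
  rewrite ge0_integralZl_EFin//; last first.
    by apply/measurable_EFinP; exact: measurable_indic.
  rewrite integral_indic//; apply: lee_wpmul2l; first by rewrite lee_fin.
  by apply: le_measure; rewrite ?inE//; exact: measurableI.
rewrite sumEFin lee_fin big_mkord -mulr_sumr.
by apply: ler_wpM2l => //; exact: geom_sum_le.
Qed.

Lemma Rintegral_bound d (T : measurableType d)
    (mu : {measure set T -> \bar R}) (D : set T) (f g : T -> R) (c B : R) :
  measurable D -> measurable_fun D f -> measurable_fun D g -> 0 <= c ->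
  (forall x, D x -> 0 <= g x) ->
  (forall x, D x -> `|f x| <= c * g x) ->
  (\int[mu]_(x in D) (g x)%:E <= B%:E)%E ->
  mu.-integrable D (EFin \o f) /\ `|\int[mu]_(x in D) f x| <= c * B.
Proof.
move=> mD mf mg c0 g0 fg hB.
have hle : (\int[mu]_(x in D) `|(f x)%:E| <= (c * B)%:E)%E.
  apply: (@le_trans _ _ (\int[mu]_(x in D) (c%:E * (g x)%:E))%E).
    apply: ge0_le_integral => //.
    - by apply/measurable_EFinP; exact: measurableT_comp.
    - by apply: measurable_funeM; exact/measurable_EFinP.
  rewrite ge0_integralZl_EFin//; last exact/measurable_EFinP.
  by rewrite EFinM; apply: lee_wpmul2l.
have intf : mu.-integrable D (EFin \o f).
  apply/integrableP; split; first exact/measurable_EFinP.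
  by apply: le_lt_trans hle _; rewrite ltry.
split => //; rewrite -lee_fin EFin_normr_Rintegral//.
apply: le_trans hle; apply: le_abse_integral => //; exact/measurable_EFinP.
Qed.

(** Intersected with [[0, 1)] because [y] will be an arc length, up to [2 pi]; for [y >= 1] this is
    all of [[0, 1)]. *)
Definition near1 (y : R) : set R := `[0%R, 1%R[%classic `&` `[(1 - y)%R, +oo[%classic.
Definition far1 (y : R) : set R := `[0%R, 1%R[%classic `&` `]-oo, (1 - y)%R[%classic.

Lemma measurable_near1 y : measurable (near1 y).
Proof. by apply: measurableI; exact: measurable_itv. Qed.

Lemma measurable_far1 y : measurable (far1 y).
Proof. by apply: measurableI; exact: measurable_itv. Qed.

(** For [y > 1] the condition at [t = 0] bounds the total mass, and [y^s >= 1]. The same instance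
    shows that the constant is nonnegative. *)
Lemma carleson_near1 (mu : {measure set R -> \bar R}) (s : R) : 0 < s ->
  carleson mu s -> exists2 C : R, 0 <= C &
    forall y, 0 < y -> (mu (near1 y) <= (C * y `^ s)%:E)%E.
Proof.
move=> s0 [C hC].
have h0 : (mu `[0%R, 1%R[%classic <= (C * (1 - 0) `^ s)%:E)%E by apply: hC; rewrite lexx ltr01.
rewrite subr0 pow1R mulr1 in h0.
have C0 : 0 <= C by rewrite -lee_fin; exact: le_trans (measure_ge0 _ _) h0.
exists C => // y y0; have [y1|y1] := leP y 1.
  have := hC (1 - y); rewrite subr_ge0 y1 gtrBl y0 => /(_ isT).
  rewrite subKr; apply: le_trans; apply: le_measure; rewrite ?inE.
  - exact: measurable_near1.
  - exact: measurable_itv.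
  - by move=> t [] /=; rewrite !in_itv /= andbT => /andP[_ ->] ->.
apply: (@le_trans _ _ (mu `[0%R, 1%R[%classic)).
  apply: le_measure; rewrite ?inE; [exact: measurable_near1 | exact: measurable_itv|].
  by move=> t [].
apply: le_trans h0 _; rewrite lee_fin -[leLHS]mulr1; apply: ler_wpM2l => //.
by rewrite -(pow1R s); apply: ge0_ler_powR; rewrite ?nnegrE ?ltW.
Qed.

Lemma measurable_powR_one_minus (D : set R) (p : R) :
  measurable_fun D (fun t : R => (1 - t) `^ p).
Proof.
apply: (@measurable_funS _ _ _ _ setT) => //.
apply: (measurableT_comp (measurable_powR p)).
by apply: measurable_funB => //; exact: measurable_cst.
Qed.

(** Points with [1 - t] about [l / 2^k] contribute a multiple of [(l / 2^k)^(s - p)], summable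
    towards [t = 1] because [p < s]. *)
Lemma carleson_integral_near (mu : {measure set R -> \bar R}) (s p C l : R) :
  0 <= C -> (forall y, 0 < y -> (mu (near1 y) <= (C * y `^ s)%:E)%E) ->
  0 < p < s -> 0 < l ->
  (\int[mu]_(t in near1 l) ((1 - t) `^ (- p))%:E <=
   (C * ((1/2) `^ (- p) / (1 - (1/2) `^ (s - p))) * l `^ (s - p))%:E)%E.
Proof.
move=> C0 hC /andP[p0 ps] l0.
have hh k : 0 < l * (1/2) ^+ k by rewrite mulr_gt0// exprn_gt0//; lra.
have -> : C * ((1/2) `^ (- p) / (1 - (1/2) `^ (s - p))) * l `^ (s - p) =
  (C * (1/2) `^ (- p) * l `^ (s - p)) / (1 - (1/2) `^ (s - p)) by ring.
apply: (@series_dominated_integral _ _ mu _ _ (fun k => near1 (l * (1/2) ^+ k))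
  (fun k => (l * (1/2) ^+ k.+1) `^ (- p))).
- exact: measurable_near1.
- exact: measurable_powR_one_minus.
- by move=> *; exact: powR_ge0.
- by move=> k; exact: measurable_near1.
- by move=> k; exact: powR_ge0.
- by rewrite powR_ge0 powR_half_lt1// subr_gt0.
- by rewrite !mulr_ge0// powR_ge0.
- move=> t [/= ]; rewrite !in_itv /= andbT => /andP[t0 t1] tl.
  have ht : 0 < 1 - t <= l by rewrite subr_gt0 t1 /= lerBlDr addrC -lerBlDr.
  have [k /andP[h1 h2]] := dyadic_low ht.
  exists k; split.
    by rewrite /near1 /= !in_itv /= t0 t1 /= andbT; move: h2; lra.
  by apply: powR_anti; rewrite ?oppr_le0 ?(ltW p0)// ltW.
- move=> k; apply: le_trans (_ : ((l * (1/2) ^+ k.+1) `^ (- p))%:E *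
      (C * (l * (1/2) ^+ k) `^ s)%:E <= _)%E.
    by apply: lee_wpmul2l; [rewrite lee_fin powR_ge0 | exact: hC].
  have l2 : 0 <= (1/2 : R) by lra.
  have -> : (l * (1 / 2) ^+ k.+1) `^ (- p) =
      (l * (1 / 2) ^+ k) `^ (- p) * (1/2) `^ (- p).
    by rewrite exprSr [l * (_ * _)]mulrA powRM//; exact: ltW.
  rewrite -EFinM lee_fin -powR_exprn//.
  have -> : C * (1 / 2) `^ (- p) * l `^ (s - p) * ((1/2) ^+ k) `^ (s - p) =
      C * (1 / 2) `^ (- p) * (l * (1/2) ^+ k) `^ (s - p).
    by rewrite powRM ?(ltW l0) ?exprn_ge0//; ring.
  have -> : (l * (1/2) ^+ k) `^ (s - p) =
      (l * (1/2) ^+ k) `^ s * (l * (1/2) ^+ k) `^ (- p).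
    by rewrite -powRD// (gt_eqF (hh k)) implybT.
  by rewrite le_eqVlt; apply/orP; left; apply/eqP; ring.
Qed.

(** Here the scales [l 2^k] grow away from [1], and [s < p] makes the contributions
    [(l 2^k)^(s - p)] decay. *)
Lemma carleson_integral_far (mu : {measure set R -> \bar R}) (s p C l : R) :
  0 <= C -> (forall y, 0 < y -> (mu (near1 y) <= (C * y `^ s)%:E)%E) ->
  0 < s < p -> 0 < l ->
  (\int[mu]_(t in far1 l) ((1 - t) `^ (- p))%:E <=
   (C * (2 `^ s / (1 - 2 `^ (s - p))) * l `^ (s - p))%:E)%E.
Proof.
move=> C0 hC /andP[s0 sp] l0.
have hh k : 0 < l * 2 ^+ k by rewrite mulr_gt0// exprn_gt0.
have -> : C * (2 `^ s / (1 - 2 `^ (s - p))) * l `^ (s - p) =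
  (C * 2 `^ s * l `^ (s - p)) / (1 - 2 `^ (s - p)) by ring.
apply: (@series_dominated_integral _ _ mu _ _ (fun k => near1 (l * 2 ^+ k.+1))
  (fun k => (l * 2 ^+ k) `^ (- p))).
- exact: measurable_far1.
- exact: measurable_powR_one_minus.
- by move=> *; exact: powR_ge0.
- by move=> k; exact: measurable_near1.
- by move=> k; exact: powR_ge0.
- by rewrite powR_ge0 powR2_lt1// subr_lt0.
- by rewrite !mulr_ge0// powR_ge0.
- move=> t [/= ]; rewrite !in_itv /= => /andP[t0 t1] tl.
  have ht : 0 < l < 1 - t by rewrite l0 /= ltrBrDr addrC -ltrBrDr.
  have [k /andP[h1 h2]] := dyadic_high ht.
  exists k; split.
    by rewrite /near1 /= !in_itv /= t0 t1 /= andbT; move: h2; lra.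
  by apply: powR_anti; rewrite ?oppr_le0 ?(ltW (lt_trans s0 sp)).
- move=> k; apply: le_trans (_ : ((l * 2 ^+ k) `^ (- p))%:E *
      (C * (l * 2 ^+ k.+1) `^ s)%:E <= _)%E.
    by apply: lee_wpmul2l; [rewrite lee_fin powR_ge0 | exact: hC].
  have -> : (l * 2 ^+ k.+1) `^ s = (l * 2 ^+ k) `^ s * 2 `^ s.
    by rewrite exprSr mulrA powRM//; exact: ltW.
  rewrite -EFinM lee_fin -powR_exprn//.
  have -> : C * 2 `^ s * l `^ (s - p) * (2 ^+ k) `^ (s - p) =
      C * 2 `^ s * (l * 2 ^+ k) `^ (s - p).
    by rewrite powRM ?(ltW l0) ?exprn_ge0//; ring.
  have -> : (l * 2 ^+ k) `^ (s - p) =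
      (l * 2 ^+ k) `^ s * (l * 2 ^+ k) `^ (- p).
    by rewrite -powRD// (gt_eqF (hh k)) implybT.
  by rewrite le_eqVlt; apply/orP; left; apply/eqP; ring.
Qed.

Definition cmeas d (T : measurableType d) (D : set T) (h : T -> R[i]) : Prop :=
  measurable_fun D (fun x => complex.Re (h x)) /\
  measurable_fun D (fun x => complex.Im (h x)).

Lemma cmeas_cst d (T : measurableType d) (D : set T) (c : R[i]) :
  cmeas D (fun=> c).
Proof. by split; exact: measurable_cst. Qed.

Lemma cmeasD d (T : measurableType d) (D : set T) (h g : T -> R[i]) :
  cmeas D h -> cmeas D g -> cmeas D (fun x => h x + g x).
Proof.
move=> [h1 h2] [g1 g2]; split.
  by under eq_fun do rewrite ReD; exact: measurable_funD.
by under eq_fun do rewrite ImD; exact: measurable_funD.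
Qed.

Lemma cmeasM d (T : measurableType d) (D : set T) (h g : T -> R[i]) :
  cmeas D h -> cmeas D g -> cmeas D (fun x => h x * g x).
Proof.
move=> [h1 h2] [g1 g2]; split.
  by under eq_fun do rewrite ReM; apply: measurable_funB; exact: measurable_funM.
by under eq_fun do rewrite ImM; apply: measurable_funD; exact: measurable_funM.
Qed.

Lemma cmeas_cpsum d (T : measurableType d) (D : set T) (b : nat -> R[i])
    (h : T -> R[i]) n : cmeas D h ->
  cmeas D (fun x => cpsum (fun k => b k * h x ^+ k) n).
Proof.
move=> mh; have mX k : cmeas D (fun x => h x ^+ k).
  elim: k => [|k IH]; first by under eq_fun do rewrite expr0; exact: cmeas_cst.
  by under eq_fun do rewrite exprS; exact: cmeasM.
rewrite /cpsum; elim: n => [|n IH].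
  by under eq_fun do rewrite big_ord0; exact: cmeas_cst.
under eq_fun do rewrite big_ord_recr /=.
by apply: cmeasD => //; apply: cmeasM => //; exact: cmeas_cst.
Qed.

Lemma cmeas_peval d (T : measurableType d) (D : set T) (b : nat -> R[i])
    (h : T -> R[i]) : HD b -> cmeas D h -> (forall x, D x -> cmod (h x) < 1) ->
  cmeas D (fun x => peval b (h x)).
Proof.
move=> hb mh h1; split.
  apply: (@measurable_fun_cvg _ _ _ _
    (fun n x => complex.Re (cpsum (fun k => b k * h x ^+ k) n))).
    by move=> n; case: (cmeas_cpsum b n mh).
  by move=> x Dx; case: (peval_cvg hb (h1 x Dx)).
apply: (@measurable_fun_cvg _ _ _ _
  (fun n x => complex.Im (cpsum (fun k => b k * h x ^+ k) n))).
  by move=> n; case: (cmeas_cpsum b n mh).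
by move=> x Dx; case: (peval_cvg hb (h1 x Dx)).
Qed.

Lemma cmeas_rC d (T : measurableType d) (D : set T) (f : T -> R) :
  measurable_fun D f -> cmeas D (fun x => rC (f x)).
Proof. by move=> mf; split => //; exact: measurable_cst. Qed.

Lemma cmeas_cexpi (D : set R) : cmeas D (@cexpi R).
Proof.
split; apply: (@measurable_funS _ _ _ _ setT) => //;
  apply: continuous_measurable_fun; [exact: continuous_cos | exact: continuous_sin].
Qed.

Lemma measurable_cmod d (T : measurableType d) (D : set T) (h : T -> R[i]) :
  cmeas D h -> measurable_fun D (fun x => cmod (h x)).
Proof.
move=> [h1 h2]; rewrite /cmod.
apply: (measurableT_comp (continuous_measurable_fun (@sqrt_continuous R))).
by apply: measurable_funD; exact: measurable_funX.
Qed.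

Lemma measurable_dist1 (D : set R) : measurable_fun D (@dist1 R).
Proof.
apply: measurable_cmod; rewrite /=.
have -> : (fun x : R => 1 - cexpi x) = (fun x => 1 + (-1) * cexpi x).
  by apply/funext => x; rewrite mulN1r.
apply: cmeasD; first exact: cmeas_cst.
by apply: cmeasM; [exact: cmeas_cst | exact: cmeas_cexpi].
Qed.

Definition dist1_le (y : R) : set R := [set x | dist1 x <= y].

Lemma measurable_dist1_le (D : set R) (y : R) : measurable D ->
  measurable (D `&` dist1_le y).
Proof.
move=> mD; have := measurable_dist1 mD (measurable_itv `]-oo, y]).
by rewrite preimage_itvNyc.
Qed.

(** With [p] the multiple of [2 pi] just below [s], the arc lies in [[p, p + 4 pi)]. Points of it
    close to [1] are within [4 y] of [p], [p + 2 pi] or [p + 4 pi], and three intervals of length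
    [8 y] give the [24]. *)
Lemma lebesgue_dist1_le (s l y : R) : 0 < l <= 2 * pi -> 0 < y ->
  (lebesgue_measure (`[s, (s + l)%R]%classic `&` dist1_le y)
   <= (24 * y)%:E)%E.
Proof.
move=> /andP[l0 l2] y0.
have [p hp /andP[ps sp]] := cexpi_base s.
pose I (c : R) : set R := `[(c - 4 * y)%R, (c + 4 * y)%R]%classic.
have mI c : measurable (I c) by exact: measurable_itv.
have pi0 := pi_gt0 R.
have hI c : lebesgue_measure (I c) = (8 * y)%:E.
  rewrite /I lebesgue_measure_itv /= lte_fin.
  have -> : c - 4 * y < c + 4 * y by lra.
  by rewrite -EFinD; congr (_%:E); ring.
have hper k x : dist1 (x + (p + 2 * pi *+ k)) = dist1 x.
  rewrite /dist1 cexpiD cexpiD hp mul1r.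
  have -> : cexpi (2 * pi *+ k) = 1 :> R[i].
    elim: k => [|k IH]; first by rewrite mulr0n cexpi0.
    by rewrite mulrSr cexpiD IH mul1r cexpi2pi.
  by rewrite mulr1.
have hnear k x : `|x - (p + 2 * pi *+ k)| <= pi -> dist1 x <= y ->
    I (p + 2 * pi *+ k) x.
  move=> h1 h2; have := dist1_ge h1.
  rewrite -(hper k) subrK => h3; rewrite /I /= in_itv /=.
  have : `|x - (p + 2 * pi *+ k)| <= 4 * y by lra.
  by rewrite ler_distl.
have mU2 : measurable (I (p + 2 * pi *+ 1) `|` I (p + 2 * pi *+ 2)).
  by apply: measurableU.
have mU : measurable (I (p + 2 * pi *+ 0) `|`
    (I (p + 2 * pi *+ 1) `|` I (p + 2 * pi *+ 2))) by apply: measurableU.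
apply: (@le_trans _ _ (lebesgue_measure (I (p + 2 * pi *+ 0) `|`
   (I (p + 2 * pi *+ 1) `|` I (p + 2 * pi *+ 2))))).
  apply: le_measure; rewrite ?inE.
  - by apply: measurable_dist1_le; exact: measurable_itv.
  - exact: mU.
  move=> x [/=]; rewrite in_itv /= => /andP[sx xs] hx.
  have [x1|x1] := leP x (p + pi).
    by left; apply: hnear => //; rewrite mulr0n addr0 ler_distl; apply/andP; split; lra.
  have [x2|x2] := leP x (p + 3 * pi).
    by right; left; apply: hnear => //; rewrite mulr1n ler_distl; apply/andP; split; lra.
  by right; right; apply: hnear => //; rewrite mulr2n ler_distl; apply/andP; split; lra.
have -> : (24 * y)%:E = ((8 * y)%:E + ((8 * y)%:E + (8 * y)%:E))%E.
  by rewrite -!EFinD; congr (_%:E); ring.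
apply: le_trans (@measureU2 _ _ _ lebesgue_measure _ _ (mI _) mU2) _.
have hI' c : (lebesgue_measure (I c) <= (8 * y)%:E)%E by rewrite hI.
apply: leeD; first exact: hI'.
by apply: le_trans (@measureU2 _ _ _ lebesgue_measure _ _ (mI _) (mI _)) _; apply: leeD; exact: hI'.
Qed.

(** The factor [1 + (l / d)^ep] of the oscillation bound. At [d = 0] the convention for powers of
    [0] makes it [1] when [ep] is nonzero; such angles form a null set discarded later. *)
Definition arcw (ep l x : R) : R := 1 + l `^ ep * dist1 x `^ (- ep).

Lemma arcw_ge1 ep l x : 1 <= arcw ep l x.
Proof. by rewrite lerDl mulr_ge0// powR_ge0. Qed.

Lemma measurable_arcw (D : set R) ep l : measurable_fun D (arcw ep l).
Proof.
apply: measurable_funD; first exact: measurable_cst.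
apply: measurable_funM; first exact: measurable_cst.
apply: (measurableT_comp (measurable_powR (- ep))).
exact: measurable_dist1.
Qed.

(** Angles with [d <= l / 2^k] have measure of order [l / 2^k], while the squared weight there is of
    order [2^(2 ep k)]; [ep < 1/2] makes the series converge, uniformly in the position of the
    arc. *)
Lemma arcw_integral (ep : R) : 0 < ep < 1/2 ->
  exists2 C : R, 0 <= C & forall s l : R, 0 < l <= 2 * pi ->
  (\int[lebesgue_measure]_(x in `[s, (s + l)%R]%classic) (arcw ep l x ^+ 2)%:E
   <= (C * l)%:E)%E.
Proof.
move=> /andP[ep0 ep1]; pose q : R := 2 `^ (2 * ep - 1).
have q1 : 0 <= q < 1 by rewrite powR_ge0 powR2_lt1//; lra.
have e1 : 1 <= 2 `^ ep :> R.
  by rewrite -[leLHS](pow1R ep); apply: ge0_ler_powR; rewrite ?nnegrE ?(ltW ep0)// ler1n.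
(* [96 = 4 * 24]: the [4] is the squared [2] in [c k], the [24] comes from [lebesgue_dist1_le], and
   the square of [2^ep] is the surplus of the exponent [k.+1]. *)
pose A := 96 * (2 `^ ep) ^+ 2.
have A0 : 0 <= A by rewrite mulr_ge0// exprn_ge0// powR_ge0.
exists (A / (1 - q)) => [|s l hl].
  by rewrite divr_ge0// subr_ge0; case/andP: q1 => _ /ltW.
have l0 : 0 < l by case/andP: hl.
rewrite mulrAC.
pose D : set R := `[s, (s + l)%R]%classic.
have mD : measurable D by exact: measurable_itv.
(* The set of index [0] is the whole arc, so that it also takes in the angles with [d > l] and those
   with [d = 0]. *)
apply: (@series_dominated_integral _ _ lebesgue_measure D _
  (fun k => if k is _.+1 then D `&` dist1_le (l * (1/2) ^+ k) else D)
  (fun k => (2 * (2 `^ ep) ^+ k.+1) ^+ 2)) => //.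
- by apply: measurable_funX; exact: measurable_arcw.
- by move=> x _; rewrite exprn_ge0// (le_trans ler01)// arcw_ge1.
- by case=> [//|k]; exact: measurable_dist1_le.
- by rewrite mulr_ge0// ltW.
- have red k x : l `^ ep * dist1 x `^ (- ep) <= (2 `^ ep) ^+ k.+1 ->
      arcw ep l x ^+ 2 <= (2 * (2 `^ ep) ^+ k.+1) ^+ 2.
    move=> h; rewrite lerXn2r ?nnegrE//.
      by rewrite (le_trans ler01)// arcw_ge1.
    have : 1 <= (2 `^ ep) ^+ k.+1 :> R by rewrite exprn_ege1.
    by rewrite /arcw; lra.
  move=> x Dx; have := dist1_ge0 x; rewrite le_eqVlt => /orP[/eqP d0|d0].
    exists 0%N; split => //; apply: red.
    by rewrite -d0 powR0 ?oppr_eq0 ?gt_eqF// mulr0 exprn_ge0// powR_ge0.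
  have [dl|dl] := leP (dist1 x) l; last first.
    exists 0%N; split => //; apply: red; rewrite expr1; apply: le_trans e1.
    rewrite powRN ler_pdivrMr ?powR_gt0// mul1r.
    by apply: ge0_ler_powR; rewrite ?nnegrE ?(ltW ep0)//; exact: ltW.
  have dd : 0 < dist1 x <= l by rewrite d0.
  have [k /andP[h1 h2]] := dyadic_low dd.
  exists k; split; first by case: k h1 h2 => // k _ h2; split.
  apply: red; rewrite powRN ler_pdivrMr ?powR_gt0// -powR_exprn// -powRM ?exprn_ge0 ?(ltW d0)//.
  apply: ge0_ler_powR; rewrite ?nnegrE ?(ltW ep0) ?(ltW l0) ?mulr_ge0 ?exprn_ge0 ?(ltW d0)//.
  by move: h1; rewrite mul1r exprVn ltr_pdivrMr ?exprn_gt0// mulrC => /ltW.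
- move=> k.
  have hm : (lebesgue_measure (if k is _.+1 then
      D `&` dist1_le (l * (1/2) ^+ k) else D) <= (24 * (l * (1/2) ^+ k))%:E)%E.
    case: k => [|k].
      rewrite /D lebesgue_measure_itv /= lte_fin ltrDl l0 -EFinB lee_fin expr0.
      by rewrite addrAC subrr add0r; lra.
    by apply: lebesgue_dist1_le => //; rewrite mulr_gt0// exprn_gt0//; lra.
  apply: le_trans (lee_wpmul2l _ hm) _.
    by rewrite lee_fin exprn_ge0// mulr_ge0// exprn_ge0// powR_ge0.
  rewrite -EFinM lee_fin.
  have -> : q = (2 `^ ep) ^+ 2 * (1/2).
    rewrite /q powRD ?pnatr_eq0 ?implybT// powR_inv1// mul1r; congr (_ * _).
    by rewrite mulrC powRrM powR_mulrn// powR_ge0.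
  rewrite /A [(_ * (1/2)) ^+ k]exprMn [(_ ^+ 2) ^+ k]exprAC [_ ^+ k.+1]exprS.
  by rewrite le_eqVlt; apply/orP; left; apply/eqP; ring.
Qed.

(** The Morrey condition subtracts the true mean, the oscillation estimate an ad hoc constant [c];
    this compares them. Since [W >= 1], [W <= W ^+ 2], so the square integral of the weight also
    controls a first moment. *)
Lemma arc_mean_bound (s l C E c : R) (N : set R) (v W : R -> R) :
  0 < l -> 0 <= E -> 0 <= C ->
  measurable N -> lebesgue_measure N = 0%E ->
  measurable_fun `[s, (s + l)%R]%classic v ->
  measurable_fun `[s, (s + l)%R]%classic W ->
  (forall x, 1 <= W x) ->
  (forall x, (`[s, (s + l)%R]%classic `\` N) x -> `|v x - c| <= E * W x) ->
  (\int[lebesgue_measure]_(x in `[s, (s + l)%R]%classic) (W x ^+ 2)%:E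
    <= (C * l)%:E)%E ->
  `|Lint v s l / l - c| <= E * C.
Proof.
set D : set R := `[s, (s + l)%R]%classic.
move=> l0 E0 C0 mN N0 mv mW W1 hvc hW.
have mD : measurable D by exact: measurable_itv.
have hD : lebesgue_measure D = l%:E.
  rewrite /D lebesgue_measure_itv /= lte_fin ltrDl l0 -EFinB.
  by rewrite addrAC subrr add0r.
have mD' : measurable (D `\` N) by exact: measurableD.
have mvc : measurable_fun D (fun x => v x - c).
  by apply: measurable_funB => //; exact: measurable_cst.
have hle : (\int[lebesgue_measure]_(x in D) `|(v x - c)%:E| <= (E * (C * l))%:E)%E.
  rewrite (@ge0_negligible_integral _ _ _ lebesgue_measure D N
    (fun x => `|(v x - c)%:E|%E) mN mD)//; last first.
    by apply/measurable_EFinP; exact: measurableT_comp.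
  apply: (@le_trans _ _ (\int[lebesgue_measure]_(x in D `\` N) (E%:E * (W x ^+ 2)%:E))%E).
    apply: ge0_le_integral => //.
    - apply/measurable_EFinP; apply: measurableT_comp => //.
      by apply: measurable_funS mvc => // x [].
    - apply: measurable_funeM; apply/measurable_EFinP.
      by apply: measurable_funX; apply: measurable_funS mW => // x [].
    - move=> x hx; rewrite abse_EFin -EFinM lee_fin; apply: le_trans (hvc x hx) _.
      by apply: ler_wpM2l => //; rewrite expr2 ler_peMl// (le_trans ler01).
  apply: (@le_trans _ _ (\int[lebesgue_measure]_(x in D) (E%:E * (W x ^+ 2)%:E))%E).
    apply: ge0_subset_integral => //.
    - by apply: measurable_funeM; apply/measurable_EFinP; exact: measurable_funX.
    - by move=> x _; rewrite -EFinM lee_fin mulr_ge0// exprn_ge0// (le_trans ler01).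
  rewrite ge0_integralZl_EFin//; last 2 first.
  - by move=> x _; rewrite lee_fin exprn_ge0// (le_trans ler01).
  - by apply/measurable_EFinP; exact: measurable_funX.
  by rewrite EFinM; apply: lee_wpmul2l.
have intvc : lebesgue_measure.-integrable D (EFin \o (fun x => v x - c)).
  apply/integrableP; split; first exact/measurable_EFinP.
  by apply: le_lt_trans hle _; rewrite ltry.
have intc : lebesgue_measure.-integrable D (EFin \o (fun=> c)).
  apply/integrableP; split; first by apply/measurable_EFinP; exact: measurable_cst.
  rewrite (_ : (fun x => `|(EFin \o (fun=> c)) x|%E) = cst (`|c|%:E))//.
  have hlt : (`|c|%:E * lebesgue_measure D < +oo)%E by rewrite hD -EFinM ltry.
  by rewrite integral_cst//; exact: hlt.
have hv : Lint v s l = \int[lebesgue_measure]_(x in D) (v x - c) + c * l.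
  have -> : c * l = \int[lebesgue_measure]_(x in D) c.
    by rewrite Rintegral_cst//; congr (_ * _); exact: esym (congr1 fine hD).
  rewrite -RintegralD// /Lint /Rintegral; congr fine.
  by apply: eq_integral => x _; rewrite subrK.
rewrite hv mulrDl mulfK ?gt_eqF// addrK normrM [X in _ * X]ger0_norm ?invr_ge0 ?(ltW l0)//.
rewrite ler_pdivrMr// -mulrA -lee_fin EFin_normr_Rintegral//.
apply: le_trans hle; apply: le_abse_integral => //; exact/measurable_EFinP.
Qed.

End Integrals.

(** * Closed graph theorem by Baire category *)

Section ClosedGraph.
Variable R : realType.
Implicit Types (f g x y : nat -> R[i]).

Let vadd f g : nat -> R[i] := fun n => f n + g n.
Let vsub f g : nat -> R[i] := fun n => f n - g n.
Let vscale (c : R[i]) f : nat -> R[i] := fun n => c * f n.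

(** No definiteness is asked, so that the pullback [fun f => NY (T f)] qualifies as a second
    seminorm on [X]. *)
Record seminorm_on (X : set (nat -> R[i])) (N : (nat -> R[i]) -> R) : Prop := {
  sn_add : forall f g, X f -> X g -> X (vadd f g);
  sn_scale : forall c f, X f -> X (vscale c f);
  sn_ge0 : forall f, X f -> 0 <= N f;
  sn_hom : forall c f, X f -> N (vscale c f) = cmod c * N f;
  sn_tri : forall f g, X f -> X g -> N (vadd f g) <= N f + N g }.

Lemma sn_sub X N f g : seminorm_on X N -> X f -> X g -> X (vsub f g).
Proof.
move=> h Xf Xg; have -> : vsub f g = vadd f (vscale (-1) g).
  by apply/funext => n; rewrite /vadd /vscale mulN1r.
by apply: (sn_add h) => //; exact: (sn_scale h).
Qed.

Lemma sn_subtri X N f g : seminorm_on X N -> X f -> X g ->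
  N (vsub f g) <= N f + N g.
Proof.
move=> h Xf Xg; have -> : vsub f g = vadd f (vscale (-1) g).
  by apply/funext => n; rewrite /vadd /vscale mulN1r.
apply: le_trans (sn_tri h Xf (sn_scale h (-1) Xg)) _.
by rewrite (sn_hom h)// cmodN cmod1 mul1r.
Qed.

Lemma sn_subC X N f g : seminorm_on X N -> X f -> X g ->
  N (vsub f g) = N (vsub g f).
Proof.
move=> h Xf Xg; have -> : vsub f g = vscale (-1) (vsub g f).
  by apply/funext => n; rewrite /vsub /vscale mulN1r opprB.
by rewrite (sn_hom h) ?cmodN ?cmod1 ?mul1r//; exact: (sn_sub h).
Qed.

Lemma sn_dist X N f g x : seminorm_on X N -> X f -> X g -> X x ->
  N (vsub f x) <= N (vsub f g) + N (vsub g x).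
Proof.
move=> h Xf Xg Xx.
have -> : vsub f x = vadd (vsub f g) (vsub g x).
  by apply/funext => n; rewrite /vsub /vadd addrA subrK.
by apply: (sn_tri h); exact: (sn_sub h).
Qed.

Definition seq_complete (X : set (nat -> R[i])) (N : (nat -> R[i]) -> R) :=
  forall u : nat -> nat -> R[i], (forall m, X (u m)) ->
   (forall e : R, 0 < e -> exists K : nat, forall m n, (K <= m)%N ->
      (K <= n)%N -> N (vsub (u m) (u n)) < e) ->
   exists2 f, X f & forall e : R, 0 < e -> exists K : nat,
      forall n, (K <= n)%N -> N (vsub (u n) f) < e.

(* Baire category argument: the sublevel sets of a second seminorm cannot all
   be nowhere dense. *)
Lemma seminorm_sublevel_dense_ball X N (p : (nat -> R[i]) -> R) :
  X (fun=> 0) -> seminorm_on X N -> seq_complete X N ->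
  exists (n : nat) (x0 : nat -> R[i]) (e : R), [/\ X x0, 0 < e &
    forall x, X x -> N (vsub x x0) < e -> forall eta : R, 0 < eta ->
      exists y, [/\ X y, p y <= n%:R & N (vsub x y) < eta]].
Proof.
move=> X0 hN cN; apply: contrapT => hno.
(* If the conclusion fails, every ball contains a smaller one whose double avoids the elements with
   [p y <= n]. Membership and positivity are premises inside the existential so that [choice] yields
   a total function. *)
have H (ns : nat * ((nat -> R[i]) * R)) : exists st' : (nat -> R[i]) * R,
    X ns.2.1 -> 0 < ns.2.2 ->
    [/\ X st'.1, 0 < st'.2, st'.2 <= ns.2.2 / 2,
      N (vsub st'.1 ns.2.1) < ns.2.2 / 2 &
      forall y, X y -> p y <= ns.1%:R -> st'.2 * 2 <= N (vsub st'.1 y)].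
  case: ns => n [x0 e] /=; apply: contrapT => hno2; apply: hno.
  have [Xx0 e0] : X x0 /\ 0 < e.
    by split; apply: contrapT => h; apply: hno2; exists (x0, e) => ? ?; exfalso; apply: h.
  exists n, x0, (e / 2); split; rewrite ?divr_gt0// => x Xx hx eta eta0.
  apply: contrapT => hno3; apply: hno2.
  exists (x, Num.min (e / 2) (eta / 2)) => _ _ /=; split => //.
  - by rewrite lt_min !divr_gt0.
  - by rewrite ge_min lexx.
  - move=> y Xy py; rewrite leNgt; apply/negP => hlt; apply: hno3.
    exists y; split => //; apply: lt_le_trans hlt _.
    by rewrite -ler_pdivlMr// ge_min lexx orbT.
have [g hg] := choice H.
pose fix s n := if n is m.+1 then g (m, s m) else ((fun=> 0) : nat -> R[i], 1 : R).
have hs n : X (s n).1 /\ 0 < (s n).2.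
  elim: n => [|n [IH1 IH2]]; first by [].
  by have [] := hg (n, s n) IH1 IH2.
have Xs n : X (s n).1 by case: (hs n).
have s0 n : 0 < (s n).2 by case: (hs n).
have hst n : [/\ (s n.+1).2 <= (s n).2 / 2,
      N (vsub (s n.+1).1 (s n).1) < (s n).2 / 2 &
      forall y, X y -> p y <= n%:R -> (s n.+1).2 * 2 <= N (vsub (s n.+1).1 y)].
  by have [] := hg (n, s n) (Xs n) (s0 n).
have zero : N (fun=> 0) = 0.
  have -> : (fun=> 0) = vscale 0 (fun=> 0) by apply/funext => n; rewrite /vscale mul0r.
  by rewrite (sn_hom hN)// cmod0 mul0r.
have vsubrr f : vsub f f = fun=> 0 by apply/funext => n; rewrite /vsub subrr.
(* Each centre moves by less than half the radius and the radius at least halves, so radii lost pay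
   for distances travelled: the balls are nested. *)
have htel n k : N (vsub (s (n + k)%N).1 (s n).1) <= (s n).2 - (s (n + k)%N).2.
  elim: k => [|k IH]; first by rewrite addn0 vsubrr zero subrr.
  rewrite addnS; apply: le_trans (sn_dist hN (Xs _) (Xs (n + k)%N) (Xs _)) _.
  have [h1 h2 _] := hst (n + k)%N.
  apply: le_trans (lerD (ltW h2) IH) _.
  by move: h1; set e1 := (s (n + k).+1).2; set e2 := (s (n + k)%N).2; lra.
have hd n m : (n <= m)%N -> N (vsub (s m).1 (s n).1) <= (s n).2.
  move=> nm; rewrite -(subnKC nm); apply: le_trans (htel _ _) _.
  by rewrite gerBl ltW.
have se n : (s n).2 <= (1/2) ^+ n.
  elim: n => [|n IH]; first by rewrite expr0.
  have [h1 _ _] := hst n; apply: le_trans h1 _; rewrite exprS.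
  by move: IH; set e := (1/2) ^+ n; lra.
have [|x Xx hx] := cN (fun n => (s n).1) Xs.
  move=> e e0; have [K hK] := half_expr_small 2 e0; exists K => m n Km Kn.
  apply: le_lt_trans (sn_dist hN (Xs m) (Xs K) (Xs n)) _.
  rewrite (sn_subC hN (Xs K) (Xs n)); apply: le_lt_trans hK.
  apply: le_trans (lerD (hd _ _ Km) (hd _ _ Kn)) _.
  by have := se K; lra.
(* The limit [x] has [p x <= n], so it must keep twice the radius of stage [n.+1] away from that
   centre; as a limit of the nested centres it is within one and a half radii. *)
pose n := (Num.truncn (p x)).+1.
have [_ _ h3] := hst n.
have pn : p x <= n%:R by apply/ltW/truncnS_gt.
have := h3 x Xx pn; apply/negP; rewrite -ltNge.
have e0 : 0 < (s n.+1).2 / 2 by rewrite divr_gt0.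
have [K hK] := hx _ e0.
have XK := Xs (maxn K n.+1); have Xn := Xs n.+1.
rewrite (sn_subC hN)//; apply: le_lt_trans (sn_dist hN Xx XK Xn) _.
have h4 := hK _ (leq_maxl K n.+1); have h5 := hd _ _ (leq_maxr K n.+1).
rewrite (sn_subC hN)//; have := s0 n.+1; lra.
Qed.

(** Scaling by [c = e / (2 N x)] brings [x] inside the ball of the previous lemma. Approximating
    [x0 + c x] and [x0] by elements with [p <= n] and dividing the difference by [c] gives
    [p <= 2 n / c], whence the constant [4 n / e]. *)
Lemma seminorm_approx X N (p : (nat -> R[i]) -> R) :
  X (fun=> 0) -> seminorm_on X N -> seq_complete X N -> seminorm_on X p ->
  exists2 K : R, 0 <= K & forall x, X x -> forall eta : R, 0 < eta ->
    exists y, [/\ X y, p y <= K * N x & N (vsub x y) < eta].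
Proof.
move=> X0 hN cN hp.
have [n [x0 [e [Xx0 e0 he]]]] := seminorm_sublevel_dense_ball p X0 hN cN.
have hom0 q : seminorm_on X q -> q (fun=> 0) = 0.
  move=> hq; have -> : (fun=> 0) = vscale 0 (fun=> 0).
    by apply/funext => k; rewrite /vscale mul0r.
  by rewrite (sn_hom hq)// cmod0 mul0r.
exists (4 * n%:R / e) => [|x Xx eta eta0].
  by rewrite divr_ge0 ?mulr_ge0 ?(ltW e0).
have := sn_ge0 hN Xx; rewrite le_eqVlt => /orP[/eqP r0|r0].
  exists (fun=> 0); split => //; first by rewrite hom0// -r0 mulr0.
  have -> : vsub x (fun=> 0) = x by apply/funext => k; rewrite /vsub subr0.
  by rewrite -r0.
set r := N x in r0 *; pose c := e / (2 * r).
have c0 : 0 < c by rewrite divr_gt0// mulr_gt0.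
have cc : cmod (rC c) = c by rewrite cmod_rC gtr0_norm.
have ci : cmod (rC c^-1) = c^-1 by rewrite cmod_rC gtr0_norm// invr_gt0.
have Xcx := sn_scale hN (rC c) Xx.
have X1 := sn_add hN Xx0 Xcx.
have h1 : N (vsub (vadd x0 (vscale (rC c) x)) x0) < e.
  have -> : vsub (vadd x0 (vscale (rC c) x)) x0 = vscale (rC c) x.
    by apply/funext => k; rewrite /vsub /vadd addrC addKr.
  rewrite (sn_hom hN)// cc -/r.
  have -> : c * r = e / 2 by rewrite /c; field; rewrite gt_eqF.
  by rewrite ltr_pdivrMr// ltr_pMr// ltr1n.
have h2 : N (vsub x0 x0) < e.
  have -> : vsub x0 x0 = fun=> 0 by apply/funext => k; rewrite /vsub subrr.
  by rewrite hom0.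
have eta1 : 0 < c * eta / 2 by rewrite divr_gt0// mulr_gt0.
have [y1 [Xy1 py1 hy1]] := he _ X1 h1 _ eta1.
have [y2 [Xy2 py2 hy2]] := he _ Xx0 h2 _ eta1.
have Xy := sn_sub hN Xy1 Xy2.
exists (vscale (rC c^-1) (vsub y1 y2)); split.
- exact: sn_scale hN _ _ Xy.
- rewrite (sn_hom hp)// ci.
  have hpy : p (vsub y1 y2) <= 2 * n%:R.
    by apply: le_trans (sn_subtri hp Xy1 Xy2) _; lra.
  apply: le_trans (ler_wpM2l _ hpy) _; first by rewrite invr_ge0 ltW.
  rewrite le_eqVlt; apply/orP; left; apply/eqP; rewrite /c; field.
  by rewrite !gt_eqF.
have -> : vsub x (vscale (rC c^-1) (vsub y1 y2)) = vscale (rC c^-1)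
    (vsub (vsub (vadd x0 (vscale (rC c) x)) y1) (vsub x0 y2)).
  have hc : rC c^-1 * rC c = 1 by rewrite -rCM mulVf ?rC1// gt_eqF.
  apply/funext => k; rewrite /vsub /vscale /vadd.
  transitivity (rC c^-1 * rC c * x k - rC c^-1 * (y1 k - y2 k)).
    by rewrite hc mul1r.
  by rewrite -mulrA -mulrBr; congr (_ * _); ring.
rewrite (sn_hom hN); last by apply: (sn_sub hN); exact: (sn_sub hN).
rewrite ci mulrC ltr_pdivrMr// mulrC.
apply: le_lt_trans (sn_subtri hN (sn_sub hN X1 Xy1) (sn_sub hN Xx0 Xy2)) _.
by rewrite (splitr (c * eta)); exact: ltrD.
Qed.

Lemma banach_seminorm X N : @banach_HD R X N ->
  [/\ X (fun=> 0), seminorm_on X N & seq_complete X N].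
Proof.
case=> _ [X0 [Xa Xs]] [N0 [_ [Nh Nt]]] cN _; split => //.
Qed.

(** Approximating the successive remainders of [x] writes it as a series whose images have norms at
    most [K r / 2^k], so they sum in [Y] to a limit of norm at most [2 K r]. Bounded evaluations of
    [T f] play the part of the closed graph: they identify the limit with [T x]. *)
Lemma closed_graph X NX Y NY (T : (nat -> R[i]) -> (nat -> R[i])) :
  banach_HD X NX -> banach_HD Y NY ->
  (forall f g, T (fun n => f n + g n) = fun n => T f n + T g n) ->
  (forall c f, T (fun n => c * f n) = fun n => c * T f n) ->
  (forall f, X f -> Y (T f)) ->
  (forall z, cmod z < 1 -> exists C : R, forall f, X f ->
     cmod (peval (T f) z) <= C * NX f) ->
  exists C : R, forall f, X f -> NY (T f) <= C * NX f.
Proof.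
move=> bX bY TD TZ TXY Tev.
have [X0 sX cX] := banach_seminorm bX; have [Y0 sY cY] := banach_seminorm bY.
have TB f g : T (vsub f g) = vsub (T f) (T g).
  have -> : vsub f g = (fun n => f n + vscale (-1) g n).
    by apply/funext => n; rewrite /vscale mulN1r.
  by rewrite TD TZ; apply/funext => n; rewrite /vsub mulN1r.
have hp : seminorm_on X (fun f => NY (T f)).
  split; [exact: sn_add sX | exact: sn_scale sX | | |].
  - by move=> f /TXY; exact: sn_ge0 sY _.
  - by move=> c f Xf; rewrite /vscale TZ (sn_hom sY) //; exact: TXY.
  - by move=> f g Xf Xg; rewrite /vadd TD; apply: (sn_tri sY); exact: TXY.
have [K K0 hK] := seminorm_approx X0 sX cX hp.
exists (2 * K) => x Xx.
(* A positive [r] above [NX x] keeps the tolerances [r / 2^k] positive even when [NX x = 0]. *)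
suff main (r : R) : 0 < r -> NX x <= r -> NY (T x) <= 2 * K * r.
  apply/ler_addgt0Pr => e e0.
  have K1 : 0 < 2 * K + 1 by lra.
  have r0 : 0 < NX x + e / (2 * K + 1).
    by rewrite ltr_wpDl ?(sn_ge0 sX)// divr_gt0.
  apply: le_trans (main _ r0 _) _; first by rewrite lerDl ltW// divr_gt0.
  rewrite mulrDr lerD2l mulrA ler_pdivrMr// mulrC ler_pM2l//; lra.
move=> r0 xr.
have H (kx : nat * (nat -> R[i])) : exists y, X kx.2 ->
    [/\ X y, NY (T y) <= K * NX kx.2 & NX (vsub kx.2 y) < r * (1/2) ^+ kx.1.+1].
  case: kx => k u /=; have [Xu|nXu] := pselect (X u); last by exists u.
  have e0 : 0 < r * (1/2) ^+ k.+1 by rewrite mulr_gt0 ?exprn_gt0//; lra.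
  by have [y hy] := hK u Xu _ e0; exists y.
have [g hg] := choice H.
pose fix s n := if n is m.+1 then vsub (s m) (g (m, s m)) else x.
have hs n : X (s n) /\ NX (s n) <= r * (1/2) ^+ n.
  elim: n => [|n [IH1 IH2]]; first by rewrite expr0 mulr1.
  have [h1 h2 h3] := hg (n, s n) IH1; split; last exact: ltW.
  exact: (sn_sub sX).
have Xs n : X (s n) by case: (hs n).
have Ns n : NX (s n) <= r * (1/2) ^+ n by case: (hs n).
have Yg n : NY (T (g (n, s n))) <= K * r * (1/2) ^+ n.
  have [_ h _] := hg (n, s n) (Xs n); apply: le_trans h _.
  by rewrite -mulrA; apply: ler_wpM2l => //; exact: Ns.
pose u n := vsub (T x) (T (s n)).
have Yu n : Y (u n) by apply: (sn_sub sY); exact: TXY.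
have zeroY : NY (fun=> 0) = 0.
  have -> : (fun=> 0) = vscale 0 (fun=> 0) by apply/funext => k; rewrite /vscale mul0r.
  by rewrite (sn_hom sY)// cmod0 mul0r.
have vsubrr f : vsub f f = fun=> 0 by apply/funext => n; rewrite /vsub subrr.
have htel n k : NY (vsub (u (n + k)%N) (u n)) <=
    2 * K * r * ((1/2) ^+ n - (1/2) ^+ (n + k)).
  elim: k => [|k IH]; first by rewrite addn0 vsubrr zeroY subrr mulr0.
  rewrite addnS; apply: le_trans (sn_dist sY (Yu _) (Yu (n + k)%N) (Yu _)) _.
  have hu : vsub (u (n + k).+1) (u (n + k)%N) = T (g ((n + k)%N, s (n + k)%N)).
    rewrite /u /= TB; apply/funext => i; rewrite /vsub; ring.
  rewrite hu; apply: le_trans (lerD (Yg _) IH) _.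
  by rewrite exprS le_eqVlt; apply/orP; left; apply/eqP; field.
have Kr : 0 <= 2 * K * r by rewrite !mulr_ge0// ltW.
have hd n m : (n <= m)%N -> NY (vsub (u m) (u n)) <= 2 * K * r * (1/2) ^+ n.
  move=> nm; rewrite -(subnKC nm); apply: le_trans (htel _ _) _.
  by apply: ler_wpM2l => //; rewrite gerBl exprn_ge0//; lra.
have [|f Yf hf] := cY u Yu.
  move=> e e0; have [k hk] := half_expr_small (2 * (2 * K * r)) e0.
  exists k => m n km kn.
  apply: le_lt_trans (sn_dist sY (Yu m) (Yu k) (Yu n)) _.
  rewrite (sn_subC sY (Yu k) (Yu n)); apply: le_lt_trans hk.
  apply: le_trans (lerD (hd _ _ km) (hd _ _ kn)) _.
  by rewrite le_eqVlt; apply/orP; left; apply/eqP; ring.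
suff <- : f = T x.
  apply/ler_addgt0Pr => e e0; have [k hk] := hf e e0.
  have -> : f = vsub (u k) (vsub (u k) f).
    by apply/funext => i; rewrite /vsub subKr.
  apply: le_trans (sn_subtri sY (Yu k) (sn_sub sY (Yu k) Yf)) _.
  apply: lerD; last exact/ltW/hk.
  have -> : u k = vsub (u k) (u 0%N).
    by apply/funext => i; rewrite /vsub /u /= /vsub subrr subr0.
  by apply: le_trans (hd _ _ (leq0n k)) _; rewrite expr0 mulr1.
have YHD h : Y h -> HD h by case: bY => + _ _ _ _; exact.
have hfT : HD (vsub f (T x)) by apply: HDB; apply: YHD => //; exact: TXY.
suff : vsub f (T x) = fun=> 0.
  by move=> /funeqP h; apply/funext => i; apply/eqP; rewrite -subr_eq0; apply/eqP/h.
(* The difference [f - T x] equals [- (u n - f) - T (s n)]. Its value at [z] is small by continuity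
   of evaluation on [Y] for the first part and by the assumed bound on [T] for the second. *)
apply: (peval_eq0 hfT) => z z1; apply/eqP; rewrite -cmod_eq0 eq_le cmod_ge0 andbT.
have [CT hCT] := Tev z z1.
have [CY hCY] : exists C : R, forall h, Y h -> cmod (peval h z) <= C * NY h.
  case: bY => _ _ _ _ /(_ (cmod z)) []; first by rewrite cmod_ge0.
  by move=> C hC; exists C => h Yh; exact: hC.
have key n : cmod (peval (vsub f (T x)) z) <=
    `|CY| * NY (vsub (u n) f) + `|CT| * (r * (1/2) ^+ n).
  have Yd := sn_sub sY (Yu n) Yf.
  have -> : vsub f (T x) = vsub (vscale (-1) (vsub (u n) f)) (T (s n)).
    by apply/funext => i; rewrite /vscale /vsub /u /vsub; ring.
  rewrite [peval _ _]pevalB//; last 2 first.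
  - by apply: YHD; exact: (sn_scale sY).
  - by apply: YHD; exact: TXY.
  apply: le_trans (cmodBD _ _) _; apply: lerD.
    apply: le_trans (hCY _ (sn_scale sY (-1) Yd)) _.
    rewrite (sn_hom sY)// cmodN cmod1 mul1r; apply: ler_wpM2r; last exact: ler_norm.
    exact: sn_ge0 sY _ Yd.
  apply: le_trans (hCT _ (Xs n)) _.
  apply: le_trans (ler_wpM2r (sn_ge0 sX (Xs n)) (ler_norm CT)) _.
  by apply: ler_wpM2l.
apply/ler_addgt0Pr => e e0; rewrite add0r.
have e1 : 0 < e / 2 / (`|CY| + 1) by rewrite !divr_gt0// ltr_wpDl.
have [k1 hk1] := hf _ e1.
have e2 : 0 < e / 2 by rewrite divr_gt0.
have [k2 hk2] := half_expr_small (`|CT| * r) e2.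
pose n := maxn k1 k2; apply: le_trans (key n) _; rewrite (splitr e); apply: lerD.
  apply: le_trans (ler_wpM2l (normr_ge0 _) (ltW (hk1 n (leq_maxl _ _)))) _.
  rewrite mulrA ler_pdivrMr ?ltr_wpDl// [leLHS]mulrC.
  by apply: ler_wpM2l; [exact: ltW | rewrite lerDl].
apply: le_trans (ltW hk2); rewrite mulrA; apply: ler_wpM2l; first by rewrite mulr_ge0// ltW.
by apply: ler_wiXn2l; rewrite ?leq_maxr//; lra.
Qed.

End ClosedGraph.

(** * Kernel estimates and the integral formula for the operator *)

Lemma quotient_sub (F : fieldType) (A B u v : F) : u != 0 -> v != 0 ->
  A / u - B / v = (A - B) / u + B * (v - u) * (u^-1 * v^-1).
Proof. by move=> u0 v0; field; rewrite u0 v0. Qed.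

Section CesaroMorrey.
Variable R : realType.
Implicit Types (z w : R[i]) (a b : nat -> R[i]).

(** Taylor coefficients of [f (w) / (1 - w)]; the operator multiplies them by the moments. *)
Definition psums a : nat -> R[i] := fun n => \sum_(k < n.+1) a k.

Lemma HD_psums a : HD a -> HD (psums a).
Proof.
move=> /HD_absum ha; apply/HD_absum/bounded_absum => r r01.
have [B B0 hB] := ha r r01; exists B => // n.
case/andP: r01 => r0 r1.
apply: le_trans (hB n.+1); apply: le_trans (ler_wpM2r (exprn_ge0 _ r0) (cmod_sum _ _)) _.
rewrite mulr_suml; apply: ler_sum => i _; apply: ler_wpM2l; first exact: cmod_ge0.
by apply: ler_wiXn2l => //; [exact: ltW | rewrite -ltnS].
Qed.

(** Summation by parts; the boundary term tends to [0] in the disc, which gives [peval_psums]. *)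
Lemma cpsum_psums a w n : (1 - w) * cpsum (fun k => psums a k * w ^+ k) n.+1 =
  cpsum (fun k => a k * w ^+ k) n.+1 - psums a n * w ^+ n * w.
Proof.
rewrite /cpsum; elim: n => [|n IH].
  by rewrite !big_ord_recr !big_ord0 /= !add0r expr0 !mulr1 /psums big_ord_recr big_ord0 /= add0r; ring.
rewrite big_ord_recr /= mulrDr IH [in RHS]big_ord_recr /=.
have -> : psums a n.+1 = psums a n + a n.+1 by rewrite /psums big_ord_recr.
by rewrite !exprS; ring.
Qed.

Lemma peval_psums a w : HD a -> cmod w < 1 ->
  peval (psums a) w = peval a w / (1 - w).
Proof.
move=> ha w1; have hs := HD_psums ha.
have w0 : 1 - w != 0.
  rewrite -cmod_gt0; apply: lt_le_trans (cmod_rev _ _).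
  by rewrite cmod1 subr_gt0.
have h1 := peval_cvg hs w1.
have h0 : ccvg (fun n => psums a n * w ^+ n) 0.
  have := ccvgB (ccvg_shift h1) h1; rewrite subrr.
  by apply: eq_ccvg => n; rewrite /cpsum big_ord_recr /= addrAC subrr add0r.
have h2 := ccvgZ (1 - w) (ccvg_shift h1).
have h3 : ccvg (fun n => (1 - w) * cpsum (fun k => psums a k * w ^+ k) n.+1)
    (peval a w).
  have := ccvgB (ccvg_shift (peval_cvg ha w1)) (ccvgM h0 (ccvg_cst w)).
  by rewrite mul0r subr0; apply: eq_ccvg => n; rewrite cpsum_psums.
by rewrite -(ccvg_unique h2 h3) mulrC mulKf.
Qed.

(** The second bound follows from the first: moving radially from [r e^(ix)] to [e^(ix)] costs
    [1 - r], so [d] is at most twice the modulus. *)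
Lemma cmod_1B_ge (r x : R) : 0 <= r <= 1 ->
  1 - r <= cmod (1 - rC r * cexpi x) /\ dist1 x / 2 <= cmod (1 - rC r * cexpi x).
Proof.
move=> /andP[r0 r1]; have cr : cmod (rC r * cexpi x) = r.
  by rewrite cmodM cmod_cexpi mulr1 cmod_rC ger0_norm.
have h1 : 1 - r <= cmod (1 - rC r * cexpi x).
  by apply: le_trans (cmod_rev _ _); rewrite cmod1 cr.
split => //.
have : dist1 x <= cmod (1 - rC r * cexpi x) + (1 - r).
  have -> : 1 - r = cmod (rC r * cexpi x - cexpi x).
    have -> : rC r * cexpi x - cexpi x = rC (r - 1) * cexpi x.
      by rewrite rCB rC1 mulrBl mul1r.
    by rewrite cmodM cmod_cexpi mulr1 cmod_rC distrC ger0_norm// subr_ge0.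
  by apply: le_trans (cmodD _ _); rewrite addrA subrK.
by lra.
Qed.

(** The right-hand side does not involve [r]. One majorant thus serves for boundary values
    ([r = 1]), for the passage to radial limits and for the [H2] means. *)
Lemma kernel_bound (al K ep t r x : R) a : HD a -> growth al K a -> 1 <= al ->
  0 <= K -> 0 < ep < 1 -> 0 <= t < 1 -> 0 <= r <= 1 -> 0 < dist1 x ->
  cmod (peval (psums a) (rC t * (rC r * cexpi x))) <=
  K * (dist1 x / 2) `^ (- ep) * (1 - t) `^ (- (al - ep)).
Proof.
move=> ha hg al1 K0 /andP[ep0 ep1] /andP[t0 t1] /andP[r0 r1] d0.
have tr : t * r <= t by rewrite ler_piMr.
have tr0 : 0 <= t * r by rewrite mulr_ge0.
rewrite mulrA -rCM; set w := rC _ * _.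
have cw : cmod w = t * r by rewrite cmodM cmod_cexpi mulr1 cmod_rC ger0_norm.
have w1 : cmod w < 1 by rewrite cw; apply: le_lt_trans t1.
rewrite peval_psums// cmodM cmodV.
have trr : 0 <= t * r <= 1 by rewrite tr0 (le_trans tr)// ltW.
have [h1 h2] := cmod_1B_ge x trr; rewrite -/w in h1 h2.
set m := cmod (1 - w) in h1 h2 *.
have t1' : 0 < 1 - t by rewrite subr_gt0.
have tm : 1 - t <= m by apply: le_trans h1; rewrite lerD2l lerN2.
have m0 : 0 < m by apply: lt_le_trans tm.
have hm : (1 - t) `^ (1 - ep) * (dist1 x / 2) `^ ep <= m.
  have -> : m = m `^ (1 - ep) * m `^ ep.
    by rewrite -powRD ?(gt_eqF m0) ?implybT// subrK powRr1// ltW.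
  apply: ler_pM; rewrite ?powR_ge0//.
    by apply: ge0_ler_powR; rewrite ?nnegrE ?subr_ge0 ?(ltW ep1) ?(ltW t1) ?(ltW m0).
  by apply: ge0_ler_powR; rewrite ?nnegrE ?divr_ge0 ?(ltW ep0) ?(ltW d0) ?(ltW m0).
have d2 : 0 < dist1 x / 2 by rewrite divr_gt0.
have hq : 0 < (1 - t) `^ (1 - ep) * (dist1 x / 2) `^ ep.
  by rewrite mulr_gt0// powR_gt0.
have hmi : m^-1 <= (1 - t) `^ (- (1 - ep)) * (dist1 x / 2) `^ (- ep).
  rewrite !powRN -invfM lef_pV2 ?posrE//.
have hf : cmod (peval a w) <= K * (1 - t) `^ (1 - al).
  apply: le_trans (hg w w1) _; apply: ler_wpM2l => //; rewrite cw.
  by apply: powR_anti; rewrite ?subr_le0// lerD2l lerN2.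
apply: le_trans (ler_pM (cmod_ge0 _) _ hf hmi) _; first by rewrite invr_ge0 ltW.
have -> : (1 - t) `^ (- (al - ep)) = (1 - t) `^ (1 - al) * (1 - t) `^ (- (1 - ep)).
  by rewrite -powRD ?(gt_eqF t1') ?implybT//; congr (_ `^ _); ring.
by rewrite le_eqVlt; apply/orP; left; apply/eqP; ring.
Qed.

(** Varying the numerator costs [(1 - t)^(- al)] and one factor [1 / (1 - t)]; varying the
    denominator costs two such factors on [(1 - t)^(1 - al)]. Both have order
    [(1 - t)^(- (al + 1))], and the [2] comes from [cexpi_lip]. *)
Lemma kernel_angular (al K1 K2 t x y : R) a : HD a -> growth al K1 a ->
  angular_lip al K2 a -> 0 <= K1 -> 0 <= K2 -> 0 <= t < 1 ->
  cmod (peval (psums a) (rC t * cexpi x) - peval (psums a) (rC t * cexpi y)) <=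
  (K2 + 2 * K1) * `|x - y| * (1 - t) `^ (- (al + 1)).
Proof.
move=> ha hg hl K10 K20 /andP[t0 t1].
have t1' : 0 < 1 - t by rewrite subr_gt0.
have t01 : 0 <= t <= 1 by rewrite t0 ltW.
set w := rC t * cexpi x; set v := rC t * cexpi y.
have cw : cmod w = t by rewrite cmodM cmod_cexpi mulr1 cmod_rC ger0_norm.
have cv : cmod v = t by rewrite cmodM cmod_cexpi mulr1 cmod_rC ger0_norm.
have [h1 _] := cmod_1B_ge x t01; have [h2 _] := cmod_1B_ge y t01.
rewrite -/w in h1; rewrite -/v in h2.
have m1 := lt_le_trans t1' h1; have m2 := lt_le_trans t1' h2.
have w0 : 1 - w != 0 by rewrite -cmod_gt0.
have v0 : 1 - v != 0 by rewrite -cmod_gt0.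
rewrite !peval_psums ?cw ?cv//.
have -> : peval a w / (1 - w) - peval a v / (1 - v) =
    (peval a w - peval a v) / (1 - w) +
    peval a v * (w - v) * ((1 - w)^-1 * (1 - v)^-1).
  have -> : w - v = (1 - v) - (1 - w) by rewrite opprB [RHS]addrC addrA subrK.
  exact: quotient_sub.
have hi1 : cmod (1 - w)^-1 <= (1 - t)^-1 by rewrite cmodV lef_pV2 ?posrE.
have hi2 : cmod (1 - v)^-1 <= (1 - t)^-1 by rewrite cmodV lef_pV2 ?posrE.
have e3 : (1 - t) `^ (- (al + 1)) = (1 - t) `^ (- al) * (1 - t)^-1.
  by rewrite opprD powRD ?(gt_eqF t1') ?implybT// powR_inv1// ltW.
have e4 : (1 - t) `^ (- (al + 1)) = (1 - t) `^ (1 - al) * ((1 - t)^-1 * (1 - t)^-1).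
  rewrite -(powR_inv1 (ltW t1')) -!powRD ?(gt_eqF t1') ?implybT//.
  by congr (_ `^ _); ring.
apply: le_trans (cmodD _ _) _.
rewrite [(K2 + _) * _]mulrDl [leRHS]mulrDl; apply: lerD.
  rewrite cmodM e3 mulrA; apply: ler_pM; rewrite ?cmod_ge0//.
  by apply: hl; rewrite t0 t1.
rewrite 3!cmodM e4.
have hf : cmod (peval a v) <= K1 * (1 - t) `^ (1 - al) by rewrite -cv hg// cv.
have hd : cmod (w - v) <= 2 * `|x - y|.
  rewrite -mulrBr cmodM cmod_rC ger0_norm//.
  apply: le_trans (_ : 1 * cmod (cexpi x - cexpi y) <= _).
    by apply: ler_wpM2r; [exact: cmod_ge0 | exact: ltW].
  by rewrite mul1r cexpi_lip.
have -> : 2 * K1 * `|x - y| * ((1 - t) `^ (1 - al) * ((1 - t)^-1 / (1 - t))) =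
  (K1 * (1 - t) `^ (1 - al)) * (2 * `|x - y|) * ((1 - t)^-1 / (1 - t)) by ring.
by apply: ler_pM; rewrite ?mulr_ge0 ?cmod_ge0//; apply: ler_pM; rewrite ?cmod_ge0.
Qed.

(** Lets each argument about real integrals be run once for both components. *)
Definition ReIm (L : R[i] -> R) := L = @complex.Re R \/ L = @complex.Im R.

Lemma ReIm_le L z : ReIm L -> `|L z| <= cmod z.
Proof. by case=> ->; [exact: Re_le_cmod | exact: Im_le_cmod]. Qed.

Lemma ReImB L z w : ReIm L -> L (z - w) = L z - L w.
Proof. by case=> ->; [exact: ReB | exact: ImB]. Qed.

Lemma ReIm_cvg L (u : nat -> R[i]) l : ReIm L -> ccvg u l ->
  (fun n => L (u n)) @ \oo --> L l.
Proof. by case=> -> []. Qed.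

Lemma ReIm_meas L d (T : measurableType d) (D : set T) (h : T -> R[i]) :
  ReIm L -> cmeas D h -> measurable_fun D (fun x => L (h x)).
Proof. by case=> -> []. Qed.

Variable mu : {measure set R -> \bar R}.
Let D01 : set R := `[0%R, 1%R[%classic.

Let mD01 : measurable D01. Proof. exact: measurable_itv. Qed.

Lemma D01P t : D01 t -> 0 <= t < 1.
Proof. by rewrite /D01 /= in_itv. Qed.

Lemma cmod_rCM_lt (t : R) z : 0 <= t < 1 -> cmod z <= 1 -> cmod (rC t * z) < 1.
Proof.
move=> /andP[t0 t1] z1; rewrite cmodM cmod_rC ger0_norm//.
by apply: le_lt_trans t1; rewrite ler_piMr.
Qed.

Lemma kernel_meas b z : HD b -> cmod z <= 1 ->
  cmeas D01 (fun t => peval b (rC t * z)).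
Proof.
move=> hb z1; apply: cmeas_peval => //.
  apply: cmeasM; last exact: cmeas_cst.
  by apply: cmeas_rC; exact: measurable_id.
by move=> t /D01P t01; exact: cmod_rCM_lt.
Qed.

Hypothesis mufin : (mu D01 < +oo)%E.

Lemma mu_cst_integrable (c : R) : mu.-integrable D01 (EFin \o (fun=> c)).
Proof.
apply/integrableP; split; first by apply/measurable_EFinP; exact: measurable_cst.
rewrite (_ : (fun x => `|(EFin \o (fun=> c)) x|%E) = cst (`|c|%:E))//.
rewrite integral_cst//; apply: lte_mul_pinfty => //.
Qed.

Lemma moment_integrable n : mu.-integrable D01 (EFin \o (fun t : R => t ^+ n)).
Proof.
apply: (le_integrable mD01 _ _ (mu_cst_integrable 1)).
  by apply/measurable_EFinP; exact: measurable_funX.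
move=> t /D01P/andP[t0 t1] /=; rewrite lee_fin normr1 ger0_norm ?exprn_ge0//.
by rewrite exprn_ile1// ltW.
Qed.

Lemma moment_ge0 n : 0 <= moment mu n.
Proof.
apply: fine_ge0; apply: integral_ge0 => t /D01P/andP[t0 _].
by rewrite lee_fin exprn_ge0.
Qed.

Lemma moment_le n m : (n <= m)%N -> moment mu m <= moment mu n.
Proof.
move=> nm; apply: (le_Rintegral mD01); try exact: moment_integrable.
move=> t /D01P/andP[t0 t1]; apply: ler_wiXn2l => //; exact: ltW.
Qed.

Lemma HD_Cmu a : HD a -> HD (Cmu mu a).
Proof.
move=> /HD_psums/HD_absum/absum_bound ha; apply/HD_absum/bounded_absum => r r01.
have [B B0 hB] := ha r r01; exists (moment mu 0 * B) => [|n].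
  by rewrite mulr_ge0// moment_ge0.
rewrite /Cmu cmodM cmod_rC ger0_norm ?moment_ge0// -mulrA.
apply: ler_pM; rewrite ?moment_ge0 ?moment_le//.
  by rewrite mulr_ge0 ?cmod_ge0// exprn_ge0//; case/andP: r01.
exact: hB.
Qed.

(** The factor [t ^+ n] inside the moment is absorbed into [(t z) ^+ n]. Integrability is carried
    along because additivity of the integral needs it at each step of the induction. *)
Lemma ReIm_cpsum_Cmu L a z n : ReIm L ->
  L (cpsum (fun k => Cmu mu a k * z ^+ k) n) =
  \int[mu]_(t in D01) L (cpsum (fun k => psums a k * (rC t * z) ^+ k) n) /\
  mu.-integrable D01
    (EFin \o (fun t => L (cpsum (fun k => psums a k * (rC t * z) ^+ k) n))).
Proof.
move=> hL.
have LD x y : L (x + y) = L x + L y by case: hL => ->; [exact: ReD | exact: ImD].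
have LZ c x : L (rC c * x) = c * L x by case: hL => ->; [exact: Re_rCM | exact: Im_rCM].
have L0 : L 0 = 0 by case: hL => ->.
rewrite /cpsum; elim: n => [|n [IH1 IH2]].
  rewrite big_ord0 L0; under eq_fun do rewrite big_ord0 L0.
  split; last exact: mu_cst_integrable.
  by rewrite Rintegral_cst// mul0r.
have e t : L (psums a n * (rC t * z) ^+ n) = L (psums a n * z ^+ n) * t ^+ n.
  rewrite exprMn -rCX mulrCA LZ mulrC; congr (_ * _).
have hi : mu.-integrable D01 (EFin \o (fun t => L (psums a n * (rC t * z) ^+ n))).
  rewrite (_ : (EFin \o _) = (fun t => ((L (psums a n * z ^+ n))%:E * (t ^+ n)%:E)%E)).
    by apply: (integrableZl mD01); exact: moment_integrable.
  by apply/funext => t /=; rewrite e EFinM.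
rewrite big_ord_recr /= LD IH1; split.
  under [in RHS]eq_Rintegral do rewrite big_ord_recr /= LD.
  rewrite RintegralD//; congr (_ + _).
  under eq_Rintegral do rewrite e.
  rewrite RintegralZl//; last exact: moment_integrable.
  by rewrite /Cmu -mulrA LZ mulrC.
under eq_fun do rewrite big_ord_recr /= LD.
pose G t := L (\sum_(i < n) psums a i * (rC t * z) ^+ i).
pose H t := L (psums a n * (rC t * z) ^+ n).
rewrite (_ : (EFin \o _) = ((EFin \o G) \+ (EFin \o H))%E) //.
exact: integrableD.
Qed.

(** As [|t z| <= |z|], the partial sums are dominated by the absolute series at [|z|], a constant
    and so integrable for finite mass; dominated convergence passes to the full series. *)
Lemma ReIm_peval_Cmu L a z : ReIm L -> HD a -> cmod z < 1 ->
  L (peval (Cmu mu a) z) =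
  \int[mu]_(t in D01) L (peval (psums a) (rC t * z)).
Proof.
move=> hL ha z1; have hs := HD_psums ha.
have c1 := ReIm_cvg hL (peval_cvg (HD_Cmu ha) z1).
have z01 : 0 <= cmod z < 1 by rewrite cmod_ge0.
have [B B0 hB] := (HD_absum _).1 hs _ z01.
have mF : cmeas D01 (fun t => peval (psums a) (rC t * z)).
  by apply: kernel_meas => //; exact: ltW.
pose f n t := (L (cpsum (fun k => psums a k * (rC t * z) ^+ k) n))%:E : \bar R.
have [] := @dominated_convergence _ _ R mu D01 mD01 f
  (fun t => (L (peval (psums a) (rC t * z)))%:E) (EFin \o (fun=> B)).
- move=> n; apply/measurable_EFinP; apply: ReIm_meas => //.
  apply: cmeas_cpsum; apply: cmeasM; last exact: cmeas_cst.
  by apply: cmeas_rC; exact: measurable_id.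
- by apply/measurable_EFinP; exact: ReIm_meas.
- apply: aeW => t /D01P t01; apply: cvg_EFin; first exact: nearW.
  apply: (ReIm_cvg hL); apply: peval_cvg => //.
  by apply: cmod_rCM_lt => //; exact: ltW.
- exact: mu_cst_integrable.
- apply: aeW => t n /D01P/andP[t0 t1]; rewrite lee_fin.
  apply: le_trans (ReIm_le _ hL) _; apply: le_trans (cmod_sum _ _) _.
  apply: le_trans (hB n); apply: ler_sum => k _; rewrite cmodM cmodX.
  apply: ler_wpM2l; first exact: cmod_ge0.
  rewrite lerXn2r ?nnegrE ?cmod_ge0// cmodM cmod_rC ger0_norm//.
  by rewrite ler_piMl ?cmod_ge0// ltW.
move=> intF _ hcv.
have c2 : (fun n => L (cpsum (fun k => Cmu mu a k * z ^+ k) n)) @ \oo -->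
    \int[mu]_(t in D01) L (peval (psums a) (rC t * z)).
  have -> : (fun n => L (cpsum (fun k => Cmu mu a k * z ^+ k) n)) =
      fine \o (fun n => \int[mu]_(t in D01) f n t)%E.
    by apply/funext => n /=; have [-> _] := ReIm_cpsum_Cmu a z n hL.
  apply: fine_cvg; rewrite /Rintegral fineK//; exact: integrable_fin_num.
exact: cvg_unique c1 c2.
Qed.

(** Supplies the evaluation bound required by [closed_graph]: [|1 - t z| >= 1 - |z|] for all [t].
    The [2] comes from adding the two components. *)
Lemma peval_Cmu_bound a z (B : R) : HD a -> cmod z < 1 -> 0 <= B ->
  (forall w, cmod w <= cmod z -> cmod (peval a w) <= B) ->
  cmod (peval (Cmu mu a) z) <= 2 * (B / (1 - cmod z) * fine (mu D01)).
Proof.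
move=> ha z1 B0 hB; have z1' : 0 < 1 - cmod z by rewrite subr_gt0.
have mF : cmeas D01 (fun t => peval (psums a) (rC t * z)).
  by apply: kernel_meas; [exact: HD_psums | exact: ltW].
have key L : ReIm L -> `|L (peval (Cmu mu a) z)| <=
    B / (1 - cmod z) * fine (mu D01).
  move=> hL; rewrite ReIm_peval_Cmu//.
  have [] // := @Rintegral_bound _ _ _ mu D01
    (fun t => L (peval (psums a) (rC t * z))) (fun=> 1) (B / (1 - cmod z))
    (fine (mu D01)) mD01.
  - exact: ReIm_meas.
  - by rewrite divr_ge0// ltW.
  - move=> t t01; apply: le_trans (ReIm_le _ hL) _; rewrite mulr1.
    have tz : cmod (rC t * z) <= cmod z.
      have /andP[t0 t1] := D01P t01.
      by rewrite cmodM cmod_rC ger0_norm// ler_piMl ?cmod_ge0// ltW.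
    rewrite peval_psums//; last exact: le_lt_trans z1.
    rewrite cmodM cmodV; apply: ler_pM; rewrite ?cmod_ge0 ?invr_ge0 ?cmod_ge0 ?hB//.
    have h : 1 - cmod z <= cmod (1 - rC t * z).
      by apply: le_trans (cmod_rev _ _); rewrite cmod1 lerD2l lerN2.
    by rewrite lef_pV2 ?posrE// (lt_le_trans z1').
  - rewrite integral_cst// mul1e fineK// ge0_fin_numE//.
apply: le_trans (cmod_le_ReIm _) _; rewrite mulr2n mulrDl !mul1r.
by apply: lerD; apply: key; [left | right].
Qed.

Lemma peval_ccvg b (u : nat -> R[i]) l (r : R) : HD b -> r < 1 ->
  (forall n, cmod (u n) <= r) -> cmod l <= r -> ccvg u l ->
  ccvg (fun n => peval b (u n)) (peval b l).
Proof.
move=> hb r1 ur lr ul; have r0 : 0 <= r := le_trans (cmod_ge0 _) lr.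
pose r' := (1 + r) / 2.
have r01 : 0 < r' < 1 by rewrite /r'; apply/andP; split; lra.
have rr : r <= r' by rewrite /r'; lra.
have [K K0 hK] := peval_taylor2 hb r01.
apply: (@ccvg_pinching _ _ _ (fun n => cmod (u n - l) * cmod (peval (dcoef b) l)
  + K * (cmod (u n - l) * cmod (u n - l)))) => [n|].
  have := hK l (u n) (le_trans lr rr) (le_trans (ur n) rr); rewrite expr2 => h.
  set A := peval b (u n) - _ in h *.
  have -> : A = (u n - l) * peval (dcoef b) l + (A - (u n - l) * peval (dcoef b) l).
    by rewrite addrC subrK.
  by apply: le_trans (cmodD _ _) _; rewrite cmodM lerD2l.
have /ccvgP c0 := ul.
rewrite -[0 : R](addr0 0); apply: cvgD.
  by rewrite -(mul0r (cmod (peval (dcoef b) l))); apply: cvgM => //; exact: cvg_cst.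
rewrite -(mulr0 K); apply: cvgM; first exact: cvg_cst.
by rewrite -(mulr0 0); exact: cvgM.
Qed.

End CesaroMorrey.

(** * Membership of the image in the Morrey space *)

Section MorreyMembership.
Variable R : realType.

Lemma lebesgue_dist1_eq0 (s l : R) : 0 < l <= 2 * pi ->
  lebesgue_measure (`[s, (s + l)%R]%classic `&` dist1_le (0 : R)) = 0%E.
Proof.
move=> hl; have mD : measurable (`[s, (s + l)%R]%classic : set R).
  exact: measurable_itv.
apply/eqP; rewrite eq_le measure_ge0 andbT.
apply/lee_addgt0Pr => e e0; rewrite add0e.
have e1 : 0 < e / 24 by rewrite divr_gt0.
have := lebesgue_dist1_le s hl e1; rewrite [24 * _]mulrC divfK//.
apply: le_trans; apply: le_measure; rewrite ?inE.
- exact: measurable_dist1_le.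
- exact: measurable_dist1_le.
- move=> x [h1 h2]; split => //; rewrite /dist1_le /=.
  by apply: le_trans h2 (ltW e1).
Qed.

Lemma sqr_integral_bound (s l C E : R) (N : set R) (v1 v2 W : R -> R) :
  0 <= E -> measurable N -> lebesgue_measure N = 0%E ->
  measurable_fun `[s, (s + l)%R]%classic v1 ->
  measurable_fun `[s, (s + l)%R]%classic v2 ->
  measurable_fun `[s, (s + l)%R]%classic W ->
  (forall x, 1 <= W x) ->
  (forall x, (`[s, (s + l)%R]%classic `\` N) x -> `|v1 x| <= E * W x) ->
  (forall x, (`[s, (s + l)%R]%classic `\` N) x -> `|v2 x| <= E * W x) ->
  (\int[lebesgue_measure]_(x in `[s, (s + l)%R]%classic) (W x ^+ 2)%:E
    <= (C * l)%:E)%E ->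
  (\int[lebesgue_measure]_(x in `[s, (s + l)%R]%classic)
    (v1 x ^+ 2 + v2 x ^+ 2)%:E <= (2 * E ^+ 2 * C * l)%:E)%E.
Proof.
set D : set R := `[s, (s + l)%R]%classic.
move=> E0 mN N0 mv1 mv2 mW W1 h1 h2 hW.
have mD : measurable D by exact: measurable_itv.
have mD' : measurable (D `\` N) by exact: measurableD.
have mf : measurable_fun D (fun x => (v1 x ^+ 2 + v2 x ^+ 2)%:E).
  by apply/measurable_EFinP; apply: measurable_funD; exact: measurable_funX.
have mg : measurable_fun D (fun x => ((2 * E ^+ 2)%:E * (W x ^+ 2)%:E)%E).
  by apply: measurable_funeM; apply/measurable_EFinP; exact: measurable_funX.
have E2 : 0 <= 2 * E ^+ 2 by rewrite mulr_ge0// exprn_ge0.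
rewrite (@ge0_negligible_integral _ _ _ lebesgue_measure D N _ mN mD)//; last first.
  by move=> x _; rewrite lee_fin addr_ge0// sqr_ge0.
apply: (@le_trans _ _ (\int[lebesgue_measure]_(x in D `\` N)
    ((2 * E ^+ 2)%:E * (W x ^+ 2)%:E))%E).
  apply: ge0_le_integral => //.
  - by move=> x _; rewrite lee_fin addr_ge0// sqr_ge0.
  - by apply: measurable_funS mf => // x [].
  - by apply: measurable_funS mg => // x [].
  - move=> x hx; rewrite -EFinM lee_fin.
    have sq (u : R) : `|u| <= E * W x -> u ^+ 2 <= E ^+ 2 * W x ^+ 2.
      move=> h; rewrite -exprMn -(real_normK (num_real u)).
      by rewrite lerXn2r ?nnegrE// mulr_ge0// (le_trans ler01).
    have -> : 2 * E ^+ 2 * W x ^+ 2 = E ^+ 2 * W x ^+ 2 + E ^+ 2 * W x ^+ 2 by ring.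
    by apply: lerD; apply: sq; [exact: h1 | exact: h2].
apply: (@le_trans _ _ (\int[lebesgue_measure]_(x in D)
    ((2 * E ^+ 2)%:E * (W x ^+ 2)%:E))%E).
  apply: ge0_subset_integral => //.
  by move=> x _; rewrite -EFinM lee_fin mulr_ge0// sqr_ge0.
rewrite ge0_integralZl_EFin//; last 2 first.
- by move=> x _; rewrite lee_fin sqr_ge0.
- by apply/measurable_EFinP; exact: measurable_funX.
have -> : 2 * E ^+ 2 * C * l = 2 * E ^+ 2 * (C * l) by rewrite mulrA.
by rewrite [leRHS]EFinM; apply: lee_wpmul2l; rewrite ?lee_fin.
Qed.

Variables (mu : {measure set R -> \bar R}) (a : nat -> R[i]).
Variables (al K1 K2 s C lam : R).
Hypothesis ha : HD a.
Hypothesis hg : growth al K1 a.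
Hypothesis hl : angular_lip al K2 a.
Hypothesis al1 : 1 <= al.
Hypothesis K10 : 0 <= K1.
Hypothesis K20 : 0 <= K2.
Hypothesis C0 : 0 <= C.
Hypothesis hC : forall y, 0 < y -> (mu (near1 y) <= (C * y `^ s)%:E)%E.
Hypothesis lam01 : 0 < lam <= 1.
(** Holds in both applications: [s = 1 + (lam2 - lam1) / 2] with [al = (3 - lam1) / 2] and
    [lam = lam2], and [s = (1 + lam) / 2] with [al = 1]. *)
Hypothesis hs : s - al = (lam - 1) / 2.

Let D01 : set R := `[0%R, 1%R[%classic.
Let mD01 : measurable D01. Proof. exact: measurable_itv. Qed.
(* [ep] lies strictly between [(1 - lam) / 2], which makes [(1 - t) `^ (- p)]
   integrable for a Carleson measure, and [1 / 2], which makes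
   [dist1 x `^ (- ep)] square integrable. *)
Let ep : R := (2 - lam) / 4.
Let p : R := al - ep.
Let Kn : R := C * ((1/2) `^ (- p) / (1 - (1/2) `^ (s - p))).
Let Kf : R := C * (2 `^ s / (1 - 2 `^ (s - (al + 1)))).
Let F x t : R[i] := peval (psums a) (rC t * x).

Let ep01 : 0 < ep < 1/2.
Proof. by move: lam01 => /andP[? ?]; rewrite /ep; apply/andP; split; lra. Qed.

Let ep1 : 0 < ep < 1.
Proof. by move: ep01 => /andP[? ?]; apply/andP; split; lra. Qed.

Let sp : s - p = (lam - 1) / 2 + ep.
Proof. by rewrite /p opprB addrCA addrC hs. Qed.

Let ps : 0 < p < s.
Proof.
move: sp lam01 => + /andP[? ?]; move: ep01 al1 => /andP[? ?] ?.
by rewrite /p /ep => ?; apply/andP; split; lra.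
Qed.

Let sal : 0 < s < al + 1.
Proof.
by move: ps hs lam01 => /andP[? ?] ? /andP[? ?]; apply/andP; split; lra.
Qed.

(** Makes the near estimate at [l = 1] an estimate over the whole interval, in particular the source
    of integrability. *)
Let near11 : near1 (1 : R) = D01.
Proof.
rewrite /near1 subrr; apply/seteqP; split => [t []//|t h]; split => //.
by move: h; rewrite /D01 /= !in_itv /= => /andP[-> _].
Qed.

Let mufin : (mu D01 < +oo)%E.
Proof. by rewrite -near11; apply: le_lt_trans (hC ltr01) _; rewrite ltry. Qed.

Let Kn0 : 0 <= Kn.
Proof.
rewrite mulr_ge0// divr_ge0 ?powR_ge0// subr_ge0 ltW// powR_half_lt1//.
by rewrite subr_gt0; case/andP: ps.
Qed.

Let Kf0 : 0 <= Kf.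
Proof.
rewrite mulr_ge0// divr_ge0 ?powR_ge0// subr_ge0 ltW// powR2_lt1//.
by rewrite subr_lt0; case/andP: sal.
Qed.

Let cmod_rr (r x : R) : 0 <= r <= 1 -> cmod (rC r * cexpi x) <= 1.
Proof. by move=> /andP[r0 r1]; rewrite cmodM cmod_cexpi mulr1 cmod_rC ger0_norm. Qed.

Let F_meas L x : ReIm L -> cmod x <= 1 -> measurable_fun D01 (fun t => L (F x t)).
Proof. by move=> hL x1; apply: ReIm_meas => //; apply: kernel_meas => //; exact: HD_psums. Qed.

Let near_bound L (r x l : R) : ReIm L -> 0 <= r <= 1 -> 0 < dist1 x -> 0 < l ->
  mu.-integrable (near1 l) (EFin \o (fun t => L (F (rC r * cexpi x) t))) /\
  `|\int[mu]_(t in near1 l) L (F (rC r * cexpi x) t)| <=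
  K1 * (dist1 x / 2) `^ (- ep) * (Kn * l `^ (s - p)).
Proof.
move=> hL r01 d0 l0.
apply: (@Rintegral_bound _ _ _ mu _ _ (fun t => (1 - t) `^ (- p))).
- exact: measurable_near1.
- apply: (measurable_funS mD01); last by apply: F_meas => //; exact: cmod_rr.
  by move=> t [].
- exact: measurable_powR_one_minus.
- by rewrite mulr_ge0// powR_ge0.
- by move=> *; exact: powR_ge0.
- move=> t [/D01P t01 _]; apply: le_trans (ReIm_le _ hL) _.
  exact: (kernel_bound ha hg al1 K10 ep1 t01 r01 d0).
- exact: carleson_integral_near.
Qed.

(** Dominated convergence with the majorant of [kernel_bound]. Off the angles of the point [1] the
    [lim] in [bdry] is therefore a genuine radial limit, given by the same integral formula at
    [r = 1]. *)
Lemma bdry_cvg L (x : R) : ReIm L -> 0 < dist1 x ->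
  L (peval (Cmu mu a) (rC r * cexpi x)) @[r --> 1^'-] -->
  \int[mu]_(t in D01) L (F (cexpi x) t).
Proof.
move=> hL d0; set I := \int[mu]_(t in D01) _.
pose f r := L (peval (Cmu mu a) (rC r * cexpi x)).
(* Clipping at [0] changes nothing near [1], and it puts every radius of a test sequence in
   [[0, 1)], where the kernel bounds apply. *)
suff h : f (Num.max 0 r) @[r --> 1^'-] --> I.
  apply: cvg_trans h; apply: near_eq_cvg; near=> r.
  rewrite /f max_r//; apply: ltW; near: r; exact: nbhs_left_gt.
apply/cvg_at_leftP => u [u1 ucvg]; pose v n := Num.max 0 (u n).
have v01 n : 0 <= v n <= 1 by rewrite /v le_max lexx /= ge_max ler01 /= ltW.
have v1 n : v n < 1 by rewrite /v gt_max ltr01 u1.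
have hv n : f (v n) = \int[mu]_(t in D01) L (F (rC (v n) * cexpi x) t).
  have hz : cmod (rC (v n) * cexpi x) < 1.
    rewrite cmodM cmod_cexpi mulr1 cmod_rC ger0_norm; first exact: v1.
    by case/andP: (v01 n).
  exact: (ReIm_peval_Cmu mufin hL ha hz).
have vc : (fun n => `|v n - 1|) @ \oo --> (0 : R).
  have : (fun n => `|u n - 1|) @ \oo --> (0 : R).
    apply/norm_cvg0P; rewrite -(subrr (1 : R)).
    by apply: cvgB => //; exact: cvg_cst.
  apply: (squeeze_cvgr _ (cvg_cst 0)); apply: nearW => n; rewrite normr_ge0 /=.
  rewrite distrC [leRHS]distrC !ger0_norm ?subr_ge0 ?(ltW (u1 n)) ?(ltW (v1 n))//.
  by rewrite lerD2l lerN2 /v le_max lexx orbT.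
have cx : cmod (cexpi x) <= 1 by rewrite cmod_cexpi.
pose g t := (K1 * (dist1 x / 2) `^ (- ep) * (1 - t) `^ (- p)).
have ig : mu.-integrable D01 (EFin \o g).
  rewrite -near11.
  have [] // := @Rintegral_bound _ _ _ mu (near1 1) g (fun t => (1 - t) `^ (- p))
    (K1 * (dist1 x / 2) `^ (- ep)) (Kn * 1 `^ (s - p)).
  - exact: measurable_near1.
  - by apply: measurable_funM; [exact: measurable_cst | exact: measurable_powR_one_minus].
  - exact: measurable_powR_one_minus.
  - by rewrite mulr_ge0// powR_ge0.
  - by move=> *; exact: powR_ge0.
  - by move=> t _; rewrite ger0_norm// !mulr_ge0// powR_ge0.
  - exact: carleson_integral_near.
have [] := @dominated_convergence _ _ R mu D01 mD01
  (fun n t => (L (F (rC (v n) * cexpi x) t))%:E)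
  (fun t => (L (F (cexpi x) t))%:E) (EFin \o g).
- by move=> n; apply/measurable_EFinP; apply: F_meas => //; exact: cmod_rr.
- by apply/measurable_EFinP; exact: F_meas.
- apply: aeW => t /D01P t01; have /andP[t0 t1] := t01.
  apply: cvg_EFin; first exact: nearW.
  apply: (ReIm_cvg hL); apply: (@peval_ccvg _ _ _ _ t) => //.
  + exact: HD_psums.
  + move=> n; rewrite cmodM cmod_rC ger0_norm// ler_piMr//; exact: cmod_rr.
  + by rewrite cmodM cmod_rC ger0_norm// cmod_cexpi mulr1.
  + apply: (@ccvg_pinching _ _ _ (fun n => `|v n - 1|)) => // n.
    rewrite -mulrBr.
    have -> : rC (v n) * cexpi x - cexpi x = rC (v n - 1) * cexpi x.
      by rewrite rCB rC1 mulrBl mul1r.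
    rewrite !cmodM !cmod_rC cmod_cexpi mulr1 ger0_norm// ler_piMl//.
    exact: ltW.
- exact: ig.
- apply: aeW => t n /D01P t01; rewrite lee_fin; apply: le_trans (ReIm_le _ hL) _.
  exact: (kernel_bound ha hg al1 K10 ep1 t01 (v01 n) d0).
move=> intF _ hcv.
have -> : (fun n => f (Num.max 0 (u n))) =
    fine \o (fun n => \int[mu]_(t in D01) (L (F (rC (v n) * cexpi x) t))%:E)%E.
  by apply/funext => n /=; exact: hv.
by apply: fine_cvg; rewrite /I /Rintegral fineK//; exact: integrable_fin_num.
Unshelve. all: by end_near. Qed.

Lemma bdry_Cmu (x : R) : 0 < dist1 x ->
  complex.Re (bdry (Cmu mu a) x) = \int[mu]_(t in D01) complex.Re (F (cexpi x) t) /\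
  complex.Im (bdry (Cmu mu a) x) = \int[mu]_(t in D01) complex.Im (F (cexpi x) t).
Proof.
move=> d0; rewrite /bdry /=; split; apply: cvg_lim => //.
  by apply: (@bdry_cvg (@complex.Re R)) => //; left.
by apply: (@bdry_cvg (@complex.Im R)) => //; right.
Qed.

Lemma ReIm_bdry_Cmu L (x : R) : ReIm L -> 0 < dist1 x ->
  L (bdry (Cmu mu a) x) = \int[mu]_(t in D01) L (F (cexpi x) t).
Proof. by case=> -> /bdry_Cmu []. Qed.

Let M0 : R := K1 * (1/2) `^ (- ep) * Kn + (K2 + 2 * K1) * Kf.

Let M00 : 0 <= M0.
Proof.
apply: addr_ge0.
  by apply: mulr_ge0 => //; apply: mulr_ge0 => //; exact: powR_ge0.
by apply: mulr_ge0 => //; apply: addr_ge0 => //; exact: mulr_ge0.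
Qed.

(** The constant is the far part of the integral frozen at the left end of the arc, so it is
    independent of [x]; the near part is estimated whole. By [hs] both pieces scale as
    [l^((lam - 1) / 2)]: the near one through [l^(s - p)], the far one through
    [l * l^(s - al - 1)]. *)
Lemma bdry_Cmu_osc L (s0 l : R) : ReIm L -> 0 < l ->
  exists c : R, forall x, s0 <= x <= s0 + l -> 0 < dist1 x ->
  `|L (bdry (Cmu mu a) x) - c| <= M0 * l `^ ((lam - 1) / 2) * arcw ep l x.
Proof.
move=> hL l0; exists (\int[mu]_(t in far1 l) L (F (cexpi s0) t)) => x xl d0.
rewrite ReIm_bdry_Cmu//.
have r11 : 0 <= (1 : R) <= 1 by rewrite ler01 lexx.
have e1 y : rC 1 * cexpi y = cexpi y by rewrite rC1 mul1r.
have [in1 bn] := near_bound hL r11 d0 l0; rewrite e1 in in1 bn.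
have [inD _] := near_bound hL r11 d0 ltr01; rewrite e1 near11 in inD.
have mn := measurable_near1 l; have mf := measurable_far1 l.
have DU : D01 = near1 l `|` far1 l.
  apply/seteqP; split => [t ht|t [[]|[]]//].
  by have [h|h] := leP (1 - l) t; [left | right]; split => //=;
    rewrite in_itv /= ?h.
have nfd : [disjoint near1 l & far1 l].
  apply/disj_setPS => t [[_ /=]]; rewrite in_itv /= andbT => h1 [_ /=].
  by rewrite in_itv /= ltNge h1.
have sfar : far1 l `<=` D01 by move=> t [].
have inF := integrableS mD01 mf sfar inD.
have fm y : measurable_fun (far1 l) (fun t => L (F (cexpi y) t)).
  apply: (measurable_funS mD01 sfar); apply: (F_meas hL).
  by rewrite cmod_cexpi.
have xs0 : `|x - s0| <= l.
  by case/andP: xl => h1 h2; rewrite ger0_norm ?subr_ge0// lerBlDl.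
have K120 : 0 <= K2 + 2 * K1 by rewrite addr_ge0// mulr_ge0.
have [ind bf] : mu.-integrable (far1 l) (EFin \o (fun t => L (F (cexpi x) t) - L (F (cexpi s0) t))) /\
   `|\int[mu]_(t in far1 l) (L (F (cexpi x) t) - L (F (cexpi s0) t))| <=
   (K2 + 2 * K1) * l * (Kf * l `^ (s - (al + 1))).
  apply: (@Rintegral_bound _ _ _ mu _ _ (fun t => (1 - t) `^ (- (al + 1)))).
  - exact: mf.
  - exact: (measurable_funB (fm x) (fm s0)).
  - exact: measurable_powR_one_minus.
  - by rewrite mulr_ge0// ltW.
  - by move=> *; exact: powR_ge0.
  - move=> t [/D01P t01 _]; rewrite -(ReImB _ _ hL).
    apply: le_trans (ReIm_le _ hL) _.
    apply: le_trans (kernel_angular x s0 ha hg hl K10 K20 t01) _.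
    by apply: ler_wpM2r; [exact: powR_ge0 | exact: ler_wpM2l].
  - exact: carleson_integral_far.
have in0 : mu.-integrable (far1 l) (EFin \o (fun t => L (F (cexpi s0) t))).
  rewrite (_ : (EFin \o _) = (fun t => (L (F (cexpi x) t))%:E -
     (L (F (cexpi x) t) - L (F (cexpi s0) t))%:E)%E).
    exact: (integrableB mf inF ind).
  by apply/funext => t; rewrite -EFinB subKr.
have inDU : mu.-integrable (near1 l `|` far1 l) (EFin \o (fun t => L (F (cexpi x) t))).
  by rewrite -DU.
rewrite DU (Rintegral_setU mn mf inDU nfd).
rewrite -addrA -(RintegralB mf inF in0); apply: le_trans (ler_normD _ _) _.
apply: le_trans (lerD bn bf) _.
have d2 : (dist1 x / 2) `^ (- ep) = dist1 x `^ (- ep) * (1/2) `^ (- ep).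
  by rewrite -powRM ?(ltW d0)// ?mul1r//; lra.
have e2 : l `^ (s - p) = l `^ ((lam - 1) / 2) * l `^ ep.
  by rewrite sp powRD// (gt_eqF l0) implybT.
have e3 : l * l `^ (s - (al + 1)) = l `^ ((lam - 1) / 2).
  rewrite -{1}(powRr1 (ltW l0)) -powRD ?(gt_eqF l0) ?implybT//.
  by congr (_ `^ _); rewrite -hs; ring.
rewrite d2 e2 /M0 /arcw.
set A := l `^ ((lam - 1) / 2) in e3 *; set B := l `^ ep * dist1 x `^ (- ep).
have A0 : 0 <= A by exact: powR_ge0.
have B0 : 0 <= B by rewrite mulr_ge0// powR_ge0.
have -> : K1 * (dist1 x `^ (- ep) * (1 / 2) `^ (- ep)) * (Kn * (A * l `^ ep)) =
  K1 * (1/2) `^ (- ep) * Kn * A * B by rewrite /B; ring.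
have -> : (K2 + 2 * K1) * l * (Kf * l `^ (s - (al + 1))) =
  (K2 + 2 * K1) * Kf * A by rewrite -e3; ring.
set P := K1 * _ * Kn; set Q := (K2 + _) * Kf.
have P0 : 0 <= P.
  by apply: mulr_ge0 => //; apply: mulr_ge0 => //; exact: powR_ge0.
have Q0 : 0 <= Q by exact: mulr_ge0.
rewrite -subr_ge0.
have -> : (P + Q) * A * (1 + B) - (P * A * B + Q * A) = P * A + Q * A * B by ring.
by apply: addr_ge0; [exact: mulr_ge0 | apply: mulr_ge0 => //; exact: mulr_ge0].
Qed.

(** Off the null set the function is a limit along the radii [1 - 1 / (n + 2)]. On it all angles
    represent the point [1], so it is constant there whatever value [lim] assigns. *)
Lemma bdry_Cmu_meas L (s0 l : R) : ReIm L -> 0 < l ->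
  measurable_fun `[s0, (s0 + l)%R]%classic (fun x => L (bdry (Cmu mu a) x)).
Proof.
move=> hL l0; set D : set R := `[s0, (s0 + l)%R]%classic.
have mD : measurable D by exact: measurable_itv.
pose N := D `&` dist1_le (0 : R).
have mN : measurable N by exact: measurable_dist1_le.
have mDN : measurable (D `\` N) by exact: measurableD.
have -> : D = (D `\` N) `|` N.
  apply/seteqP; split => [x Dx|x [[]//|[]//]].
  by have [Nx|Nx] := pselect (N x); [right | left].
apply/measurable_funU => //; split.
  pose u n : R := 1 - n.+2%:R^-1.
  have u1 n : u n < 1 by rewrite ltrBlDr ltrDl invr_gt0 ltr0n.
  have u0 n : 0 <= u n by rewrite subr_ge0 invf_le1 ?ltr0n// ler1n.
  have uc : u @ \oo --> (1 : R).
    rewrite -[X in _ --> X]subr0; apply: cvgB; first exact: cvg_cst.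
    have := @cvg_harmonic R; rewrite -cvg_shiftS; exact.
  apply: (@measurable_fun_cvg _ _ _ _
      (fun n x => L (peval (Cmu mu a) (rC (u n) * cexpi x)))).
    move=> n; apply: ReIm_meas => //; apply: cmeas_peval.
    - exact: HD_Cmu.
    - by apply: cmeasM; [exact: cmeas_cst | exact: cmeas_cexpi].
    - by move=> x _; rewrite cmodM cmod_cexpi mulr1 cmod_rC ger0_norm.
  move=> x [Dx Nx].
  have d0 : 0 < dist1 x.
    by rewrite ltNge; apply/negP => h; apply: Nx; split.
  rewrite ReIm_bdry_Cmu//.
  by have /cvg_at_leftP := bdry_cvg hL d0; apply.
apply: (@eq_measurable_fun _ _ _ _ _ (fun=> L (bdry (Cmu mu a) 0))).
  move=> x; rewrite inE => -[_ hx].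
  have -> : bdry (Cmu mu a) x = bdry (Cmu mu a) 0; last by [].
  have : cexpi x = 1.
    move: hx; rewrite /dist1_le /= => hx.
    apply/eqP; rewrite eq_sym -subr_eq0 -cmod_eq0 eq_le hx /=.
    exact: dist1_ge0.
  by rewrite /bdry => ->; rewrite cexpi0.
exact: measurable_cst.
Qed.

Lemma Cmu_Morrey : Morrey lam (Cmu mu a).
Proof.
have [CJ CJ0 hJ] := arcw_integral ep01.
have pi0 := pi_gt0 R; have pi2 := pi_ge2 R.
have hg0 := HD_Cmu mufin ha.
split; first split => //.
  (* For the [H2] means the near estimate is taken over all of [[0, 1)]; the weight of an arc of
     length [2 pi >= 1] dominates [d^(- ep)]. *)
  pose M1 := K1 * (1/2) `^ (- ep) * Kn.
  have M10 : 0 <= M1.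
    by apply: mulr_ge0 => //; apply: mulr_ge0 => //; exact: powR_ge0.
  exists (2 * M1 ^+ 2 * CJ * (2 * pi)) => r r01.
  have l2 : 0 < 2 * (pi : R) <= 2 * (pi : R).
    by apply/andP; split; [exact: mulr_gt0 | exact: lexx].
  have r01' : 0 <= r <= 1 by case/andP: r01 => -> /ltW.
  under eq_integral do rewrite cmod_sqr.
  have mp : cmeas `[0%R, (0 + 2 * pi)%R]%classic
      (fun x => peval (Cmu mu a) (rC r * cexpi x)).
    apply: cmeas_peval => //.
      by apply: cmeasM; [exact: cmeas_cst | exact: cmeas_cexpi].
    move=> x _; rewrite cmodM cmod_cexpi mulr1 cmod_rC ger0_norm; by case/andP: r01.
  have mD : measurable (`[0%R, (0 + 2 * pi)%R]%classic : set R) by exact: measurable_itv.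
  have bnd L x : ReIm L -> (`[0%R, (0 + 2 * pi)%R]%classic `\`
      (`[0%R, (0 + 2 * pi)%R]%classic `&` dist1_le 0)) x ->
      `|L (peval (Cmu mu a) (rC r * cexpi x))| <= M1 * arcw ep (2 * pi) x.
    move=> hL [Dx Nx].
    have d0 : 0 < dist1 x.
      by rewrite ltNge; apply/negP => h; apply: Nx; split.
    have [_] := near_bound hL r01' d0 ltr01; rewrite near11 pow1R mulr1.
    have hz : cmod (rC r * cexpi x) < 1.
      by rewrite cmodM cmod_cexpi mulr1 cmod_rC ger0_norm; case/andP: r01.
    rewrite -(ReIm_peval_Cmu mufin hL ha hz).
    move=> h; apply: le_trans h _.
    have -> : (dist1 x / 2) `^ (- ep) = dist1 x `^ (- ep) * (1/2) `^ (- ep).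
      by rewrite -powRM ?(ltW d0)// ?mul1r//; lra.
    have -> : K1 * (dist1 x `^ (- ep) * (1/2) `^ (- ep)) * Kn =
      M1 * dist1 x `^ (- ep) by rewrite /M1; ring.
    apply: ler_wpM2l => //; rewrite /arcw.
    apply: le_trans (_ : (2 * pi) `^ ep * dist1 x `^ (- ep) <= _); last by rewrite lerDr.
    rewrite ler_peMl ?powR_ge0// -[leLHS](pow1R ep).
    by apply: ge0_ler_powR; rewrite ?nnegrE//; case/andP: ep01 => [e0 _]; lra.
  have := @sqr_integral_bound 0 (2 * pi) CJ M1 _ _ _ (arcw ep (2 * pi)) M10
    (measurable_dist1_le 0 mD) (lebesgue_dist1_eq0 0 l2) mp.1 mp.2
    (@measurable_arcw R _ ep _) (arcw_ge1 ep _)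
    (fun x => bnd _ x (or_introl erefl)) (fun x => bnd _ x (or_intror erefl))
    (hJ 0 _ l2).
  by rewrite add0r.
exists (2 * (M0 * (1 + CJ)) ^+ 2 * CJ) => s0 l l2.
have l0 : 0 < l by case/andP: l2.
set A := l `^ ((lam - 1) / 2).
have A0 : 0 <= A by exact: powR_ge0.
(* The squared oscillation contributes [l^(lam - 1)] and the length of the arc the missing [l]. *)
have -> : l `^ lam = A ^+ 2 * l.
  rewrite -(powR_mulrn _ A0) /A -powRrM -[X in _ = _ * X](powRr1 (ltW l0)).
  by rewrite -powRD ?(gt_eqF l0) ?implybT//; congr (_ `^ _); field.
have -> : 2 * (M0 * (1 + CJ)) ^+ 2 * CJ * (A ^+ 2 * l) =
  2 * (M0 * A * (1 + CJ)) ^+ 2 * CJ * l by ring.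
under eq_integral do rewrite cmod_sqr ReB ImB.
have mD : measurable (`[s0, (s0 + l)%R]%classic : set R) by exact: measurable_itv.
have MA0 : 0 <= M0 * A by rewrite mulr_ge0.
have key L : ReIm L ->
  let m := Lint (fun t => L (bdry (Cmu mu a) t)) s0 l / l in
  measurable_fun `[s0, (s0 + l)%R]%classic (fun x => L (bdry (Cmu mu a) x) - m) /\
  forall x, (`[s0, (s0 + l)%R]%classic `\`
      (`[s0, (s0 + l)%R]%classic `&` dist1_le 0)) x ->
    `|L (bdry (Cmu mu a) x) - m| <= M0 * A * (1 + CJ) * arcw ep l x.
  move=> hL m; have mL := @bdry_Cmu_meas L s0 l hL l0; split.
    by apply: measurable_funB => //; exact: measurable_cst.
  have [c hc] := bdry_Cmu_osc s0 hL l0.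
  have hc' x : (`[s0, (s0 + l)%R]%classic `\`
      (`[s0, (s0 + l)%R]%classic `&` dist1_le 0)) x ->
      `|L (bdry (Cmu mu a) x) - c| <= M0 * A * arcw ep l x.
    move=> [Dx Nx]; apply: hc; first by move: Dx; rewrite /= in_itv.
    by rewrite ltNge; apply/negP => h; apply: Nx; split.
  (* Replacing [c] by the mean adds [M0 A CJ]; since the weight is at least [1], this only enlarges
     the factor to [1 + CJ]. *)
  have hm : `|m - c| <= M0 * A * CJ.
    exact: (@arc_mean_bound _ s0 l CJ (M0 * A) c _ _ (arcw ep l) l0 MA0 CJ0
      (measurable_dist1_le 0 mD) (lebesgue_dist1_eq0 s0 l2) mL
      (@measurable_arcw R _ ep _) (arcw_ge1 ep _) hc' (hJ s0 l l2)).
  move=> x hx.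
  have -> : L (bdry (Cmu mu a) x) - m = (L (bdry (Cmu mu a) x) - c) - (m - c).
    by rewrite opprB addrA subrK.
  apply: le_trans (ler_normB _ _) _; apply: le_trans (lerD (hc' x hx) hm) _.
  have W1 := arcw_ge1 ep l x; rewrite -subr_ge0.
  have -> : M0 * A * (1 + CJ) * arcw ep l x - (M0 * A * arcw ep l x + M0 * A * CJ)
    = M0 * A * CJ * (arcw ep l x - 1) by ring.
  by rewrite !mulr_ge0// subr_ge0.
have [m1 b1] := key _ (or_introl erefl); have [m2 b2] := key _ (or_intror erefl).
have MA1 : 0 <= M0 * A * (1 + CJ) by rewrite mulr_ge0// addr_ge0.
exact: (@sqr_integral_bound s0 l CJ _ _ _ _ (arcw ep l) MA1
    (measurable_dist1_le 0 mD) (lebesgue_dist1_eq0 s0 l2) m1 m2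
    (@measurable_arcw R _ ep _) (arcw_ge1 ep _) b1 b2 (hJ s0 l l2)).
Qed.

End MorreyMembership.

(** * A Morrey function with large partial sums *)

Section TestFunction.
Variable R : realType.

Lemma bernoulli_ineq (x : R) n : 0 <= x <= 1 -> 1 - n%:R * x <= (1 - x) ^+ n.
Proof.
move=> /andP[x0 x1]; elim: n => [|n IH]; first by rewrite mul0r subr0 expr0.
have x1' : 0 <= 1 - x by rewrite subr_ge0.
rewrite exprS; apply: le_trans (ler_wpM2l x1' IH).
rewrite -[n.+1%:R]natr1 -subr_ge0.
have -> : (1 - x) * (1 - n%:R * x) - (1 - (n%:R + 1) * x) = n%:R * (x * x) by ring.
by rewrite mulr_ge0// mulr_ge0.
Qed.

(** On [[1 - y, 1)] the integrand is at least [(1 - y) ^+ n]. With [n y] at most [1/2], Bernoulli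
    makes this factor at least [1/2], so moments control tails. *)
Lemma moment_lower (mu : {measure set R -> \bar R}) n (y : R) :
  (mu `[0%R, 1%R[%classic < +oo)%E -> 0 <= y <= 1 ->
  (((1 - y) ^+ n)%:E * mu `[(1 - y)%R, 1%R[%classic <= (moment mu n)%:E)%E.
Proof.
move=> mufin /andP[y0 y1]; have y1' : 0 <= 1 - y by rewrite subr_ge0.
have mD : measurable (`[0%R, 1%R[%classic : set R) by exact: measurable_itv.
have mE : measurable (`[(1 - y)%R, 1%R[%classic : set R) by exact: measurable_itv.
have mX (D : set R) : measurable_fun D (fun t : R => (t ^+ n)%:E).
  by apply/measurable_EFinP; exact: measurable_funX.
have X0 t : (`[0%R, 1%R[%classic : set R) t -> (0 <= (t ^+ n)%:E)%E.
  by rewrite /= in_itv /= => /andP[t0 _]; rewrite lee_fin exprn_ge0.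
have sE : (`[(1 - y)%R, 1%R[%classic : set R) `<=` `[0%R, 1%R[%classic.
  by move=> t /=; rewrite !in_itv /= => /andP[h ->]; rewrite (le_trans y1' h).
rewrite /moment fineK; last first.
  by apply: integrable_fin_num => //; exact: moment_integrable.
apply: le_trans (ge0_subset_integral mu mE mD (mX _) X0 sE).
rewrite -integral_cst//; apply: ge0_le_integral => //.
- by move=> t _ /=; rewrite lee_fin exprn_ge0.
- move=> t /=; rewrite in_itv /= => /andP[h _]; rewrite lee_fin.
  by rewrite lerXn2r ?nnegrE// (le_trans y1').
Qed.

(** Nonnegative terms make the partial sums at a positive radius increase to the value. *)
Lemma peval_real_ge (c : nat -> R) (r : R) n : (forall k, 0 <= c k) ->
  HD (fun k => rC (c k)) -> 0 <= r < 1 ->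
  \sum_(k < n) c k * r ^+ k <= cmod (peval (fun k => rC (c k)) (rC r)).
Proof.
move=> c0 hc /andP[r0 r1].
have z1 : cmod (rC r) < 1 by rewrite cmod_rC ger0_norm.
have [h _] := peval_cvg hc z1.
have e m : complex.Re (cpsum (fun k => rC (c k) * rC r ^+ k) m) =
    \sum_(k < m) c k * r ^+ k.
  by rewrite /cpsum Re_sum; apply: eq_bigr => k _; rewrite -rCX -rCM.
apply: le_trans (_ : complex.Re (peval (fun k => rC (c k)) (rC r)) <= _); last first.
  exact: le_trans (ler_norm _) (Re_le_cmod _).
have nd : nondecreasing_seq (fun m => complex.Re (cpsum (fun k => rC (c k) * rC r ^+ k) m)).
  apply/nondecreasing_seqP => m; rewrite !e big_ord_recr /= lerDl.
  by rewrite mulr_ge0// exprn_ge0.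
rewrite -e -(cvg_lim _ h)//.
by apply: (nondecreasing_cvgn_le nd); apply: cvgP h.
Qed.

(* The image of Lebesgue measure under [u |-> 1 - |u|^(1/s)] gives [[t, 1)]
   mass of exact order [(1 - t)^s]. *)
Lemma exists_power_measure (s : R) : 0 < s ->
  exists nu : {measure set R -> \bar R}, carleson nu s /\
  forall y : R, 0 < y <= 1 -> ((y `^ s)%:E <= nu `[(1 - y)%R, 1%R[%classic)%E.
Proof.
move=> s0; pose phi (u : R) : R := 1 - `|u| `^ s^-1.
have mphi : measurable_fun setT phi.
  apply: measurable_funB; first exact: measurable_cst.
  apply: (measurableT_comp (measurable_powR s^-1)).
  exact: normr_measurable.
have si : 0 < s^-1 by rewrite invr_gt0.
have powK (y : R) : 0 <= y -> (y `^ s) `^ s^-1 = y.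
  by move=> y0; rewrite -powRrM divff ?gt_eqF// powRr1.
have sn0 : s != 0 by rewrite gt_eqF.
have mono (u v : R) : 0 <= u -> 0 <= v -> (u `^ s^-1 <= v) -> u <= v `^ s.
  move=> u0 v0 h; rewrite -[leLHS](powRr1 u0) -(mulVf sn0) powRrM.
  by apply: ge0_ler_powR; rewrite ?nnegrE ?powR_ge0// ltW.
have mI (a b : bool) (x y : R) : measurable ([set` Interval (BSide a x) (BSide b y)] : set R).
  exact: measurable_itv.
have pre t : measurable (phi @^-1` `[t, 1%R[%classic).
  by rewrite -[X in measurable X]setTI; apply: mphi => //; exact: measurable_itv.
exists (measure_function_pushforward__canonical__measure_function_Measure
  lebesgue_measure mphi); split.
  (* The [2] counts both signs of [u]: the preimage lies in [|u| <= (1 - t)^s]. *)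
  exists 2 => t /andP[t0 t1]; pose y := (1 - t) `^ s.
  have y0 : 0 < y by rewrite powR_gt0// subr_gt0.
  have ly : (lebesgue_measure (`[(- y)%R, y]%classic : set R) <= (2 * y)%:E)%E.
    rewrite lebesgue_measure_itv /= lte_fin.
    have -> : - y < y by lra.
    by rewrite -EFinB lee_fin; lra.
  have key : (lebesgue_measure (phi @^-1` `[t, 1%R[%classic) <=
      lebesgue_measure (`[(- y)%R, y]%classic : set R))%E.
    apply: le_measure; rewrite ?inE; [exact: pre | exact: mI |].
    move=> u /=; rewrite !in_itv /= -ler_norml => /andP[h _].
    by apply: mono; rewrite ?subr_ge0 ?(ltW t1)//; move: h; rewrite /phi; lra.
  exact: le_trans key ly.
move=> y /andP[y0 y1]; pose z := y `^ s.
have z0 : 0 < z by rewrite powR_gt0.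
have lz : ((z)%:E <= lebesgue_measure (`]0%R, z]%classic : set R))%E.
  by rewrite lebesgue_measure_itv /= lte_fin z0 oppr0 adde0.
have key : (lebesgue_measure (`]0%R, z]%classic : set R) <=
    lebesgue_measure (phi @^-1` `[(1 - y)%R, 1%R[%classic))%E.
  apply: le_measure; rewrite ?inE; [exact: mI | exact: pre |].
  move=> u /=; rewrite !in_itv /= => /andP[u0 uz].
  rewrite /phi gtr0_norm// lerD2l lerN2 ltrBlDr ltrDl powR_gt0// andbT.
  rewrite -[leRHS]powK ?(ltW y0)//.
  by apply: ge0_ler_powR; rewrite ?nnegrE ?(ltW si) ?(ltW u0) ?(ltW z0).
exact: le_trans lz key.
Qed.

(** The constant function [1]: all its partial sums are [1], so the operator sends it to the
    sequence of moments. *)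
Let e0 : nat -> R[i] := fun n => (n == 0%N)%:R.

Let cpsum_e0 z n : cpsum (fun k => e0 k * z ^+ k) n.+1 = 1.
Proof.
rewrite /cpsum big_ord_recl /e0 /= expr0 mulr1 big1 ?addr0// => i _.
by rewrite mul0r.
Qed.

Let ccvg_e0 z : ccvg (cpsum (fun k => e0 k * z ^+ k)) 1.
Proof.
have : ccvg (fun n => cpsum (fun k => e0 k * z ^+ k) n.+1) 1.
  by apply: eq_ccvg (ccvg_cst 1) => n; rewrite cpsum_e0.
by move=> [h1 h2]; split; rewrite -cvg_shiftS /=; [exact: h1 | exact: h2].
Qed.

Let psums_e0 n : psums e0 n = 1.
Proof.
rewrite /psums -(cpsum_e0 1 n) /cpsum; apply: eq_bigr => i _.
by rewrite expr1n mulr1.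
Qed.

(** The function is the moment sequence of a measure with tails of exact order [s = (1 + lam) / 2].
    Its first [N] terms are at least of order [N^(- s)], so they sum to order [N^(1 - s)], and
    [1 - s = (1 - lam) / 2]. *)
Lemma Morrey_large_psums (lam : R) : 0 < lam < 1 ->
  exists2 f : nat -> R, Morrey lam (fun n => rC (f n)) & (forall n, 0 <= f n) /\
  exists2 c : R, 0 < c & forall N n, (0 < N)%N -> (N <= n)%N ->
    c * N%:R `^ ((1 - lam) / 2) <= \sum_(k < n.+1) f k.
Proof.
move=> /andP[l0 l1]; pose s := (1 + lam) / 2; have s0 : 0 < s by rewrite /s; lra.
have [nu [hnu nulow]] := exists_power_measure s0.
have [C C0 hC] := carleson_near1 s0 hnu.
have nufin : (nu `[0%R, 1%R[%classic < +oo)%E.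
  by case: hnu => M /(_ 0); rewrite lexx ltr01 => /(_ isT) h; apply: le_lt_trans h _; rewrite ltry.
have he0 : HD e0 by move=> z _; exists 1; exact: ccvg_e0.
have p0 z : peval e0 z = 1 by exact: peval_unique (ccvg_e0 z).
have hM : Morrey lam (Cmu nu e0).
  (* For the constant function [al = 1], growth constant [1] and Lipschitz constant [0]. *)
  apply: (@Cmu_Morrey R nu e0 1 1 0 s C lam) => //.
  - by move=> w _; rewrite p0 cmod1 subrr powRr0 mulr1.
  - by move=> t x y _; rewrite !p0 subrr cmod0 !mul0r.
  - by rewrite l0 ltW.
  - by rewrite /s; field.
exists (moment nu).
  have -> : (fun n => rC (moment nu n)) = Cmu nu e0; last exact: hM.
  by apply/funext => n; rewrite /Cmu -[X in _ = _ * X]/(psums e0 n) psums_e0 mulr1.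
split; first by move=> n; exact: moment_ge0.
exists ((1/2) * 2 `^ (- s)) => [|N n N0 Nn].
  by rewrite mulr_gt0 ?powR_gt0//; lra.
have n0 : 0 < N%:R :> R by rewrite ltr0n.
have hk k : (k < N)%N -> (1/2) * (2 * N%:R) `^ (- s) <= moment nu k.
  (* [y = 1 / (2 N)] keeps [k y <= 1/2] for all [k < N], while the tail has mass at least [y^s]. *)
  move=> kN; pose y : R := (2 * N%:R)^-1.
  have N2 : 0 < 2 * N%:R :> R by rewrite mulr_gt0.
  have N1 : 1 <= N%:R :> R by rewrite ler1n.
  have y01 : 0 < y <= 1 by rewrite invr_gt0 N2 /= invf_le1//; lra.
  have y01' : 0 <= y <= 1 by case/andP: y01 => /ltW -> ->.
  have h := moment_lower k nufin y01'.
  have hb : 1/2 <= (1 - y) ^+ k.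
    apply: le_trans (bernoulli_ineq k y01').
    have : k%:R * y <= 1/2.
      rewrite /y ler_pdivrMr//; have : k%:R <= N%:R :> R by rewrite ler_nat ltnW.
      by lra.
    by lra.
  rewrite -lee_fin; apply: le_trans h.
  have -> : (2 * N%:R) `^ (- s) = y `^ s.
    by rewrite /y -powR_inv1 ?(ltW N2)// -powRrM mulN1r.
  rewrite EFinM; apply: lee_pmul.
  - by rewrite lee_fin; lra.
  - by rewrite lee_fin powR_ge0.
  - by rewrite lee_fin.
  - exact: nulow.
have hsum : \sum_(k < N) moment nu k <= \sum_(k < n.+1) moment nu k.
  rewrite -!(big_mkord xpredT (moment nu)).
  rewrite [leRHS](@big_cat_nat _ _ _ N) //= ?(leq_trans Nn)//.
  by rewrite lerDl sumr_ge0// => i _; exact: moment_ge0.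
apply: le_trans hsum.
apply: le_trans (_ : \sum_(k < N) (1/2) * (2 * N%:R) `^ (- s) <= _); last first.
  by apply: ler_sum => k _; apply: hk.
rewrite sumr_const card_ord -[leRHS]mulr_natr powRM// le_eqVlt; apply/orP; left; apply/eqP.
have -> : N%:R `^ ((1 - lam) / 2) = N%:R * N%:R `^ (- s) :> R.
  rewrite -{2}(powRr1 (ltW n0)) -powRD ?(gt_eqF n0) ?implybT//.
  by congr (_ `^ _); rewrite /s; field.
by ring.
Qed.

End TestFunction.

(** * Necessity of the Carleson condition, and the equivalence *)

Section Theorem1p5.
Variable R : realType.

Lemma CmuD (mu : {measure set R -> \bar R}) (f g : nat -> R[i]) :
  Cmu mu (fun n => f n + g n) = fun n => Cmu mu f n + Cmu mu g n.
Proof. by apply/funext => n; rewrite /Cmu big_split mulrDr. Qed.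

Lemma CmuZ (mu : {measure set R -> \bar R}) (c : R[i]) (f : nat -> R[i]) :
  Cmu mu (fun n => c * f n) = fun n => c * Cmu mu f n.
Proof. by apply/funext => n; rewrite /Cmu -mulr_sumr mulrCA. Qed.

(** At [r] the block [N <= k < 2 N] of the derivative series has [N] terms, each at least
    [N mu_(2N) c N^be / 2]: moments decrease, partial sums are large and [r^(2N) >= 1/2]. The Bloch
    condition bounds the total by [M (4 N)^al]; division by [N^(be + 2)] gives the exponent. *)
Lemma Bloch_moment_decay (mu : {measure set R -> \bar R}) (f : nat -> R)
    (al be c : R) : (mu `[0%R, 1%R[%classic < +oo)%E -> 0 < al -> 0 < c ->
  (forall n, 0 <= f n) ->
  (forall N n, (0 < N)%N -> (N <= n)%N ->
    c * N%:R `^ be <= \sum_(k < n.+1) f k) ->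
  Bloch al (Cmu mu (fun n => rC (f n))) ->
  exists2 K : R, 0 <= K & forall N, (0 < N)%N ->
    moment mu (2 * N) <= K * N%:R `^ (al - be - 2).
Proof.
move=> mufin al0 c0 f0 hf hB; have [M M0 hM] := Bloch_dcoef al0 hB.
exists (2 * M * 4 `^ al / c) => [|N N0].
  by rewrite divr_ge0 ?mulr_ge0 ?powR_ge0// ltW.
pose n : R := N%:R; have n0 : 0 < n by rewrite ltr0n.
have n1 : 1 <= n by rewrite ler1n.
have N4 : 0 < 4 * n by rewrite mulr_gt0.
pose x := (4 * n)^-1; have x0 : 0 < x by rewrite invr_gt0.
have x1 : x < 1 by rewrite invf_lt1//; lra.
pose r := 1 - x.
have r01 : 0 <= r < 1 by rewrite /r; apply/andP; split; lra.
have r0 : 0 <= r by case/andP: r01.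
have r1 : r < 1 by case/andP: r01.
pose S k := \sum_(j < k.+1) f j.
pose d k := k.+1%:R * (moment mu k.+1 * S k.+1).
have S0 k : 0 <= S k by apply: sumr_ge0.
have m0 k : 0 <= moment mu k by exact: moment_ge0.
have d0 k : 0 <= d k by rewrite !mulr_ge0.
have ed : dcoef (Cmu mu (fun n => rC (f n))) = fun k => rC (d k).
  apply/funext => k; rewrite /dcoef /Cmu /d !rCM.
  have -> : rC (k.+1%:R) = k.+1%:R :> R[i] by exact: (rmorph_nat (real_complex R)).
  congr (_ * (_ * _)); rewrite /S.
  by apply/esym; exact: (rmorph_sum (real_complex R)).
have hHD : HD (fun k => rC (d k)) by rewrite -ed; apply: HD_dcoef; case: hB.
have crr : cmod (rC r) = r by rewrite cmod_rC ger0_norm.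
have up := hM (rC r); rewrite ed crr in up.
have {up}up := up r1.
have low := peval_real_ge (N + N) d0 hHD r01.
have {low}low := le_trans low up.
have r2 : 1/2 <= r ^+ (2 * N).
  have x01 : 0 <= x <= 1 by rewrite !ltW.
  apply: le_trans (bernoulli_ineq (2 * N) x01).
  rewrite natrM -/n /x.
  have -> : 2 * n * (4 * n)^-1 = 1/2 by field; rewrite gt_eqF.
  by lra.
(* The derivative shifts the index, so [d k] carries the moment of order [k.+1], still at most [2 N]
   on the block. *)
have term k : (N <= k < N + N)%N ->
    n * (moment mu (2 * N) * (c * n `^ be)) * (1/2) <= d k * r ^+ k.
  move=> /andP[Nk kN]; apply: ler_pM.
  - by rewrite !mulr_ge0 ?powR_ge0// ltW.
  - by lra.
  - rewrite /d; apply: ler_pM.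
    + exact: ltW.
    + by rewrite !mulr_ge0 ?powR_ge0// ltW.
    + by rewrite ler_nat ltnW.
    apply: ler_pM => //.
    + by rewrite mulr_ge0 ?powR_ge0// ltW.
    + by apply: moment_le => //; rewrite mul2n -addnn.
    by apply: hf => //; exact: ltnW.
  apply: le_trans r2 _; apply: ler_wiXn2l => //; first exact: ltW.
  by rewrite mul2n -addnn ltnW.
have low2 : n * (n * (moment mu (2 * N) * (c * n `^ be)) * (1/2)) <=
    \sum_(k < N + N) d k * r ^+ k.
  rewrite -(big_mkord xpredT (fun k => d k * r ^+ k)).
  rewrite (@big_cat_nat _ _ _ N) //= ?leq_addr//.
  apply: le_trans (_ : \sum_(N <= k < N + N) d k * r ^+ k <= _); last first.
    by rewrite lerDr sumr_ge0// => k _; rewrite mulr_ge0// exprn_ge0.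
  apply: le_trans (_ : \sum_(N <= k < N + N)
      (n * (moment mu (2 * N) * (c * n `^ be)) * (1/2)) <= _).
    by rewrite sumr_const_nat addnK mulr_natl.
  rewrite big_nat [leRHS]big_nat; apply: ler_sum => k hk; exact: term.
have := le_trans low2 low.
have -> : 1 - r = x by rewrite /r subKr.
have -> : x `^ (- al) = 4 `^ al * n `^ al.
  by rewrite /x -powR_inv1 ?(ltW N4)// -powRrM mulN1r opprK powRM// ltW.
have -> : n `^ (al - be - 2) = n `^ al / (n `^ be * n ^+ 2).
  rewrite -(powR_mulrn 2 (ltW n0)) -powRD ?(gt_eqF n0) ?implybT// -powRN.
  by rewrite -powRD ?(gt_eqF n0) ?implybT//; congr (_ `^ _); ring.
set m := moment _ _; set b := n `^ be; set A := n `^ al.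
have b0 : 0 < b by exact: powR_gt0.
move=> h.
have -> : 2 * M * 4 `^ al / c * (A / (b * n ^+ 2)) =
  (2 * (M * (4 `^ al * A))) / (c * (b * n ^+ 2)).
  by field; rewrite !gt_eqF.
rewrite ler_pdivlMr; last by rewrite !mulr_gt0// exprn_gt0.
have -> : m * (c * (b * n ^+ 2)) = 2 * (n * (n * (m * (c * b)) * (1/2))).
  by field.
by rewrite ler_pM2l.
Qed.

(** With [N] the integer part of [1 / (4 y)], [(1 - y)^(2N) >= 1/2], so the tail beyond [1 - y] is
    at most twice the moment of order [2 N], and [N] is comparable to [1 / y]. *)
Lemma moment_decay_carleson (mu : {measure set R -> \bar R}) (s K : R) :
  (mu `[0%R, 1%R[%classic < +oo)%E -> 0 < s -> 0 <= K ->
  (forall N, (0 < N)%N -> moment mu (2 * N) <= K * N%:R `^ (- s)) ->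
  carleson mu s.
Proof.
move=> mufin s0 K0 hK; pose m := fine (mu `[0%R, 1%R[%classic).
have m0 : 0 <= m by apply: fine_ge0.
have hm : mu `[0%R, 1%R[%classic = m%:E.
  by rewrite /m fineK// ge0_fin_numE.
exists (2 * K * 8 `^ s + m * 4 `^ s) => t /andP[t0 t1].
pose y := 1 - t; have y0 : 0 < y by rewrite subr_gt0.
have y1 : y <= 1 by rewrite gerBl.
have y01 : 0 <= y <= 1 by rewrite y1 ltW.
rewrite -/y; have -> : t = 1 - y by rewrite subKr.
(* For [y > 1/4] the integer part would be [0]; there [(4 y)^s >= 1] and the total mass suffices. *)
have [hy|hy] := leP y (1/4); last first.
  apply: le_trans (_ : m%:E <= _)%E.
    rewrite -hm; apply: le_measure; rewrite ?inE.
    - exact: measurable_itv.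
    - exact: measurable_itv.
    - move=> u /=; rewrite !in_itv /= => /andP[h ->]; rewrite andbT.
      by apply: le_trans h; rewrite subr_ge0.
  rewrite lee_fin mulrDl; apply: le_trans (_ : m * 4 `^ s * y `^ s <= _); last first.
    by rewrite lerDr !mulr_ge0// powR_ge0.
  rewrite -mulrA -powRM ?(ltW y0)// -[leLHS]mulr1; apply: ler_wpM2l => //.
  by rewrite -[leLHS](pow1R s); apply: ge0_ler_powR; rewrite ?nnegrE ?(ltW s0)//; lra.
pose N := Num.truncn ((4 * y)^-1).
have y4 : 0 < 4 * y by rewrite mulr_gt0.
have /andP[h1 h2] : N%:R <= (4 * y)^-1 < N.+1%:R.
  by apply: truncn_itv; rewrite invr_ge0 ltW.
have N0 : (0 < N)%N.
  rewrite lt0n; apply/eqP => N0; move: h2; rewrite N0 invf_lt1//; lra.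
have n0 : 0 < N%:R :> R by rewrite ltr0n.
have hb : 1/2 <= (1 - y) ^+ (2 * N).
  apply: le_trans (bernoulli_ineq (2 * N) y01).
  have : N%:R * (4 * y) <= 1.
    by have := ler_wpM2r (ltW y4) h1; rewrite mulVf ?gt_eqF.
  by rewrite natrM; lra.
have hlow := moment_lower (2 * N) mufin y01.
have hfin : (mu `[(1 - y)%R, 1%R[%classic < +oo)%E.
  apply: le_lt_trans mufin; apply: le_measure; rewrite ?inE.
  - exact: measurable_itv.
  - exact: measurable_itv.
  - move=> u /=; rewrite !in_itv /= => /andP[h ->]; rewrite andbT.
    by apply: le_trans h; rewrite subr_ge0.
have hq : mu `[(1 - y)%R, 1%R[%classic = (fine (mu `[(1 - y)%R, 1%R[%classic))%:E.
  by rewrite fineK// ge0_fin_numE.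
have q0 : 0 <= fine (mu `[(1 - y)%R, 1%R[%classic) by apply: fine_ge0.
move: hlow; rewrite hq -EFinM !lee_fin; set q := fine _ in q0 * => hlow.
have hn : N%:R `^ (- s) <= 8 `^ s * y `^ s.
  rewrite -powRM ?(ltW y0)// powRN -[leRHS]invrK lef_pV2 ?posrE ?invr_gt0 ?powR_gt0 ?mulr_gt0//.
  rewrite -powRN -mulN1r powRrM powR_inv1 ?mulr_ge0 ?(ltW y0)//.
  apply: ge0_ler_powR; rewrite ?nnegrE ?invr_ge0 ?mulr_ge0 ?(ltW s0) ?(ltW y0) ?(ltW n0)//.
  (* From [1 / (4 y) < N + 1 <= 2 N] comes [N > 1 / (8 y)], the source of the constant [8]. *)
  have hN : N.+1%:R <= 2 * N%:R :> R by rewrite -natrM ler_nat mul2n -addnn -addn1 leq_add2l.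
  have -> : (8 * y)^-1 = (4 * y)^-1 / 2 by field; rewrite gt_eqF.
  by lra.
have h3 := hK N N0.
have h4 : 1/2 * q <= K * (8 `^ s * y `^ s).
  apply: le_trans (_ : (1 - y) ^+ (2 * N) * q <= _); first exact: ler_wpM2r.
  by apply: le_trans hlow _; apply: le_trans h3 _; exact: ler_wpM2l.
have h5 : 0 <= m * 4 `^ s * y `^ s by rewrite !mulr_ge0// powR_ge0.
rewrite mulrDl; have -> : 2 * K * 8 `^ s * y `^ s = 2 * (K * (8 `^ s * y `^ s)) by ring.
by lra.
Qed.

End Theorem1p5.

Theorem theorem1p5 (R : realType) (lam1 lam2 : R)
  (mu : {finite_measure set R -> \bar R})
  (X Y : set (nat -> R[i])) (NX NY : (nat -> R[i]) -> R) :
  0 < lam1 < 1 -> 0 < lam2 <= 1 ->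
  mu (~` `[0%R, 1%R[%classic) = 0%E ->
  banach_HD X NX -> banach_HD Y NY ->
  Morrey lam1 `<=` X -> X `<=` Bloch ((3 - lam1) / 2) ->
  Morrey lam2 `<=` Y -> Y `<=` Bloch ((3 - lam2) / 2) ->
  (bounded_op (Cmu mu) X NX Y NY <->
   carleson mu (1 + (lam2 - lam1) / 2)).
Proof.
move=> l1 l2 _ bX bY MX XB MY YB.
have /andP[l10 l11] := l1; have /andP[l20 l21] := l2.
have mD : measurable (`[0%R, 1%R[%classic : set R) by exact: measurable_itv.
have mufin : (mu `[0%R, 1%R[%classic < +oo)%E.
  by rewrite -ge0_fin_numE//; exact: fin_num_measure.
set s := 1 + (lam2 - lam1) / 2.
have s0 : 0 < s by rewrite /s; lra.
split=> [[TXY _]|hcar].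
  have [f Mf [f0 [c c0 hf]]] := Morrey_large_psums l1.
  have al0 : 0 < (3 - lam2) / 2 by lra.
  have [K K0 hK] := Bloch_moment_decay mufin al0 c0 f0 hf (YB _ (TXY _ (MX _ Mf))).
  apply: (moment_decay_carleson mufin s0 K0) => N N0.
  (* The decay exponent [al - be - 2] with [al = (3 - lam2) / 2] from [Y] and [be = (1 - lam1) / 2]
     from the test function. *)
  have -> : - s = (3 - lam2) / 2 - (1 - lam1) / 2 - 2 by rewrite /s; field.
  exact: hK.
have TXY f : X f -> Y (Cmu mu f).
  move=> /XB Bf; apply: MY.
  have al1 : 1 < (3 - lam1) / 2 by lra.
  have al0 : 0 < (3 - lam1) / 2 by lra.
  have [K1 K10 hg] := Bloch_growth al1 Bf.
  have [K2 K20 hl] := Bloch_angular_lip al0 Bf.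
  have [C C0 hC] := carleson_near1 s0 hcar.
  have hf : HD f by case: Bf.
  apply: (Cmu_Morrey hf hg hl (ltW al1) K10 K20 C0 hC l2).
  by rewrite /s; field.
(* Membership gives no norm inequality by itself; it remains to bound point evaluations of the
   image, from those on [X] over the closed disc of radius [|z|]. *)
split=> //; apply: (closed_graph bX bY) => //.
- exact: CmuD.
- exact: CmuZ.
move=> z z1; have z01 : 0 <= cmod z < 1 by rewrite cmod_ge0.
have [XHD _ [N0 _] _ /(_ _ z01) [C hC]] := bX.
exists (2 * (`|C| / (1 - cmod z) * fine (mu `[0%R, 1%R[%classic))) => f Xf.
have B0 : 0 <= `|C| * NX f by rewrite mulr_ge0// N0.
have hB w : cmod w <= cmod z -> cmod (peval f w) <= `|C| * NX f.
  move=> wz; apply: le_trans (hC f Xf w wz) _.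
  by apply: ler_wpM2r; [exact: N0 | exact: ler_norm].
apply: le_trans (peval_Cmu_bound mufin (XHD _ Xf) z1 B0 hB) _.
by rewrite le_eqVlt; apply/orP; left; apply/eqP; ring.
Qed.
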